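(* Let $\phi := \frac{1+\sqrt{5}}{2}$. Let $h(n)$ be the number of shifted stacks of size $n$ and let $hs(n)$ be the number of shifted stacks with summits of size $n$. Then, as $n \to \infty$, $$h(n) \sim \frac{\phi^{-1}}{2\sqrt{2}\, 5^{3/4}\, n}\, e^{2\pi\sqrt{n/5}}, \qquad hs(n) \sim \phi \cdot h(n).$$
   Context: A shifted stack with summit of size $n\ge 1$ is a finite sequence of positive integers summing to $n$, written as $a_1, \dots, a_r, c, b_s, b_{s-1}, \dots, b_1$ with $r,s\ge 0$, in which one occurrence $c$ of the largest part is marked as the summit, such that $1 \le a_1 \le a_2 \le \dots \le a_r \le c$ and $c \ge b_s \ge b_{s-1} \ge \dots \ge b_1 \ge 1$, and such that every integer from $1$ to $c-1$ occurs at least once among $a_1,\dots,a_r$ (so the left part increases from $1$ up to $c$ in steps of at most $1$; there is no such condition on the $b_j$). Sequences with different marked occurrences of the largest part are counted as distinct. A shifted stack of size $n\ge 1$ is a finite sequence of positive integers summing to $n$, written as $a_1, \dots, a_r, c, b_s, b_{s-1}, \dots, b_1$ with $r,s\ge 0$, such that $1 \le a_1 \le a_2 \le \dots \le a_r \le c$ and $c \ge b_s \ge b_{s-1} \ge \dots \ge b_1 \ge 1$, such that every integer from $1$ to $c-1$ occurs at least once among $a_1,\dots,a_r$, and satisfying in addition $c > b_s$ (if $s \ge 1$), i.e. the summit $c$ is taken to be the last occurrence of the largest part, so each underlying sequence is counted once. For example, the shifted stacks of size $4$ are $(1,2,1)$, $(1,1,2)$, $(1,1,1,1)$, so $h(4)=3$,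 and $hs(4)=6$. By convention $h(0)=hs(0)=1$. With $(q)_m := \prod_{j=1}^{m}(1-q^j)$, the generating functions are $$\sum_{n\ge 0} h(n)q^n = 1+\sum_{m\ge 1}\frac{q^{m(m+1)/2}}{(q)_{m-1}^2(1-q^m)}, \qquad \sum_{n\ge 0} hs(n)q^n = \sum_{m\ge 0}\frac{q^{m(m+1)/2}}{(q)_m^2}.$$ Here $f(n)\sim g(n)$ means $f(n)/g(n)\to 1$. *)

(* Defs.v *)
From mathcomp Require Import all_boot all_order all_algebra.
From mathcomp Require Import finmap.
From mathcomp Require Import all_classical all_reals all_analysis.

Set Implicit Arguments.
Unset Strict Implicit.
Unset Printing Implicit Defensive.

Import Order.TTheory GRing.Theory Num.Theory.
Import numFieldNormedType.Exports.

Local Open Scope classical_set_scope.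

(* The sequence a_1, ..., a_r, c, b_s, ..., b_1 with marked summit c is encoded
   as the triple (a, c, b) with a = [:: a_1; ...; a_r] and
   b = [:: b_s; ...; b_1]: both parts are listed from left to right. *)
Definition is_shifted_stack_with_summit (n : nat)
    (a : seq nat) (c : nat) (b : seq nat) : bool :=
  [&& all (leq 1) (a ++ c :: b),
      sorted leq (rcons a c),
      sorted geq (c :: b),
      all (fun k => k \in a) (iota 1 c.-1)
    & sumn (a ++ c :: b) == n].

(* [all (gtn c) (take 1 b)] is the condition c > b_s if s >= 1. *)
Definition is_shifted_stack (n : nat)
    (a : seq nat) (c : nat) (b : seq nat) : bool :=
  is_shifted_stack_with_summit n a c b && all (gtn c) (take 1 b).

(* Distinct markings of one sequence are distinct triples. *)
Definition shifted_stacks_with_summit (n : nat) :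
    set (seq nat * nat * seq nat) :=
  [set t | is_shifted_stack_with_summit n t.1.1 t.1.2 t.2].

Definition shifted_stacks (n : nat) : set (seq nat) :=
  [set s | exists a c b, s = a ++ c :: b /\ is_shifted_stack n a c b].

(* [fset_set A] is empty when A is infinite; finiteness of the sets counted
   below shows that this case does not occur. *)
Lemma sub_positive_range (n : nat) (s : seq nat) :
  all (leq 1) s -> sumn s <= n ->
  range (fun t : n.-bseq 'I_n.+1 => map val t) s.
Proof.
move=> s_pos s_le.
have size_sumn u : all (leq 1) u -> size u <= sumn u.
  elim: u => //= x u IH /andP[x_pos u_pos].
  by rewrite -add1n leq_add ?IH.
have mem_le u x : x \in u -> x <= sumn u.
  elim: u => //= y u IH; rewrite inE => /orP[/eqP ->|/IH xu].
    exact: leq_addr.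
  exact: leq_trans xu (leq_addl _ _).
have s_size : size (map (@inord n) s) <= n.
  by rewrite size_map (leq_trans (size_sumn _ s_pos)).
exists (Bseq s_size) => //=; rewrite -map_comp -[RHS]map_id.
apply/eq_in_map => x xs /=.
by rewrite inordK // ltnS (leq_trans (mem_le _ _ xs)).
Qed.

Lemma shifted_stacks_with_summit_finite (n : nat) :
  finite_set (shifted_stacks_with_summit n).
Proof.
apply: (@sub_finite_set _ _ ((range (fun t : n.-bseq 'I_n.+1 => map val t)
    `*` `I_n.+1) `*` range (fun t : n.-bseq 'I_n.+1 => map val t))).
  move=> [[a c] b] /= /and5P[pos _ _ _ /eqP sum_n].
  move: pos sum_n; rewrite all_cat /= sumn_cat /=.
  move=> /and3P[a_pos _ b_pos] sum_n.
  split=> /=; first split=> /=.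
  - by apply: sub_positive_range; rewrite // -sum_n leq_addr.
  - by rewrite ltnS -sum_n addnCA leq_addr.
  - by apply: sub_positive_range; rewrite // -sum_n addnA leq_addl.
by do 2?[apply: finite_setX]; do ?[exact: finite_II];
  apply: finite_image; exact: finite_finset.
Qed.

Lemma shifted_stacks_finite (n : nat) : finite_set (shifted_stacks n).
Proof.
apply: (@sub_finite_set _ _ ((fun t => t.1.1 ++ t.1.2 :: t.2) @`
    shifted_stacks_with_summit n)).
  by move=> s [a [c [b [-> /andP[abc _]]]]]; exists (a, c, b).
exact: finite_image (shifted_stacks_with_summit_finite n).
Qed.

Definition h (n : nat) : nat :=
  if n is 0 then 1 else #|` fset_set (shifted_stacks n)|%fset.

Definition hs (n : nat) : nat :=
  if n is 0 then 1 else #|` fset_set (shifted_stacks_with_summit n)|%fset.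

Local Open Scope ring_scope.

Definition asymp_equiv (R : realType) (f g : nat -> R) : Prop :=
  f n / g n @[n --> \oo] --> (1 : R).

Definition phi (R : realType) : R := (1 + Num.sqrt 5) / 2.

(* Main.v *)
(** Consider pairs of partitions with parts at most [m], the first of which
    contains every part of [1, ..., m]. Graded by total size they have the
    generating function [x^(m(m+1)/2) / (x)_m^2]; forbidding the part [m] in the
    second partition multiplies it by [1 - x^m]. So [hs n = S_0 n] and
    [h n = S_0 n - S_1 n], where [S_w n] is the sum over [m] of the coefficients
    of [x^(n - w m)].

    Each coefficient is a Fourier integral over the circle [|x| = e^-t] of a
    product of factors [1 / (sh(jt)^2 + 4 sin^2(j theta / 2))], with
    [sh s = e^(s/2) - e^-(s/2)], times the cosine of a phase. The products at
    [theta = 0] peak where [sh(m t) = 1], that is at [m t = v = 2 ln phi]; the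
    peak value comes from Stirling's formula and from the dilogarithm value
    [int_0^v ln sh = - pi^2 / 10]. On the scale [m = v / t + x / sqrt t],
    [theta = t^(3/2) y], with [t] near [pi / sqrt (5 n)], the sum over [m] and
    the integral over [theta] converge, by dominated convergence, to a Gaussian
    integral in [(x, y)]. Shifting [n] by [w m] only contributes the factor
    [e^(-w v) = phi^(-2 w)], whence the ratio [1 - phi^-2 = phi^-1] of [h] to
    [hs]. *)
Require Import Defs.
From mathcomp Require Import all_boot all_order all_algebra.
From mathcomp Require Import finmap.
From mathcomp Require Import all_classical all_reals all_analysis.
From mathcomp Require Import measurable_realfun.
From mathcomp Require Import zify ring lra.
Set Implicit Arguments.
Unset Strict Implicit.
Unset Printing Implicit Defensive.
Import Order.TTheory GRing.Theory Num.Theory.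
Import numFieldNormedType.Exports.
Local Open Scope classical_set_scope.
Local Open Scope ring_scope.

(** All [m] share one circle, so the peak index depends on [t] alone and the sum over [m] and the
    integral over the angle become one double limit. The integrals stay real: a factor is carried by
    its modulus and a continuous choice of its argument, and the coefficient formula follows from a
    second order recurrence in the exponent that both sides satisfy. The parameter [t] is the saddle
    point rounded so that [v / t] is an integer [M]; the peak then falls on a summand. As
    [n t + pi^2 / (5 t)] is stationary at the saddle point, the rounding costs only a factor
    [1 + o(1)]. The dilogarithm value acts twice: in the height of the peak, and in the slope of the
    phase at angle 0. Both give [pi^2 / 5], so the phase is stationary exactly where the exponent
    is. The delicate point is domination. A majorant [K / (1 + y^2)] for the modulus, uniform over
    the whole circle, is obtained when [2 m >= M]; for smaller [m] the trivial bound, of order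
    [t^(-3/2)], is absorbed by the Gaussian decay of the peak values in [m]. *)

(** * Derivatives of real functions *)

Section Derivatives.
Context {R : realType}.
Implicit Types (f g : R -> R) (x a b : R).

(* Typing the function as [R -> R], rather than between normed modules, keeps
   the ring operations in it syntactically those of [R]. *)
Definition has_derive f x a := is_derive x (1 : R) f a.

Lemma derive_eq f x a b : has_derive f x a -> a = b -> has_derive f x b.
Proof. by move=> ? <-. Qed.

Lemma derive_cst (c : R) x : has_derive (fun _ => c) x 0.
Proof. exact: is_derive_cst. Qed.

Lemma derive_id x : has_derive (fun y => y) x 1.
Proof. exact: is_derive_id. Qed.

Lemma derive_add f g x a b : has_derive f x a -> has_derive g x b ->
  has_derive (fun y => f y + g y) x (a + b).
Proof. by move=> ? ?; apply: is_deriveD. Qed.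

Lemma derive_opp f x a : has_derive f x a -> has_derive (fun y => - f y) x (- a).
Proof. by move=> ?; apply: is_deriveN. Qed.

Lemma derive_mul f g x a b : has_derive f x a -> has_derive g x b ->
  has_derive (fun y => f y * g y) x (f x * b + g x * a).
Proof. by move=> ? ?; apply: is_deriveM. Qed.

Lemma derive_exp f n x a : has_derive f x a ->
  has_derive (fun y => f y ^+ n.+1) x (n.+1%:R * f x ^+ n * a).
Proof.
move=> fa; elim: n => [|n IH].
  rewrite mul1r expr0 mul1r.
  by rewrite (_ : (fun y => f y ^+ 1) = f)//; apply/funext => y; rewrite expr1.
rewrite (_ : (fun y => _) = (fun y => f y * f y ^+ n.+1)); last first.
  by apply/funext => y; rewrite exprS.
apply: derive_eq (derive_mul fa IH) _.
by rewrite exprS -[in RHS]natr1; ring.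
Qed.

Lemma derive_inv f x a : has_derive f x a -> f x != 0 ->
  has_derive (fun y => (f y)^-1) x (- (f x) ^- 2 * a).
Proof. move=> [fd fa] fx; apply: (DeriveDef (derivableV fx fd)).
by rewrite deriveV// fa. Qed.

Lemma derive_comp (F : R -> R) f x a b : has_derive F (f x) b -> has_derive f x a ->
  has_derive (fun y => F (f y)) x (b * a).
Proof. by move=> Fb fa; have := @is_derive1_comp _ F f x b a Fb fa. Qed.

Lemma derive_expR f x a : has_derive f x a ->
  has_derive (fun y => expR (f y)) x (expR (f x) * a).
Proof. by apply: derive_comp; exact: is_derive_expR. Qed.

Lemma derive_ln f x a : has_derive f x a -> 0 < f x ->
  has_derive (fun y => ln (f y)) x ((f x)^-1 * a).
Proof. by move=> fa f0; apply: (derive_comp (F := @ln R)) fa; exact: is_derive1_ln. Qed.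

Lemma derive_sin f x a : has_derive f x a ->
  has_derive (fun y => sin (f y)) x (cos (f x) * a).
Proof. by apply: derive_comp; exact: is_derive_sin. Qed.

Lemma derive_cos f x a : has_derive f x a ->
  has_derive (fun y => cos (f y)) x (- sin (f x) * a).
Proof. by apply: derive_comp; exact: is_derive_cos. Qed.

Lemma derive_atan f x a : has_derive f x a ->
  has_derive (fun y => atan (f y)) x ((1 + (f x) ^+ 2)^-1 * a).
Proof. by apply: derive_comp; exact: is_derive1_atan. Qed.

Lemma derive_continuous f x a : has_derive f x a -> {for x, continuous f}.
Proof. by move=> [fx _]; apply/differentiable_continuous/derivable1_diffP. Qed.

Lemma continuous_derive f : (forall x, exists a, has_derive f x a) -> continuous f.
Proof. by move=> df x; have [a] := df x; exact: derive_continuous. Qed.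

Lemma derive_derive1 f x a : has_derive f x a -> derive1 f x = a.
Proof. by move=> [_ <-]; rewrite derive1E. Qed.

Lemma derive_derivable f x a : has_derive f x a -> derivable f x 1.
Proof. by case. Qed.

Lemma mean_value f (df : R -> R) a b : a < b ->
  (forall x, a <= x <= b -> has_derive f x (df x)) ->
  exists2 c, a < c < b & f b - f a = df c * (b - a).
Proof.
move=> ab dfE.
have [c cab fE] := @MVT R f df a b ab
  (fun x xab => dfE x (subset_itv_oo_cc xab)) (derivable_within_continuous
    (i := `[a, b]) (fun x xab => @ex_derive _ _ _ _ _ _ _ (dfE x xab))).
by exists c.
Qed.

Lemma derive_ge0_le f (df : R -> R) a b : a <= b ->
  (forall x, a <= x <= b -> has_derive f x (df x)) ->
  (forall x, a <= x <= b -> 0 <= df x) -> f a <= f b.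
Proof.
rewrite le_eqVlt => /predU1P[->//|ab] dfE df0.
have [c /andP[ac cb] fE] := mean_value ab dfE.
by rewrite -subr_ge0 fE mulr_ge0 ?subr_ge0 ?(ltW ab)// df0 ?(ltW ac) ?(ltW cb).
Qed.

Lemma derive0_cst f a b : a <= b ->
  (forall x, a <= x <= b -> has_derive f x 0) -> f a = f b.
Proof.
rewrite le_eqVlt => /predU1P[->//|ab] dfE.
have [c _ /eqP] := mean_value ab dfE.
by rewrite mul0r subr_eq0 => /eqP.
Qed.

Lemma cvg_fun (T : Type) (F : set_system T) {FF : Filter F} (u : T -> R) f (l : R) :
  {for l, continuous f} -> u x @[x --> F] --> l -> f (u x) @[x --> F] --> f l.
Proof. by move=> fl ul; exact: (cvg_comp u f ul fl). Qed.

Lemma cvg_eq (T : Type) (F : set_system T) (u : T -> R) (l l' : R) :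
  u x @[x --> F] --> l -> l = l' -> u x @[x --> F] --> l'.
Proof. by move=> ? <-. Qed.

End Derivatives.

(** Syntax-directed differentiation. Leaves are closed from the context, so derivatives of functions
    such as [sh] are put there beforehand. [derive] leaves the side conditions of inverses and
    logarithms, then the equality of the computed and the expected derivative. *)
Ltac derive_step :=
  lazymatch goal with
  | |- has_derive (fun _ => ?c) _ _ => apply (derive_cst c)
  | |- has_derive (fun y => @?f y + @?g y) _ _ => eapply (@derive_add _ f g)
  | |- has_derive (fun y => @?f y * @?g y) _ _ => eapply (@derive_mul _ f g)
  | |- has_derive (fun y => - @?f y) _ _ => eapply (@derive_opp _ f)
  | |- has_derive (fun y => (@?f y)^-1) _ _ => eapply (@derive_inv _ f)
  | |- has_derive (fun y => (@?f y) ^+ _.+1) _ _ => eapply (@derive_exp _ f)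
  | |- has_derive (fun y => expR (@?f y)) _ _ => eapply (@derive_expR _ f)
  | |- has_derive (fun y => ln (@?f y)) _ _ => eapply (@derive_ln _ f)
  | |- has_derive (fun y => sin (@?f y)) _ _ => eapply (@derive_sin _ f)
  | |- has_derive (fun y => cos (@?f y)) _ _ => eapply (@derive_cos _ f)
  | |- has_derive (fun y => atan (@?f y)) _ _ => eapply (@derive_atan _ f)
  | |- has_derive (fun y => y) _ _ => apply derive_id
  | |- has_derive _ _ _ => solve [eassumption | eauto with nocore]
  end.
Ltac derive := eapply derive_eq; [repeat derive_step | cbv beta].


(** * Integrals over the line and Gaussian integrals *)

Section Integrals.
Context {R : realType}.
Notation mu := (@lebesgue_measure R).
Implicit Types (f g F : R -> R) (a b x : R).

Lemma continuous_integrable f a b : continuous f ->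
  mu.-integrable `[a, b] (EFin \o f).
Proof.
move=> cf; apply: continuous_compact_integrable; first exact: segment_compact.
exact: continuous_subspaceT.
Qed.

Lemma integral_derive F f a b : a <= b -> continuous f ->
  (forall x, has_derive F x (f x)) -> \int[mu]_(x in `[a, b]) f x = F b - F a.
Proof.
rewrite le_eqVlt => /predU1P[<- _ _|ab cf dF].
  by rewrite set_itv1 Rintegral_set1 subrr.
rewrite /Rintegral (@continuous_FTC2 _ f F)//.
- exact: continuous_subspaceT.
- split.
  + by move=> x _; exact: derive_derivable (dF x).
  + by apply: cvg_at_right_filter; exact: derive_continuous (dF a).
  + by apply: cvg_at_left_filter; exact: derive_continuous (dF b).
- by move=> x _; exact: derive_derive1 (dF x).
Qed.

Lemma Rintegral_dominated (f_ : nat -> R -> R) f g :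
  (forall n, measurable_fun setT (f_ n)) ->
  (forall x, f_ n x @[n --> \oo] --> f x) ->
  mu.-integrable setT (EFin \o g) ->
  (\forall n \near \oo, forall x, `|f_ n x| <= g x) ->
  mu.-integrable setT (EFin \o f) /\
  \int[mu]_x f_ n x @[n --> \oo] --> \int[mu]_x f x.
Proof.
move=> mf_ f_f ig [N _ f_g].
have mf : measurable_fun setT f.
  apply/measurable_EFinP; apply: (@emeasurable_fun_cvg _ _ _ _ (fun n x => (f_ n x)%:E)).
    by move=> n; exact/measurable_EFinP.
  by move=> x _; apply: cvg_EFin; [exact: nearW|exact: f_f].
(* The domination only holds from [N] on, hence the shift of the sequence by [N]. *)
have [] := @dominated_convergence _ _ R mu setT measurableT
  (fun n x => (f_ (n + N)%N x)%:E) (EFin \o f) (EFin \o g).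
- by move=> n; apply/measurable_EFinP; exact: mf_.
- by apply/measurable_EFinP; exact: mf.
- apply: aeW => x _; apply: cvg_EFin; first exact: nearW.
  by have := f_f x; rewrite -(cvg_shiftn N).
- exact: ig.
- by apply: aeW => x n _; rewrite lee_fin f_g//= leq_addl.
move=> intf _ cvgf; split => //.
rewrite -(cvg_shiftn N); apply: fine_cvg.
rewrite fineK; first exact: cvgf.
exact: integrable_fin_num.
Qed.

Lemma integrable_oneDsqrV : mu.-integrable setT (EFin \o (fun y : R => (1 + y ^+ 2)^-1)).
Proof.
have mf : measurable_fun setT (fun y : R => (1 + y ^+ 2)^-1).
  by apply: continuous_measurable_fun; exact: continuous_oneDsqrV.
apply/integrableP; split; first exact/measurable_EFinP.
have E (y : R) : 0 <= (1 + y ^+ 2)^-1 by rewrite invr_ge0 addr_ge0 ?sqr_ge0.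
under eq_integral => y _ do rewrite /= ger0_norm//.
rewrite ge0_symfun_integralT//.
- rewrite (_ : [set x | _] = `[0, +oo[%classic); last first.
    by apply/seteqP; split => x/=; rewrite in_itv/= andbT.
  by rewrite integral0y_oneDsqr -EFinM ltry.
- exact: continuous_oneDsqrV.
- by move=> x /=; rewrite sqrrN.
Qed.

Definition gauss a x := expR (- (a * x ^+ 2)).

Lemma integrable_integral_gauss a : 0 < a ->
  mu.-integrable setT (EFin \o gauss a) /\
  \int[mu]_x gauss a x = Num.sqrt (pi / a).
Proof.
(* The standard deviation for which the normal density is proportional to [gauss a]. *)
move=> a0; pose s := (Num.sqrt (2 * a))^-1.
have s0 : s != 0 by rewrite invr_neq0// gt_eqF// sqrtr_gt0 mulr_gt0.
have sE : s ^+ 2 *+ 2 = a^-1.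
  by rewrite exprVn sqr_sqrtr ?mulr_ge0 1?ltW// -mulr_natl; field; lra.
have peak : normal_peak s = (Num.sqrt (pi / a))^-1.
  by rewrite /normal_peak -mulrnAl sE mulrC.
have p0 : 0 < Num.sqrt (pi / a) by rewrite sqrtr_gt0 divr_gt0 ?pi_gt0.
have E x : gauss a x = Num.sqrt (pi / a) * normal_pdf 0 s x.
  rewrite normal_pdfE// peak mulVKf ?gt_eqF// /normal_fun subr0 sE invrK.
  by rewrite mulNr mulrC.
have int := @integrable_normal_pdf R 0 s.
rewrite (_ : gauss a = fun x => Num.sqrt (pi / a) * normal_pdf 0 s x); last exact/funext.
split; first exact: (integrableZl measurableT _ int).
by rewrite RintegralZl// /Rintegral integral_normal_pdf mulr1.
Qed.

Lemma cvg_gauss_nat a : 0 < a -> gauss a n%:R @[n --> \oo] --> 0.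
Proof.
move=> a0; have q : `|expR (- a)| < 1 by rewrite ger0_norm ?expR_ge0// expR_lt1 oppr_lt0.
apply: (@squeeze_cvgr _ _ _ _ (cst 0) (fun n => expR (- a) ^+ n)).
- apply: nearW => n /=; rewrite expR_ge0 /gauss -expRM_natl ler_expR.
  rewrite mulrN lerN2 (mulrC n%:R) ler_wpM2l ?(ltW a0)// -natrX ler_nat.
  by case: n => // n; rewrite expnS expn1 leq_pmull.
- exact: cvg_cst.
- exact: cvg_expr.
Qed.

Lemma measurable_restrict_itv f a b : continuous f ->
  measurable_fun setT (f \_ `[a, b]).
Proof.
move=> cf; pose I : set R := `[a, b]%classic.
have mI : measurable I by exact: measurable_itv.
rewrite -/I; apply/measurable_restrict => //.
by apply: measurable_funTS; exact: continuous_measurable_fun.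
Qed.

Lemma integral_derive_eq0 F f : continuous f -> (forall x, has_derive F x (f x)) ->
  mu.-integrable setT (EFin \o f) ->
  F n%:R @[n --> \oo] --> 0 -> F (- n%:R) @[n --> \oo] --> 0 ->
  \int[mu]_x f x = 0.
Proof.
move=> cf dF intf F0 FN0.
have mf : measurable_fun setT f by exact: continuous_measurable_fun.
pose I (n : nat) : set R := `[- n%:R, n%:R]%classic.
have [] := @Rintegral_dominated (fun n => f \_ (I n)) f (fun x => `|f x|).
- by move=> n; exact: measurable_restrict_itv.
- move=> x; apply: cvg_near_cst; exists (Num.truncn `|x|).+1 => // n /= xn.
  rewrite patchE ifT// inE /I /= in_itv /= -ler_norml.
  by rewrite (le_trans (ltW (truncnS_gt _)))// ler_nat.
- exact: (integrable_abse intf).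
- by apply: nearW => n x; rewrite patchE; case: ifP => // _; rewrite normr0.
move=> _; have -> : (fun n => \int[mu]_x (f \_ (I n)) x) = (fun n => F n%:R - F (- n%:R)).
  apply/funext => n; rewrite -Rintegral_mkcond (integral_derive (F := F))//.
  by rewrite ge0_cp.
move=> lim; have lim0 : F n%:R - F (- n%:R) @[n --> \oo] --> (0 : R).
  by rewrite -[X in _ --> X](subrr (0 : R)); exact: cvgB.
exact: (cvg_unique _ lim lim0).
Qed.

(** Half of the exponent absorbs the factor [|x|], by [1 + u <= e^u]. This is the majorant for
    differentiation under the integral sign. *)
Lemma gauss_moment_le a x : 0 < a -> `|x| * gauss a x <= (1 + 2 / a) * gauss (a / 2) x.
Proof.
move=> a0; rewrite (_ : gauss a x = gauss (a / 2) x * gauss (a / 2) x); last first.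
  by rewrite /gauss -expRD; congr expR; field.
rewrite mulrA ler_wpM2r ?expR_ge0// /gauss expRN ler_pdivrMr ?expR_gt0//.
apply: (@le_trans _ _ ((1 + 2 / a) * (1 + a / 2 * x ^+ 2))); last first.
  by rewrite ler_wpM2l ?expR_ge1Dx// addr_ge0// divr_ge0// ltW.
have -> : (1 + 2 / a) * (1 + a / 2 * x ^+ 2) = (1 + x ^+ 2) + (2 / a + a / 2 * x ^+ 2).
  by field; lra.
have x2 : x ^+ 2 = `|x| ^+ 2 by rewrite real_normK ?num_real.
have a1 : 0 <= 2 / a by rewrite divr_ge0// ltW.
have a2 : 0 <= a / 2 * x ^+ 2 by rewrite mulr_ge0 ?sqr_ge0//; lra.
rewrite ler_wpDr ?addr_ge0//.
rewrite x2; nra.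
Qed.

Lemma integrable_gauss_bounded a (p : R -> R) c : 0 < a -> continuous p ->
  (forall x, `|p x| <= c * gauss a x) -> mu.-integrable setT (EFin \o p).
Proof.
move=> a0 cp pc; have [ig _] := integrable_integral_gauss a0.
apply: (le_integrable measurableT _ _ (integrableZl measurableT c ig)).
  by apply/measurable_EFinP; exact: continuous_measurable_fun.
by move=> x _ /=; rewrite lee_fin (le_trans (pc x))// ler_norm.
Qed.

(** Differentiation under the integral sign and an integration by parts give
    [G'(b) = - b / (2 a) G(b)], so [G(b) e^(b^2 / (4 a))] is constant. *)
Lemma integral_gauss_cos a b : 0 < a ->
  \int[mu]_x (gauss a x * cos (b * x)) =
  Num.sqrt (pi / a) * expR (- (b ^+ 2 / (4 * a))).
Proof.
move=> a0; have a20 : 0 < a / 2 by lra.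
pose G b := \int[mu]_x (gauss a x * cos (b * x)).
have dg (x : R) : has_derive (gauss a) x (- (2 * a * x) * gauss a x).
  by rewrite /gauss; derive; ring.
have db c y : has_derive (fun c => gauss a y * cos (c * y)) c (- (y * gauss a y * sin (c * y))).
  by derive; ring.
have cont (p dp : R -> R) : (forall x, has_derive p x (dp x)) -> continuous p.
  by move=> pdp x; exact: derive_continuous (pdp x).
have int_cos c : mu.-integrable setT (EFin \o (fun x => gauss a x * cos (c * x))).
  apply: (@integrable_gauss_bounded a _ 1) => //.
    by eapply cont => x; repeat derive_step.
  move=> x; rewrite normrM mul1r ger0_norm ?expR_ge0// ler_piMr ?expR_ge0//.
  by rewrite ler_norml cos_geN1 cos_le1.
have int_sin c : mu.-integrable setT (EFin \o (fun x => x * gauss a x * sin (c * x))).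
  apply: (@integrable_gauss_bounded (a / 2) _ (1 + 2 / a)) => //.
    by eapply cont => x; repeat derive_step.
  move=> x; apply: le_trans (gauss_moment_le _ a0); rewrite !normrM.
  rewrite (ger0_norm (expR_ge0 _)) ler_piMr ?mulr_ge0 ?expR_ge0//.
  by rewrite ler_norml sin_geN1 sin_le1.
have dG c : has_derive G c (- \int[mu]_x (x * gauss a x * sin (c * x))).
  pose f c x := gauss a x * cos (c * x).
  have := @cvg_differentiation_under_integral R _ _ mu f setT measurableT c (c - 1) (c + 1).
  have partialE d y : partial1of2 f d y = - (y * gauss a y * sin (d * y)).
    exact: derive_derive1 (db d y).
  have H : c \in `](c - 1), (c + 1)[ by rewrite in_itv/=; lra.
  move=> /(_ H (fun d _ => int_cos d) (fun d y _ _ => derive_derivable (db d y))).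
  move=> /(_ (fun y => (1 + 2 / a) * gauss (a / 2) y)).
  have [ig _] := integrable_integral_gauss a20.
  have b1 y : 0 <= (1 + 2 / a) * gauss (a / 2) y.
    by rewrite mulr_ge0 ?expR_ge0// addr_ge0// divr_ge0// ltW.
  have b2 d y : (`](c - 1), (c + 1)[%classic : set R) d -> [set: R] y ->
      `|partial1of2 f d y| <= (1 + 2 / a) * gauss (a / 2) y.
    move=> _ _; rewrite partialE normrN.
    apply: le_trans (gauss_moment_le _ a0); rewrite !normrM.
    rewrite (ger0_norm (expR_ge0 _)) ler_piMr ?mulr_ge0 ?expR_ge0//.
    by rewrite ler_norml sin_geN1 sin_le1.
  move=> /(_ b1 (integrableZl measurableT _ ig) b2) L.
  have E : \int[mu]_y (partial1of2 f c y) = - \int[mu]_x (x * gauss a x * sin (c * x)).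
    rewrite -mulN1r -RintegralZl//; apply: eq_Rintegral => y _.
    by rewrite partialE mulN1r.
  rewrite E in L; split.
    by apply/cvg_ex; eexists; under eq_fun do rewrite scaler1; exact: L.
  by rewrite -derive1E; apply/cvg_lim => //; exact: L.
(* Integration by parts: the derivative of [gauss a x * sin (c * x)] has integral 0. *)
have ode c : \int[mu]_x (x * gauss a x * sin (c * x)) = c / (2 * a) * G c.
  have E x : has_derive (fun x => gauss a x * sin (c * x)) x
      (c * (gauss a x * cos (c * x)) - 2 * a * (x * gauss a x * sin (c * x))).
    by derive; ring.
  have := @integral_derive_eq0 _ _ _ E.
  rewrite RintegralB//; last 2 first.
  - exact: (integrableZl measurableT _ (int_cos c)).
  - exact: (integrableZl measurableT _ (int_sin c)).
  rewrite !RintegralZl// -/(G c) => H.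
  have : c * G c - 2 * a * \int[mu]_x (x * gauss a x * sin (c * x)) = 0.
    apply: H.
    - by eapply cont => x; repeat derive_step.
    - exact: (integrableB measurableT (integrableZl measurableT _ (int_cos c))
        (integrableZl measurableT _ (int_sin c))).
    - apply: norm_cvg0; apply: (@squeeze_cvgr _ _ _ _ (cst 0) (fun n => gauss a n%:R)).
      + apply: nearW => n /=; rewrite normr_ge0 normrM ger0_norm ?expR_ge0//.
        by rewrite ler_piMr ?expR_ge0// ler_norml sin_geN1 sin_le1.
      + exact: cvg_cst.
      + exact: cvg_gauss_nat.
    - apply: norm_cvg0; apply: (@squeeze_cvgr _ _ _ _ (cst 0) (fun n => gauss a n%:R)).
      + apply: nearW => n /=; rewrite normr_ge0 normrM ger0_norm ?expR_ge0//.
        rewrite {1}/gauss sqrrN -/(gauss a n%:R).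
        by rewrite ler_piMr ?expR_ge0// ler_norml sin_geN1 sin_le1.
      + exact: cvg_cst.
      + exact: cvg_gauss_nat.
  set S := \int[mu]_x _ => H0.
  have {H0} H0 : 2 * a * S = c * G c by lra.
  by apply: (mulfI (_ : 2 * a != 0)); [lra | rewrite H0; field; lra].
have dH c : has_derive (fun c => G c * expR (c ^+ 2 / (4 * a))) c 0.
  eapply derive_eq; first by repeat derive_step; exact: dG.
  by rewrite ode; cbv beta; field; lra.
have cst c d : c <= d -> G c * expR (c ^+ 2 / (4 * a)) = G d * expR (d ^+ 2 / (4 * a)).
  by move=> cd; apply: (derive0_cst (f := fun c => G c * expR (c ^+ 2 / (4 * a))) cd).
have G0 : G 0 * expR (0 ^+ 2 / (4 * a)) = Num.sqrt (pi / a).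
  rewrite expr0n mul0r expR0 mulr1 -(integrable_integral_gauss a0).2.
  by apply: eq_Rintegral => x _; rewrite mul0r cos0 mulr1.
rewrite -/(G b) expRN; apply/eqP; rewrite eq_sym -subr_eq0 -G0; apply/eqP.
have -> : G 0 * expR (0 ^+ 2 / (4 * a)) = G b * expR (b ^+ 2 / (4 * a)).
  by have [|] := leP 0 b => [/cst//|/ltW/cst->].
by rewrite mulfK ?subrr// gt_eqF// expR_gt0.
Qed.

End Integrals.

(** * Fourier integrals of the products *)

Section Fourier.
Context {R : realType}.
Notation mu := (@lebesgue_measure R).
Implicit Types (s t w y z eps theta : R) (m n : nat) (N : int).

(** Twice the hyperbolic functions at [s / 2]: then [(1 - q)^2 = q sh(s)^2] for [q = e^(-s)], and no
    factor 2 appears in the modulus of a factor. *)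
Definition sh s := expR (s / 2) - expR (- (s / 2)).
Definition ch s := expR (s / 2) + expR (- (s / 2)).

Lemma ch2 s : ch s ^+ 2 = sh s ^+ 2 + 4.
Proof.
rewrite /ch /sh expRN; have : expR (s / 2) != 0 by rewrite gt_eqF ?expR_gt0.
by move: (expR _) => e e0; field.
Qed.

Lemma sh_gt0 s : 0 < s -> 0 < sh s.
Proof. by move=> s0; rewrite subr_gt0 ltr_expR; lra. Qed.

Lemma ch_gt0 s : 0 < ch s.
Proof. by rewrite addr_gt0 ?expR_gt0. Qed.

Lemma derive_sh s : has_derive sh s (ch s / 2).
Proof. by rewrite /sh /ch; derive; ring. Qed.

Lemma derive_ch s : has_derive ch s (sh s / 2).
Proof. by rewrite /sh /ch; derive; ring. Qed.

(* The factor [q e^(iw) / (1 - q e^(iw))^2], [q = e^(-s)], of the generating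
   function has modulus [(fden s w)^-1] and argument [ang s w]. *)
Definition fden s w := sh s ^+ 2 + 4 * sin (w / 2) ^+ 2.
Definition ang s w :=
  w + 2 * atan (expR (- s) * sin w / (1 - expR (- s) * cos w)).

Lemma fden_gt0 s w : 0 < s -> 0 < fden s w.
Proof.
move=> s0; rewrite ltr_wpDr ?exprn_gt0 ?sh_gt0//.
by rewrite mulr_ge0 ?sqr_ge0.
Qed.

Lemma fdenE s w : expR (- s) * fden s w =
  1 - 2 * expR (- s) * cos w + expR (- s) ^+ 2.
Proof.
have -> : expR (- s) = expR (- (s / 2)) ^+ 2 by rewrite -expRM_natl; congr expR; field.
rewrite /fden /sh expRN; have : expR (s / 2) != 0 by rewrite gt_eqF ?expR_gt0.
have {2}-> : w = (w / 2) *+ 2 by rewrite -mulr_natr; field.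
rewrite cos_mulr2n cos2sin2.
by move: (expR _) (sin _) => e x e0; field.
Qed.

Lemma ang_cden_gt0 s w : 0 < s -> 0 < 1 - expR (- s) * cos w.
Proof.
move=> s0; rewrite subr_gt0.
have q1 : expR (- s) < 1 by rewrite expR_lt1 oppr_lt0.
by rewrite (le_lt_trans _ q1)// ler_piMr ?expR_ge0 ?cos_le1.
Qed.

(** Real part of [e^(i (z + ang)) (1 - q e^(iw))^2 = q fden e^(i (z + w))], [q = e^(-s)], with the
    square expanded. It holds because [ang] is the argument of [q e^(iw) / (1 - q e^(iw))^2] and
    [q fden = |1 - q e^(iw)|^2]. *)
Lemma cos_fden s w z : 0 < s ->
  cos (z + ang s w) - 2 * expR (- s) * cos (z + ang s w + w) +
  expR (- s) ^+ 2 * cos (z + ang s w + w *+ 2) =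
  expR (- s) * fden s w * cos (z + w).
Proof.
move=> s0; rewrite fdenE /ang; have := ang_cden_gt0 w s0.
move: (expR (- s)) => q c0.
set x := q * sin w / _; set a := atan x.
have ca0 : 0 < cos a by rewrite cos_gt0_pihalf// atan_gtNpi2 atan_ltpi2.
have sa : sin a * (1 - q * cos w) = q * sin w * cos a.
  have : tan a = x by rewrite /a atanK.
  rewrite /tan => /(congr1 (fun y => y * cos a * (1 - q * cos w))).
  by rewrite /x divfK ?gt_eqF// => ->; field; rewrite gt_eqF.
rewrite [z + _ + w *+ 2](_ : _ = (z + w) + a *+ 2 + w *+ 2); last first.
  by rewrite !(mulr2n, mulrDl, mul1r); ring.
rewrite [z + _ + w](_ : _ = (z + w) + a *+ 2 + w); last by rewrite !(mulr2n, mulrDl, mul1r); ring.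
rewrite [z + _](_ : _ = (z + w) + a *+ 2); last by rewrite !(mulr2n, mulrDl, mul1r); ring.
have cos2 (u : R) : cos (u *+ 2) = cos u ^+ 2 - sin u ^+ 2.
  by rewrite mulr2n cosD; ring.
have sin2 (u : R) : sin (u *+ 2) = 2 * (cos u * sin u).
  by rewrite sin_mulr2n; ring.
rewrite ![cos (z + w + a *+ 2 + _)]cosD !(cosD (z + w)) !(sinD (z + w)) !cos2 !sin2.
have := cos2Dsin2 a; have := cos2Dsin2 w; move: sa ca0.
move: (cos (z + w)) (sin (z + w)) => C S.
move: (cos a) (sin a) (cos w) (sin w) c0 => ca sia cw sw c0 sa ca0 Ew Ea.
have B0 : (1 - q * cw) * sia - q * sw * ca = 0 by rewrite mulrC sa subrr.
(* [A + i B = (1 - q e^(iw)) e^(ia)], which the choice of [a] makes real: [B = 0]. *)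
pose A := (1 - q * cw) * ca + q * sw * sia.
pose B := (1 - q * cw) * sia - q * sw * ca.
transitivity (C * (A ^+ 2 - B ^+ 2) - S * (2 * A * B)); first by rewrite /A /B; ring.
transitivity (C * ((ca ^+ 2 + sia ^+ 2) * ((1 - q * cw) ^+ 2 + q ^+ 2 * sw ^+ 2))).
  transitivity (C * (A ^+ 2 + B ^+ 2)); first by rewrite /B B0; ring.
  by rewrite /A /B; ring.
have sw2 : sw ^+ 2 = 1 - cw ^+ 2 by lra.
by rewrite Ea sw2; ring.
Qed.

(** Modulus and argument, at [x = e^(-t + i theta)], of the product of the [x^j / (1 - x^j)^2] for
    [1 <= j <= m]. Summing the arguments of the factors keeps the phase continuous in [theta]. *)
Definition amp t m theta := \prod_(1 <= j < m.+1) (fden (j%:R * t) (j%:R * theta))^-1.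
Definition phase t m theta := \sum_(1 <= j < m.+1) ang (j%:R * t) (j%:R * theta).

Lemma amp_ge0 t m theta : 0 < t -> 0 <= amp t m theta.
Proof.
move=> t0; rewrite /amp big_seq prodr_ge0// => j; rewrite mem_index_iota => /andP[j0 _].
by rewrite invr_ge0 ltW// fden_gt0// mulr_gt0// ltr0n.
Qed.

Lemma amp_le t m theta : 0 < t -> amp t m theta <= amp t m 0.
Proof.
move=> t0; rewrite /amp big_seq [leRHS]big_seq.
apply: ler_prod => j; rewrite mem_index_iota => /andP[j0 _].
have jt : 0 < j%:R * t by rewrite mulr_gt0// ltr0n.
rewrite invr_ge0 ltW ?fden_gt0//= lef_pV2 ?posrE ?fden_gt0//.
by rewrite /fden mulr0 mul0r sin0 expr0n mulr0 addr0 lerDl mulr_ge0 ?sqr_ge0.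
Qed.

(** The derivative is the Poisson kernel [(1 - q^2) / |1 - q e^(iw)|^2], [q = e^(-s)]. *)
Lemma derive_ang s w : 0 < s -> has_derive (ang s) w (sh s * ch s / fden s w).
Proof.
move=> s0; have c0 := ang_cden_gt0 w s0; rewrite /ang.
eapply derive_eq; first by repeat derive_step; rewrite gt_eqF.
have -> : fden s w = (1 - 2 * expR (- s) * cos w + expR (- s) ^+ 2) / expR (- s).
  by rewrite -fdenE mulrC mulKf// gt_eqF ?expR_gt0.
have -> : sh s * ch s = (expR (- s))^-1 - expR (- s).
  rewrite /sh /ch -subr_sqr -!expRM_natl -expRN opprK.
  by congr (expR _ - expR _); field.
have q0 := expR_gt0 (- s); have q1 : expR (- s) < 1 by rewrite expR_lt1 oppr_lt0.
have := cos2Dsin2 w; have cw := cos_le1 w; have cwN := cos_geN1 w.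
move: c0; cbv beta; move: (expR (- s)) q0 q1 => q q0 q1.
move: (cos w) cw cwN (sin w) => c c1 cN1 sn q2 E.
have D0 : 0 < 1 - 2 * q * c + q ^+ 2.
  have -> : 1 - 2 * q * c + q ^+ 2 = (1 - q * c) ^+ 2 + q ^+ 2 * sn ^+ 2.
    by have -> : sn ^+ 2 = 1 - c ^+ 2; [lra | ring].
  by rewrite ltr_wpDr ?exprn_gt0// mulr_ge0 ?sqr_ge0.
have N0 : 1 - q * c != 0 by lra.
have D1 : (1 - q * c) ^+ 2 + (q * sn) ^+ 2 = 1 - 2 * q * c + q ^+ 2.
  by have E2 : sn ^+ 2 = 1 - c ^+ 2; [lra | rewrite exprMn E2; ring].
have -> : (1 + (q * sn / (1 - q * c)) ^+ 2)^-1 =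
    (1 - q * c) ^+ 2 / (1 - 2 * q * c + q ^+ 2).
  by rewrite -D1; field; rewrite N0 /= D1 gt_eqF.
set D := 1 - 2 * q * c + q ^+ 2 in D0 *.
transitivity (1 + 2 * ((q * c * (1 - q * c) - q ^+ 2 * sn ^+ 2) / D)).
  by field; rewrite N0 gt_eqF.
have -> : sn ^+ 2 = 1 - c ^+ 2 by lra.
transitivity ((D + 2 * (q * c - q ^+ 2)) / D); first by field; rewrite gt_eqF.
by rewrite {1}/D; field; rewrite !gt_eqF.
Qed.

Lemma amp0 t theta : amp t 0 theta = 1.
Proof. by rewrite /amp big_geq. Qed.

Lemma phase0 t theta : phase t 0 theta = 0.
Proof. by rewrite /phase big_geq. Qed.

Lemma ampS t m theta :
  amp t m.+1 theta = amp t m theta / fden (m.+1%:R * t) (m.+1%:R * theta).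
Proof. by rewrite /amp big_nat_recr. Qed.

Lemma phaseS t m theta :
  phase t m.+1 theta = phase t m theta + ang (m.+1%:R * t) (m.+1%:R * theta).
Proof. by rewrite /phase big_nat_recr. Qed.

Lemma continuous_phase t m : 0 < t -> continuous (phase t m).
Proof.
move=> t0; elim: m => [|m IH] theta.
  rewrite (_ : phase t 0 = fun=> 0); last by apply/funext => x; rewrite phase0.
  exact: cvg_cst.
rewrite (_ : phase t m.+1 = fun x =>
    phase t m x + ang (m.+1%:R * t) (m.+1%:R * x)); last first.
  by apply/funext => x; rewrite phaseS.
apply: cvgD; first exact: IH.
have s0 : 0 < m.+1%:R * t by rewrite mulr_gt0.
have H : continuous (fun x : R => ang (m.+1%:R * t) (m.+1%:R * x)).
  apply: continuous_derive => x; eexists.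
  by apply: derive_comp; [exact: derive_ang | repeat derive_step].
exact: H.
Qed.

Lemma continuous_amp t m : 0 < t -> continuous (amp t m).
Proof.
move=> t0; elim: m => [|m IH] theta.
  rewrite (_ : amp t 0 = fun=> 1); last by apply/funext => x; rewrite amp0.
  exact: cvg_cst.
rewrite (_ : amp t m.+1 = fun x =>
    amp t m x / fden (m.+1%:R * t) (m.+1%:R * x)); last first.
  by apply/funext => x; rewrite ampS.
apply: cvgM; first exact: IH.
have s0 : 0 < m.+1%:R * t by rewrite mulr_gt0.
apply: cvgV; first by rewrite gt_eqF ?fden_gt0.
have H : continuous (fun x : R => fden (m.+1%:R * t) (m.+1%:R * x)).
  by apply: continuous_derive => x; eexists; rewrite /fden; repeat derive_step.
exact: H.
Qed.

(* [eps] rescales the angle [theta = eps * y]. *)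
Definition fourier t eps m N :=
  eps / (2 * pi) * \int[mu]_(y in `[- (pi / eps), pi / eps])
    (amp t m (eps * y) * cos (phase t m (eps * y) - N%:~R * (eps * y))).

Lemma continuous_fourier_integrand t eps m N : 0 < t -> continuous (fun y =>
  amp t m (eps * y) * cos (phase t m (eps * y) - N%:~R * (eps * y))).
Proof.
move=> t0 y.
have lin (c : R) : continuous (fun y => c * y).
  by apply: continuous_derive => z; eexists; repeat derive_step.
apply: cvgM.
  by apply: (continuous_comp (f := fun y => eps * y)); [exact: lin|exact: continuous_amp].
apply: (@continuous_comp _ _ _ (fun y => phase t m (eps * y) - N%:~R * (eps * y)) cos);
  last exact: continuous_cos.
apply: cvgB.
  by apply: (continuous_comp (f := fun y => eps * y)); [exact: lin|exact: continuous_phase].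
have H : continuous (fun y : R => N%:~R * (eps * y)).
  by apply: continuous_derive => z; eexists; repeat derive_step.
exact: H.
Qed.

Lemma sin_natpi n : sin (pi *+ n) = 0 :> R.
Proof.
by elim: n => [|n IH]; rewrite ?mulr0n ?sin0// mulrS addrC sinDpi IH oppr0.
Qed.

Lemma sin_intpi N : sin (N%:~R * pi) = 0 :> R.
Proof.
case: N => n; first by rewrite -pmulrn mulr_natl sin_natpi.
by rewrite NegzE mulrNz mulNr sinN -pmulrn mulr_natl sin_natpi oppr0.
Qed.

Lemma fourier0 t eps N : 0 < eps -> fourier t eps 0 N = (N == 0)%:R.
Proof.
move=> e0; have pe : - (pi / eps) <= pi / eps.
  by rewrite ge0_cp// divr_ge0 ?pi_ge0// ltW.
rewrite /fourier; have [->|N0] := eqVneq N 0.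
  have c1 : continuous (fun _ : R => 1 : R) by move=> ?; exact: cvg_cst.
  have d1 (x : R) : has_derive (fun y : R => y) x 1 by exact: derive_id.
  have E := integral_derive pe c1 d1.
  under eq_Rintegral do rewrite amp0 phase0 mul0r subr0 cos0 mul1r.
  rewrite E (_ : true%:R = 1 :> R)//; have := pi_gt0 R.
  by move: (@pi R) => p p0; field; rewrite !gt_eqF.
under eq_Rintegral do rewrite amp0 phase0 sub0r cosN mul1r.
have Ne : N%:~R * eps != 0 by rewrite mulf_neq0 ?intr_eq0// gt_eqF.
pose f y : R := cos (N%:~R * (eps * y)).
have dF (y : R) : has_derive (fun y : R => sin (N%:~R * (eps * y)) / (N%:~R * eps)) y (f y).
  rewrite /f; derive; field.
  by move: Ne; rewrite mulf_eq0 negb_or => /andP[-> ->].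
have cf : continuous f.
  by apply: continuous_derive => y; eexists; rewrite /f; repeat derive_step.
rewrite (integral_derive pe cf dF).
have -> : N%:~R * (eps * (pi / eps)) = N%:~R * pi.
  by field; rewrite gt_eqF.
have -> : N%:~R * (eps * - (pi / eps)) = - (N%:~R * pi).
  by field; rewrite gt_eqF.
by rewrite sinN sin_intpi oppr0 mul0r subrr mulr0.
Qed.

(** Multiplying the product for [m + 1] by [(1 - x^(m+1))^2] leaves [x^(m+1)] times the product for
    [m]. The powers of [q] appear because [fourier] is the coefficient of [x^N] weighted by
    [e^(- N t)]. *)
Lemma fourierS t eps m N : 0 < t -> let q := expR (- (m.+1%:R * t)) in
  fourier t eps m.+1 N - 2 * q * fourier t eps m.+1 (N - m.+1%:Z) +
    q ^+ 2 * fourier t eps m.+1 (N - m.+1%:Z *+ 2) =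
  q * fourier t eps m (N - m.+1%:Z).
Proof.
move=> t0 q; rewrite /fourier.
have int k M : mu.-integrable `[- (pi / eps), pi / eps] (EFin \o (fun y =>
    amp t k (eps * y) * cos (phase t k (eps * y) - M%:~R * (eps * y)))).
  by apply: continuous_integrable; exact: continuous_fourier_integrand.
have intZ (c : R) k M : mu.-integrable `[- (pi / eps), pi / eps] (EFin \o (fun y =>
    c * (amp t k (eps * y) * cos (phase t k (eps * y) - M%:~R * (eps * y))))).
  apply: continuous_integrable => y; apply: cvgM; first exact: cvg_cst.
  exact: continuous_fourier_integrand.
rewrite !(mulrCA _ (eps / (2 * pi))) -mulrBr -mulrDr; congr (_ * _).
rewrite -!RintegralZl//.
rewrite -RintegralB//.
rewrite -RintegralD//; last first.
  apply: continuous_integrable => y; apply: cvgB.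
    exact: continuous_fourier_integrand.
  apply: cvgM; first exact: cvg_cst.
  exact: continuous_fourier_integrand.
apply: eq_Rintegral => y _; set th := eps * y.
have s0 : 0 < m.+1%:R * t by rewrite mulr_gt0.
rewrite ampS phaseS.
have := @cos_fden (m.+1%:R * t) (m.+1%:R * th) (phase t m th - N%:~R * th) s0.
have f0 := fden_gt0 (m.+1%:R * th) s0.
rewrite -/q; set D := fden _ _ in f0 *; set g := ang _ _; set A := amp _ _ _.
have z1 : phase t m th + g - N%:~R * th = phase t m th - N%:~R * th + g by ring.
have z2 : phase t m th + g - (N - m.+1%:Z)%:~R * th =
    phase t m th - N%:~R * th + g + m.+1%:R * th by rewrite intrB -pmulrn; ring.
have z3 : phase t m th + g - (N - m.+1%:Z *+ 2)%:~R * th =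
    phase t m th - N%:~R * th + g + (m.+1%:R * th) *+ 2.
  by rewrite intrB rmorphMn /= -pmulrn; ring.
have z4 : phase t m th - (N - m.+1%:Z)%:~R * th =
    phase t m th - N%:~R * th + m.+1%:R * th by rewrite intrB -pmulrn; ring.
rewrite z1 z2 z3 z4 => H; have f1 : D != 0 by rewrite gt_eqF.
apply: (mulfI f1).
transitivity (A * (q * D * cos (phase t m th - N%:~R * th + m.+1%:R * th))); last by ring.
by rewrite -H; field; rewrite gt_eqF.
Qed.

(** The bound is uniform in [N]: after multiplication by [e^(N t)] it yields decay at [-oo], the
    boundary condition that singles out one solution of the recurrence. *)
Lemma fourier_bounded t eps m : 0 < t -> 0 < eps ->
  forall N, `|fourier t eps m N| <= amp t m 0.
Proof.
move=> t0 e0 N; have pe : - (pi / eps) <= pi / eps.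
  by rewrite ge0_cp// divr_ge0 ?pi_ge0// ltW.
have c1 : continuous (fun _ : R => amp t m 0) by move=> ?; exact: cvg_cst.
have cF := @continuous_fourier_integrand t eps m N t0.
rewrite /fourier normrM ger0_norm; last first.
  by rewrite divr_ge0 ?mulr_ge0 ?pi_ge0// ltW.
have le : `|\int[mu]_(y in `[- (pi / eps), pi / eps])
    (amp t m (eps * y) * cos (phase t m (eps * y) - N%:~R * (eps * y)))| <=
    \int[mu]_(y in `[- (pi / eps), pi / eps]) amp t m 0.
  apply: le_trans; first by apply: le_normr_Rintegral => //; exact: continuous_integrable.
  apply: le_Rintegral => //; first exact: (integrable_abse (continuous_integrable _ _ cF)).
    exact: continuous_integrable.
  move=> y _; rewrite normrM ger0_norm ?amp_ge0//.
  by rewrite (le_trans _ (amp_le m (eps * y) t0))// ler_piMr ?amp_ge0// ler_norml cos_geN1 cos_le1.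
have d1 (x : R) : has_derive (fun y : R => amp t m 0 * y) x (amp t m 0).
  by derive; ring.
rewrite (integral_derive pe c1 d1) in le.
apply: le_trans (ler_wpM2l _ le) _; first by rewrite divr_ge0 ?mulr_ge0 ?pi_ge0// ltW.
rewrite le_eqVlt; apply/orP; left; apply/eqP; have := pi_gt0 R.
by move: (@pi R) => p p0; field; rewrite !gt_eqF.
Qed.

End Fourier.

(** * Counting stacks by pairs of partitions *)

Section Counting.
Local Open Scope nat_scope.
Implicit Types (a b s : seq nat) (c k l m n : nat).

(* The pairs (rcons a c, b) obtained from the stacks (a, c, b) with summit [m]
   and right part bounded by [l]. *)
Definition stack_pairs m l n : set (seq nat * seq nat) :=
  [set x | [&& sorted leq x.1, all (fun k => 0 < k <= m) x.1,
    all (fun k => k \in x.1) (iota 1 m), sorted geq x.2,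
    all (fun k => 0 < k <= l) x.2 & sumn x.1 + sumn x.2 == n]].

Definition nb_pairs m l n : nat := #|` fset_set (stack_pairs m l n)|%fset.

Lemma stack_pairsP m l n a b : stack_pairs m l n (a, b) <->
  [/\ sorted leq a /\ all (fun k => 0 < k <= m) a,
    forall k, 0 < k <= m -> k \in a, sorted geq b,
    all (fun k => 0 < k <= l) b & sumn a + sumn b = n].
Proof.
split=> [/and5P[a1 a2 a3 b1 /andP[b2 /eqP ab]]|[[a1 a2] a3 b1 b2 ab]].
  by split => // k km; apply: (allP a3); rewrite mem_iota add1n ltnS.
apply/and5P; split => //; last by rewrite b2 ab eqxx.
by apply/allP => k; rewrite mem_iota add1n ltnS; exact: a3.
Qed.

Lemma finite_stack_pairs m l n : finite_set (stack_pairs m l n).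
Proof.
apply: (@sub_finite_set _ _ (range (fun t : n.-bseq 'I_n.+1 => map val t)
    `*` range (fun t : n.-bseq 'I_n.+1 => map val t))).
  have pos s k : all (fun j => 0 < j <= k) s -> all (leq 1) s.
    by apply: sub_all => j /andP[].
  move=> [a b] /= /and5P[_ a_pos _ _ /andP[b_pos /eqP sum_n]]; split => /=.
  - by apply: sub_positive_range; rewrite ?(pos a m)// -sum_n leq_addr.
  - by apply: sub_positive_range; rewrite ?(pos b l)// -sum_n leq_addl.
by apply: finite_setX; apply: finite_image; exact: finite_finset.
Qed.

Lemma card_setU (T : choiceType) (A B : set T) : finite_set A -> finite_set B ->
  A `&` B = set0 ->
  #|` fset_set (A `|` B)|%fset = #|` fset_set A|%fset + #|` fset_set B|%fset.
Proof.
move=> fA fB AB0; rewrite fset_setU// cardfsU -fset_setI// AB0 fset_set0.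
by rewrite cardfs0 subn0.
Qed.

Lemma card_image (T U : choiceType) (f : T -> U) (A : set T) : finite_set A ->
  {in A &, injective f} -> #|` fset_set (f @` A)|%fset = #|` fset_set A|%fset.
Proof.
move=> fA f_inj; rewrite fset_set_image// card_in_imfset// => x y.
by rewrite !in_fset_set//; exact: f_inj.
Qed.

Lemma sorted_leq_rcons a c : sorted leq (rcons a c) = all (geq c) a && sorted leq a.
Proof. by rewrite !(sorted_pairwise leq_trans) pairwise_rcons. Qed.

Lemma sorted_geq_cons b c : sorted geq (c :: b) = all (geq c) b && sorted geq b.
Proof.
have geq_trans : transitive geq by move=> x y z yx xz; exact: leq_trans xz yx.
by rewrite !(sorted_pairwise geq_trans).
Qed.

(** A part [l + 1] of the right partition, if there is one, is its first entry and can be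
    removed. *)
Lemma nb_pairs_right m l n : nb_pairs m l.+1 (n + l.+1) =
  nb_pairs m l (n + l.+1) + nb_pairs m l.+1 n.
Proof.
pose f (x : seq nat * seq nat) := (x.1, l.+1 :: x.2).
have f_inj : injective f by move=> [a b] [a' b'] [-> ->].
rewrite /nb_pairs -(card_image (finite_stack_pairs m l.+1 n) (in2W f_inj)).
rewrite -card_setU; [|exact: finite_stack_pairs
  |exact: finite_image (finite_stack_pairs _ _ _)|]; last first.
  apply/seteqP; split => // x [/= /and5P[_ _ _ _ /andP[+ _]]] [y _ yx].
  by rewrite -yx /= ltnn.
congr #|` fset_set _|%fset; apply/seteqP; split => [[a b]|[a b] [|]].
- move=> /stack_pairsP[a1 a3 b1 b2 ab].
  have [bl|] := boolP (all (fun k => 0 < k <= l) b).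
    by left; apply/stack_pairsP.
  case: b b1 b2 ab => [//|c b] b1 /andP[/andP[c0 cl] b2] ab nb.
  have cE : c = l.+1.
    apply/eqP; rewrite eqn_leq cl /= ltnNge; apply: contra nb => cl'.
    rewrite /= c0 cl' /=; move: b1; rewrite sorted_geq_cons => /andP[bc _].
    apply/allP => k kb; have /andP[-> _] := allP b2 k kb.
    exact: leq_trans (allP bc k kb) cl'.
  right; exists (a, b); last by rewrite /f /= -cE.
  move: b1; rewrite sorted_geq_cons => /andP[_ b1].
  by apply/stack_pairsP; split => //; move: ab; rewrite /= cE; lia.
- move=> /and5P[/= a1 a2 a3 b1 /andP[b2 ab]]; apply/and5P; split => //=.
  rewrite ab andbT; apply: sub_all b2 => k /andP[-> kl]; exact: leqW.
- case=> -[a' b'] /and5P[/= a1 a2 a3 b1 /andP[b2 ab]] [<- <-].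
  apply/and5P; split => //=.
    rewrite -/(sorted geq (l.+1 :: b')) sorted_geq_cons b1 andbT.
    by apply: sub_all b2 => k /andP[].
  by rewrite b2 ltnSn /= addnCA addnC eqn_add2r.
Qed.

(** The left partition must contain [m + 1], as its last entry. After removal of that entry the rest
    either still contains [m + 1] or has all its parts at most [m], whence the two terms. *)
Lemma nb_pairs_left m l n :
  nb_pairs m.+1 l (n + m.+1) = nb_pairs m.+1 l n + nb_pairs m l n.
Proof.
pose f (x : seq nat * seq nat) := (rcons x.1 m.+1, x.2).
have f_inj : injective f by move=> [a b] [a' b'] [/rcons_inj[-> ->]].
rewrite /nb_pairs -card_setU; [|exact: finite_stack_pairs..|]; last first.
  apply/seteqP; split => // x [/= /and3P[_ _ /andP[+ _]]] /and3P[_ + _].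
  move=> /allP/(_ m.+1); rewrite mem_iota add1n ltnSn => /(_ isT) mx.
  by move=> /allP/(_ m.+1 mx); rewrite ltnn andbF.
rewrite -[RHS](card_image (f := f)); last 2 first.
- by rewrite finite_setU; split; exact: finite_stack_pairs.
- exact: in2W.
congr #|` fset_set _|%fset; apply/seteqP; split => [[a b]|_ [[a b] ab <-]].
- move=> /stack_pairsP[[a1 a2] a3 b1 b2 ab].
  have ma : m.+1 \in a by rewrite a3 ?ltnSn.
  case: (lastP a) ma a1 a2 a3 ab => [//|a' c] ma a1 a2 a3 ab.
  move: a1; rewrite sorted_leq_rcons => /andP[ac a1].
  move: a2; rewrite all_rcons => /andP[/andP[c0 cm] a2].
  have cE : c = m.+1.
    apply/eqP; rewrite eqn_leq cm /=; move: ma; rewrite mem_rcons inE => /orP[/eqP->//|].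
    exact: (allP ac).
  exists (a', b); last by rewrite /f /= cE.
  have ab' : sumn a' + sumn b = n by move: ab; rewrite sumn_rcons cE; lia.
  have a3' k : 0 < k <= m -> k \in a'.
    move=> /andP[k0 km]; have : k \in rcons a' c by rewrite a3// k0 leqW.
    by rewrite mem_rcons inE cE => /orP[/eqP kE|//]; rewrite kE ltnn in km.
  have [m1a|m1a] := boolP (m.+1 \in a').
    left; apply/stack_pairsP; split => // k /andP[k0].
    by rewrite leq_eqVlt => /orP[/eqP->//|km]; rewrite a3' // k0.
  right; apply/stack_pairsP; split => //; split => //.
  apply/allP => k ka; have /andP[-> /=] := allP a2 k ka.
  by rewrite leq_eqVlt => /orP[/eqP kE|//]; rewrite -kE ka in m1a.
- rewrite /f /=; case: ab => /stack_pairsP[[a1 a2] a3 b1 b2 ab];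
    apply/stack_pairsP; split => //; rewrite ?sumn_rcons -?ab; try lia.
  + split; last by rewrite all_rcons a2 ltnSn.
    by rewrite sorted_leq_rcons a1 andbT; apply: sub_all a2 => k /andP[].
  + by move=> k /a3; rewrite mem_rcons inE orbC => ->.
  + split; last first.
      by rewrite all_rcons ltnSn /=; apply: sub_all a2 => k /andP[-> km]; exact: leqW.
    rewrite sorted_leq_rcons a1 andbT; apply: sub_all a2 => k /andP[_].
    exact: leqW.
  + move=> k; rewrite mem_rcons inE => /andP[k0].
    by rewrite leq_eqVlt => /orP[->//|km]; rewrite a3 ?orbT// k0.
Qed.

Lemma nb_pairs_small m l n : n < m -> nb_pairs m l n = 0.
Proof.
move=> nm; rewrite /nb_pairs (_ : stack_pairs m l n = set0) ?fset_set0 ?cardfs0//.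
apply/seteqP; split => // -[a b] /and5P[/= _ _ a3 _ /andP[_ /eqP ab]].
have ma : m \in a by rewrite (allP a3)// mem_iota; lia.
have : m <= sumn a.
  elim: a ma {a3 ab} => //= x a IH; rewrite inE => /orP[/eqP->|/IH]; lia.
lia.
Qed.

Lemma nb_pairs00 n : nb_pairs 0 0 n = (n == 0).
Proof.
rewrite /nb_pairs; have [->|n0] := eqVneq n 0.
  rewrite (_ : stack_pairs 0 0 0 = [set ([::], [::])]) ?fset_set1 ?cardfs1//.
  apply/seteqP; split => [[[|x a] [|y b]]|_ ->] //= /and5P[/= _].
  - by move=> _ _ _ /andP[/andP[]]; lia.
  - by move=> /andP[]; lia.
  - by move=> /andP[]; lia.
rewrite (_ : stack_pairs 0 0 n = set0) ?fset_set0 ?cardfs0//.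
apply/seteqP; split => // -[[|x a] [|y b]] /and5P[/= _].
- by move=> _ _ _ /eqP nE; rewrite -nE in n0.
- by move=> _ _ _ /andP[/andP[]]; lia.
- by move=> /andP[]; lia.
- by move=> /andP[]; lia.
Qed.

Lemma shifted_stack_with_summitE n a c b :
  is_shifted_stack_with_summit n a c b =
  (0 < c) && `[< stack_pairs c c n (rcons a c, b) >].
Proof.
apply/idP/andP => [/and5P[pos a1 cb a3 /eqP sum]|[c0 /asboolP/stack_pairsP]].
  move: pos; rewrite all_cat /= => /and3P[pa c0 pb].
  split => //; apply/asboolP/stack_pairsP.
  move: cb; rewrite -/(sorted geq (c :: b)) sorted_geq_cons => /andP[bc b1].
  have /andP[ac _] : all (geq c) a && sorted leq a by rewrite -sorted_leq_rcons.
  split => //.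
  - split => //; rewrite all_rcons c0 leqnn /=.
    by apply/allP => k ka; rewrite (allP pa k ka) /=; exact: (allP ac k ka).
  - move=> k /andP[k0]; rewrite mem_rcons inE leq_eqVlt => /orP[->//|kc].
    by rewrite (allP a3) ?orbT// mem_iota k0 /= add1n prednK.
  - by apply/allP => k kb; rewrite (allP pb k kb) /=; exact: (allP bc k kb).
  - by rewrite sumn_rcons -addnA -sum sumn_cat.
move=> [[a1 a2] a3 b1 b2 sum]; apply/and5P; split => //.
- move: a2; rewrite all_rcons all_cat /= c0 => /andP[_ a2].
  by apply/andP; split; [apply: sub_all a2|apply: sub_all b2] => k /andP[].
- rewrite -/(sorted geq (c :: b)) sorted_geq_cons b1 andbT.
  by apply: sub_all b2 => k /andP[].
- apply/allP => k; rewrite mem_iota add1n prednK// => /andP[k0 kc].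
  have : k \in rcons a c by rewrite a3// k0 ltnW.
  by rewrite mem_rcons inE => /orP[/eqP kE|//]; rewrite kE ltnn in kc.
- by rewrite sumn_cat /= addnA -sumn_rcons sum.
Qed.

Lemma shifted_stackE n a c b : is_shifted_stack n a c b =
  (0 < c) && `[< stack_pairs c c.-1 n (rcons a c, b) >].
Proof.
rewrite /is_shifted_stack shifted_stack_with_summitE -andbA.
case: (posnP c) => //= c0.
apply/andP/asboolP => [[/asboolP/stack_pairsP[a1 a2 b1 b2 sum] bc]|].
  apply/stack_pairsP; split => //; apply/allP => k kb.
  have /andP[-> _] /= := allP b2 k kb; rewrite -ltnS prednK//.
  case: b kb b1 bc {b2 sum} => //= x b; rewrite inE => kb.
  rewrite -/(sorted geq (x :: b)) sorted_geq_cons take0 /= andbT => /andP[bx _] xc.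
  by case/orP: kb => [/eqP->//|/(allP bx) kx]; exact: leq_ltn_trans kx xc.
move=> /stack_pairsP[a1 a2 b1 b2 sum]; split.
  apply/asboolP/stack_pairsP; split => //; apply: sub_all b2 => k /andP[-> kc].
  exact: leq_trans kc (leq_pred _).
case: b b1 b2 {sum} => //= x b _ /andP[/andP[_ +] _].
by rewrite take0 /= andbT; lia.
Qed.

Lemma card_bigcup (T : choiceType) (A : nat -> set T) n :
  (forall k, finite_set (A k)) -> (forall k l x, A k x -> A l x -> k = l) ->
  #|` fset_set (\bigcup_(k in `I_n) A k)|%fset = \sum_(k < n) #|` fset_set (A k)|%fset.
Proof.
move=> fA dA; elim: n => [|n IH].
  by rewrite II0 bigcup_set0 big_ord0 fset_set0 cardfs0.
rewrite IIS bigcup_setU bigcup_set1 card_setU//; last 2 first.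
- by apply: bigcup_finite => //; exact: finite_II.
- apply/seteqP; split => // x [[k /= kn xk] xn].
  by rewrite (dA _ _ _ xk xn) ltnn in kn.
by rewrite IH big_ord_recr.
Qed.

Lemma last_stack_pairs m l n x : 0 < m -> stack_pairs m l n x -> last 0 x.1 = m.
Proof.
case: x => a b m0 /stack_pairsP[[a1 a2] a3 _ _ _] /=.
have : m \in a by rewrite a3// m0 leqnn.
case: (lastP a) a1 a2 => // a' c; rewrite sorted_leq_rcons all_rcons last_rcons.
move=> /andP[ac _] /andP[/andP[_ cm] _].
rewrite mem_rcons inE => /orP[/eqP->//|/(allP ac) mc].
by apply/eqP; rewrite eqn_leq cm.
Qed.

(** The summit is the last entry of the first partition, so a triple is recovered from its pair and
    the pairs for different summits are disjoint. Summits range over [1, ..., n] because a part is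
    at most the total size. *)
Lemma card_stacks (B : set (seq nat * nat * seq nat)) (l : nat -> nat) n :
  (forall a c b, B (a, c, b) <-> 0 < c /\ stack_pairs c (l c) n (rcons a c, b)) ->
  #|` fset_set B|%fset = \sum_(m < n) nb_pairs m.+1 (l m.+1) n.
Proof.
move=> BE; pose f (x : seq nat * nat * seq nat) := (rcons x.1.1 x.1.2, x.2).
have f_inj : injective f.
  by move=> [[a c] b] [[a' c'] b'] [/rcons_inj[-> ->] ->].
have fBE : f @` B = \bigcup_(k in `I_n) stack_pairs k.+1 (l k.+1) n.
  apply/seteqP; split => [_ [[[a c] b] /BE[c0 abc] <-]|[a b] [k /= kn ab]].
    exists c.-1 => /=; rewrite prednK//; move/stack_pairsP: abc => [_ _ _ _ <-].
    by rewrite sumn_rcons; lia.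
  move: (last_stack_pairs (ltn0Sn k) ab) (ab) => /=.
  case: (lastP a) => [//|a' c]; rewrite last_rcons => cE abc.
  by exists (a', c, b) => //; apply/BE; move: abc; rewrite -cE; split => //; rewrite cE.
have fB : finite_set B.
  rewrite (_ : B = f @^-1` (f @` B)); last first.
    by apply/seteqP; split => [x Bx|x [y By /f_inj <-]//]; exists x.
  apply: finite_preimage; first exact: in2W.
  by rewrite fBE; apply: bigcup_finite => *; [exact: finite_II|exact: finite_stack_pairs].
rewrite -(card_image fB (in2W f_inj)) fBE card_bigcup//.
  by move=> k; exact: finite_stack_pairs.
move=> i j x xi xj; apply: succn_inj.
by rewrite -(last_stack_pairs (ltn0Sn i) xi) (last_stack_pairs (ltn0Sn j) xj).
Qed.

Lemma hsE n : hs n.+1 = \sum_(m < n.+1) nb_pairs m.+1 m.+1 n.+1.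
Proof.
apply: (card_stacks (l := id)) => a c b.
rewrite /shifted_stacks_with_summit /= shifted_stack_with_summitE.
by split=> [/andP[-> /asboolP]//|[-> ?]]; apply/asboolP.
Qed.

(** Here sequences are counted, not triples. The summit exceeds everything to its right, so it is
    the last occurrence of the maximum and the sequence determines the triple. *)
Lemma hE n : h n.+1 = \sum_(m < n.+1) nb_pairs m.+1 m n.+1.
Proof.
pose B := [set t : seq nat * nat * seq nat | is_shifted_stack n.+1 t.1.1 t.1.2 t.2].
have BE a c b : B (a, c, b) <-> 0 < c /\ stack_pairs c c.-1 n.+1 (rcons a c, b).
  rewrite /B /= shifted_stackE.
  by split=> [/andP[-> /asboolP]//|[-> ?]]; apply/asboolP.
rewrite -(card_stacks (l := predn) BE) /h.
rewrite (_ : shifted_stacks n.+1 = (fun t => t.1.1 ++ t.1.2 :: t.2) @` B); last first.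
  apply/seteqP; split => [s [a [c [b [-> abc]]]]|s [[[a c] b] abc <-]].
    by exists (a, c, b).
  by exists a, c, b.
rewrite card_image//.
  apply: (@sub_finite_set _ _ (shifted_stacks_with_summit n.+1)).
    by move=> [[a c] b] /andP[].
  exact: shifted_stacks_with_summit_finite.
move=> [[a c] b] [[a' c'] b'].
rewrite !inE => /BE[c0 abc] /BE[c0' abc'] /= E.
have maxE a1 c1 b1 : 0 < c1 -> stack_pairs c1 c1.-1 n.+1 (rcons a1 c1, b1) ->
    (forall k, k \in a1 ++ c1 :: b1 -> k <= c1) /\ (c1 \notin b1).
  move=> c10 /stack_pairsP[[s1 a2] _ _ b2 _]; split => [k|].
    rewrite mem_cat inE => /or3P[ka|/eqP->//|kb].
      by move: s1; rewrite sorted_leq_rcons => /andP[/allP/(_ k ka)].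
    by have /andP[_ /leq_trans->//] := allP b2 k kb; exact: leq_pred.
  by apply/negP => /(allP b2); lia.
have [cmax cb] := maxE _ _ _ c0 abc; have [cmax' cb'] := maxE _ _ _ c0' abc'.
have cc : c = c'.
  apply/eqP; rewrite eqn_leq; apply/andP; split.
    by apply: cmax'; rewrite -E mem_cat inE eqxx orbT.
  by apply: cmax; rewrite E mem_cat inE eqxx orbT.
(* As [c] does not occur in [b], its distance from the right end of the sequence is the length of
   [b]. *)
subst c'; have bb : size b = size b'.
  have idx (u v : seq nat) : c \notin v -> index c (rev (u ++ c :: v)) = size v.
    by move=> cv; rewrite rev_cat rev_cons cat_rcons index_cat mem_rev (negbTE cv)
      size_rev /= eqxx addn0.
  by rewrite -(idx a b cb) -(idx a' b' cb') E.
have /eqP : a ++ c :: b == a' ++ c :: b' by rewrite E.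
have aa : size a = size a' by move/(congr1 size): E; rewrite !size_cat /= bb => /addIn.
by move/eqP; rewrite eqseq_cat// => /andP[/eqP-> /eqP[->]].
Qed.

End Counting.

(** * Counts as Fourier integrals *)

Section PairsFourier.
Context {R : realType}.
Implicit Types (m n k : nat) (N : int) (t eps : R).

(** Extension by 0 to negative sizes, which makes the recurrences valid for every integer and allows
    descent to [-oo]. *)
Definition pairsz m l N : R := if N is Posz n then (nb_pairs m l n)%:R else 0.

Lemma pairsz_lt0 m l N : N < 0 -> pairsz m l N = 0.
Proof. by case: N. Qed.

Lemma pairsz_small m l N : N < m%:Z -> pairsz m l N = 0.
Proof. by case: N => //= n nm; rewrite nb_pairs_small. Qed.

Lemma pairsz_right m N :
  pairsz m.+1 m.+1 N = pairsz m.+1 m.+1 (N - m.+1%:Z) + pairsz m.+1 m N.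
Proof.
have [Nm|] := ltP N m.+1%:Z.
  by rewrite !(@pairsz_small m.+1)// ?addr0//; lia.
case: N => // n; rewrite lez_nat => nm; rewrite subzn//.
by rewrite -{1 3}(subnK nm) /= nb_pairs_right addnC natrD.
Qed.

Lemma pairsz_left m N :
  pairsz m.+1 m N = pairsz m.+1 m (N - m.+1%:Z) + pairsz m m (N - m.+1%:Z).
Proof.
have [Nm|] := ltP N m.+1%:Z.
  by rewrite pairsz_small// !pairsz_lt0 ?addr0//; lia.
case: N => // n; rewrite lez_nat => nm; rewrite subzn//.
by rewrite -{1}(subnK nm) /= nb_pairs_left natrD.
Qed.

(** Coefficients of [(1 - x^(m+1))^2 P_(m+1) = x^(m+1) P_m], with [P_m] the series of the
    [pairsz m m N]: parts [m + 1] are removed on both sides and the intermediate counts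
    [pairsz m.+1 m] eliminated. *)
Lemma pairsz_rec m N : pairsz m.+1 m.+1 N -
  2 * pairsz m.+1 m.+1 (N - m.+1%:Z) + pairsz m.+1 m.+1 (N - m.+1%:Z *+ 2) =
  pairsz m m (N - m.+1%:Z).
Proof.
have := pairsz_right m (N - m.+1%:Z); have := pairsz_right m N.
have := pairsz_left m N; rewrite (_ : N - m.+1%:Z *+ 2 = N - m.+1%:Z - m.+1%:Z); last by ring.
by lra.
Qed.

(** Vanishing second differences make the sequence affine, and an affine sequence with limit 0 is
    0. *)
Lemma linear_cvg0 (d : nat -> R) : (forall k, d k - 2 * d k.+1 + d k.+2 = 0) ->
  d k @[k --> \oo] --> 0 -> d 0%N = 0.
Proof.
move=> rec d0; pose b := d 1%N - d 0%N.
have dS k : d k.+1 - d k = b.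
  by elim: k => // k IH; have := rec k; lra.
have b0 : b = 0.
  have L : d k.+1 - d k @[k --> \oo] --> (0 : R).
    by rewrite -[X in _ --> X](subrr (0 : R)); apply: cvgB => //; rewrite cvg_shiftS.
  have L' : d k.+1 - d k @[k --> \oo] --> b.
    by under eq_fun do rewrite dS; exact: cvg_cst.
  exact: (cvg_unique _ L' L).
have dE k : d k = d 0%N by elim: k => // k <-; have := dS k; lra.
have L : d k @[k --> \oo] --> d 0%N by under eq_fun do rewrite dE; exact: cvg_cst.
exact: (cvg_unique _ L d0).
Qed.

(* Both sides satisfy the recurrence of [pairsz_rec] and [fourierS]; their
   difference is affine along steps of [m] and tends to 0 at [-oo]. *)
Lemma pairs_fourier t eps m N : 0 < t -> 0 < eps ->
  pairsz m m N = expR (N%:~R * t) * fourier t eps m N.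
Proof.
move=> t0 e0; elim: m N => [|m IH] N.
  rewrite fourier0//; have [->|N0] := eqVneq N 0.
    by rewrite mul0r expR0 mulr1 /= nb_pairs00.
  rewrite mulr0; case: N N0 => //= n n0; rewrite nb_pairs00.
  by case: n n0.
pose E (N : int) := expR (N%:~R * t) * fourier t eps m.+1 N - pairsz m.+1 m.+1 N.
suff : E N = 0 by rewrite /E => /eqP; rewrite subr_eq0 => /eqP.
have Erec M : E M - 2 * E (M - m.+1%:Z) + E (M - m.+1%:Z *+ 2) = 0.
  have := fourierS eps m M t0; have := pairsz_rec m M; rewrite IH /= /E.
  set q := expR (- _); set e := expR (M%:~R * t).
  have -> : expR ((M - m.+1%:Z)%:~R * t) = e * q.
    by rewrite -expRD; congr expR; rewrite intrB -pmulrn; ring.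
  have -> : expR ((M - m.+1%:Z *+ 2)%:~R * t) = e * q ^+ 2.
    by rewrite -expRM_natl -expRD; congr expR; rewrite intrB rmorphMn /= -pmulrn; ring.
  move=> H1 H2; transitivity (e * (fourier t eps m.+1 M -
      2 * q * fourier t eps m.+1 (M - m.+1%:Z) +
      q ^+ 2 * fourier t eps m.+1 (M - m.+1%:Z *+ 2)) -
    (pairsz m.+1 m.+1 M - 2 * pairsz m.+1 m.+1 (M - m.+1%:Z) +
     pairsz m.+1 m.+1 (M - m.+1%:Z *+ 2))); first by ring.
  by rewrite H1 H2; ring.
have := @linear_cvg0 (fun k => E (N - m.+1%:Z *+ k)).
rewrite mulr0n subr0; apply.
  move=> k; have := Erec (N - m.+1%:Z *+ k).
  rewrite (_ : N - _ - m.+1%:Z = N - m.+1%:Z *+ k.+1); last first.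
    by rewrite [in RHS]mulrSr opprD addrA.
  rewrite (_ : N - _ - m.+1%:Z *+ 2 = N - m.+1%:Z *+ k.+2)//.
  by rewrite [in RHS]mulrSr [in RHS]mulrSr mulr2n !opprD !addrA.
apply: norm_cvg0.
apply: (@squeeze_cvgr _ _ _ _ (cst 0)
  (fun k => expR (N%:~R * t) * amp t m.+1 0 * expR (- t) ^+ k)).
- near=> k; rewrite /= normr_ge0 /=.
  (* From here on the size is negative: the count is 0, and only the bounded integral times a
     geometrically small exponential remains. *)
  have kN : (`|N| < k)%N by near: k; exact: nbhs_infty_gt.
  have Nk : N - m.+1%:Z *+ k < 0.
    have : (k <= m.+1 * k)%N by rewrite leq_pmull.
    by rewrite -mulr_natr natz -PoszM; lia.
  rewrite /E pairsz_lt0// subr0 normrM ger0_norm ?expR_ge0//.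
  rewrite -mulrA [leRHS]mulrA [leRHS]mulrAC.
  rewrite ler_pM ?expR_ge0 ?normr_ge0//; last exact: fourier_bounded.
  rewrite -expRM_natl -expRD ler_expR rmorphB rmorphMn /= -pmulrn mulrBl lerD2l.
  rewrite mulrN lerN2 ler_wpM2r ?(ltW t0)// -mulrnA ler_nat.
  by rewrite leq_pmull.
- exact: cvg_cst.
- rewrite -[X in _ --> X](mulr0 (expR (N%:~R * t) * amp t m.+1 0)).
  apply: cvgM; first exact: cvg_cst.
  by apply: cvg_expr; rewrite ger0_norm ?expR_ge0// expR_lt1 oppr_lt0.
Unshelve. all: end_near. Qed.

Definition stack_sum w n : R := \sum_(1 <= m < n.+1) pairsz m m (n%:Z - (w * m)%:Z).

Lemma hs_stack_sum n : (0 < n)%N -> (hs n)%:R = stack_sum 0 n.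
Proof.
case: n => // n _; rewrite hsE natr_sum /stack_sum big_add1 big_mkord.
by apply: eq_bigr => i _; rewrite mul0n subr0.
Qed.

Lemma h_stack_sum n : (0 < n)%N -> (h n)%:R = stack_sum 0 n - stack_sum 1 n.
Proof.
case: n => // n _; rewrite hE natr_sum /stack_sum !big_add1 !big_mkord -sumrB.
apply: eq_bigr => i _; rewrite mul0n mul1n subr0.
by have := pairsz_right i n.+1; move=> ->; rewrite addrC addKr.
Qed.

End PairsFourier.

(** * The sum of the inverse odd squares *)

Section Basel.
Context {R : realType}.
Implicit Types (x : R) (n k : nat).

Lemma sin_le x : 0 <= x -> sin x <= x.
Proof.
move=> x0; rewrite -subr_ge0.
have := @derive_ge0_le R (fun y => y - sin y) (fun y => 1 - cos y) 0 x x0.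
rewrite sin0 subr0; apply => y _; last by rewrite subr_ge0 cos_le1.
by derive; ring.
Qed.

Lemma mul_cos_le_sin x : 0 <= x <= pi -> x * cos x <= sin x.
Proof.
move=> /andP[x0 xpi]; rewrite -subr_ge0.
have := @derive_ge0_le R (fun y => sin y - y * cos y) (fun y => y * sin y) 0 x x0.
rewrite sin0 mul0r subr0; apply => y /andP[y0 yx]; first by derive; ring.
by rewrite mulr_ge0// sin_ge0_pi// y0 (le_trans yx).
Qed.

(** For [k < 2^n] these are the odd multiples of [pi / 2^(n+2)] in [(0, pi / 2)]. Doubling those of
    level [n + 1] gives those of level [n] and their supplements. *)
Definition odd_angle n k : R := k.*2.+1%:R * pi / (2 ^ n.+2)%:R.

Lemma odd_angle_bounds n k : (k < 2 ^ n)%N -> 0 < odd_angle n k < pi / 2.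
Proof.
move=> kn; have p0 := pi_gt0 R; have n0 : 0 < (2 ^ n.+2)%:R :> R by rewrite ltr0n expn_gt0.
rewrite divr_gt0 ?mulr_gt0//= ltr_pdivrMr// mulrAC [ltRHS]mulrC mulrA.
rewrite mulrAC ltr_pM2r// ltr_pdivlMl// -natrM ltr_nat !expnS.
by move: (2 ^ n)%N kn => N; lia.
Qed.

(** The identity [sin^-2 x + sin^-2 (pi / 2 - x) = 4 sin^-2 (2 x)] pairs the angles of level
    [n + 1], so each level multiplies the sum by 4. *)
Lemma sum_sin_inv2 n : \sum_(k < 2 ^ n) (sin (odd_angle n k)) ^- 2 = 2 * 4 ^+ n.
Proof.
elim: n => [|n IH].
  rewrite expn0 big_ord1 expr0 mulr1 /odd_angle mul1r.
  have c2 : cos (pi / 2 : R) = 0 := cos_pihalf R.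
  have := cos_mulr2n (pi / 4 : R); rewrite (_ : pi / 4 *+ 2 = pi / 2); last first.
    by rewrite mulr2n; have := @pi_gt0 R; move: (@pi R) => p _; field.
  rewrite c2 cos2sin2 => E; have : sin (pi / 4) ^+ 2 = 2^-1 :> R by lra.
  by move=> ->; rewrite invrK.
have -> : 2 * 4 ^+ n.+1 = 4 * (2 * 4 ^+ n) :> R by rewrite exprS; ring.
rewrite -IH mulr_sumr.
have two : (2 ^ n.+1 = 2 ^ n + 2 ^ n)%N by rewrite expnS; lia.
rewrite -(big_mkord xpredT (fun k => sin (odd_angle n.+1 k) ^- 2)) two.
rewrite big_mkord big_split_ord /= [X in _ + X](reindex_inj rev_ord_inj) /= -big_split /=.
apply: eq_bigr => k _.
have n0 : (2 ^ n)%:R != 0 :> R by rewrite pnatr_eq0 expn_eq0.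
have E1 : odd_angle n k = odd_angle n.+1 k *+ 2.
  rewrite /odd_angle mulr2n !expnS !natrM; move: (@pi R) => p.
  by move: (2 ^ n)%:R n0 => a a0; field.
have E2 : odd_angle n.+1 (2 ^ n + (2 ^ n - k.+1)) = pi / 2 - odd_angle n.+1 k.
  have kn : (k.+1 <= 2 ^ n)%N := ltn_ord k.
  rewrite /odd_angle !expnS !natrM; move: (@pi R) => p.
  rewrite -!natr1 -!addnn !natrD natrB// -!natr1.
  by move: (2 ^ n)%:R n0 => a a0; field.
have cosB2 (a : R) : sin (pi / 2 - a) = cos a.
  by rewrite -opprB sinN sinBpihalf opprK.
rewrite E2 cosB2 E1 sin_mulr2n.
have [x0 xpi] : 0 < odd_angle n.+1 k /\ odd_angle n.+1 k < pi / 2.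
  by apply/andP; apply: odd_angle_bounds; rewrite two ltn_addr.
set x := odd_angle n.+1 k in x0 xpi *.
have sx : 0 < sin x by rewrite sin_gt0_pihalf// x0.
have cx : 0 < cos x by rewrite cos_gt0_pihalf// (lt_trans _ x0)//= oppr_lt0 (lt_trans x0).
have := cos2Dsin2 x; move: (cos x) (sin x) sx cx => c u u0 c0 E.
have -> : 4 / (c * u *+ 2) ^+ 2 = (c ^+ 2 + u ^+ 2) / (c * u) ^+ 2.
  by rewrite E -[_ *+ 2]mulr_natr; field; rewrite !gt_eqF.
by field; rewrite !gt_eqF.
Qed.

(** From [x cos x <= sin x <= x] follows [sin^-2 x - 1 <= x^-2 <= sin^-2 x] on [(0, pi / 2)]. Summed
    over the angles, the gap is [2^n] against a total of [2 * 4^n]. *)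
Lemma cvg_odd_squares :
  \sum_(k < 2 ^ n) (k.*2.+1%:R ^- 2) @[n --> \oo] --> (pi ^+ 2 / 8 : R).
Proof.
have p0 := pi_gt0 R.
have pw n : (2 ^ n)%:R = 2 ^+ n :> R by rewrite natrX.
have x2E n (k : nat) : (odd_angle n k) ^- 2 = 16 * 4 ^+ n / pi ^+ 2 * (k.*2.+1%:R ^- 2).
  rewrite /odd_angle !expnS !natrM pw (_ : 4 = 2 ^+ 2); last by rewrite -natrX.
  have a0 : 2 ^+ n != 0 :> R by rewrite expf_neq0.
  rewrite -exprM mulnC exprM; move: (2 ^+ n) a0 => a a0.
  have b0 : k.*2.+1%:R != 0 :> R by rewrite pnatr_eq0.
  move: k.*2.+1%:R b0 (@pi R) p0 => b b0 p p0.
  by field; rewrite (gt_eqF p0) a0 b0.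
apply: (@squeeze_cvgr _ _ _ _ (fun n => pi ^+ 2 / 8 - pi ^+ 2 / 16 * (1 / 2) ^+ n)
  (fun=> pi ^+ 2 / 8)).
- apply: nearW => n.
  have sumE : \sum_(k < 2 ^ n) (k.*2.+1%:R ^- 2) =
      pi ^+ 2 / (16 * 4 ^+ n) * \sum_(k < 2 ^ n) (odd_angle n k) ^- 2.
    rewrite mulr_sumr; apply: eq_bigr => k _; rewrite x2E.
    have a0 : 4 ^+ n != 0 :> R by rewrite expf_neq0.
    have b0 : k.*2.+1%:R != 0 :> R by rewrite pnatr_eq0.
    move: k.*2.+1%:R b0 (@pi R) (4 ^+ n) a0 p0 => b b0 p a a0 p0.
    by field; rewrite (gt_eqF p0) a0 b0.
  have H k : (k < 2 ^ n)%N -> sin (odd_angle n k) ^- 2 - 1 <= odd_angle n k ^- 2 <=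
      sin (odd_angle n k) ^- 2.
    move=> /odd_angle_bounds; set x := odd_angle n k => /andP[x0 xpi].
    have sx : 0 < sin x by rewrite sin_gt0_pihalf// x0.
    have cx : 0 < cos x by rewrite cos_gt0_pihalf// (lt_trans _ x0)//= oppr_lt0 (lt_trans x0).
    apply/andP; split; last first.
      by rewrite lef_pV2 ?posrE ?exprn_gt0// ler_pXn2r ?nnegrE ?(ltW x0) ?(ltW sx)// sin_le// ltW.
    have -> : sin x ^- 2 - 1 = (cos x / sin x) ^+ 2.
      by rewrite expr_div_n cos2sin2; field; rewrite gt_eqF.
    rewrite -exprVn ler_pXn2r ?nnegrE ?invr_ge0 ?(ltW x0) ?divr_ge0 ?(ltW cx) ?(ltW sx)//.
    rewrite ler_pdivrMr// ler_pdivlMl// mul_cos_le_sin// (ltW x0)/=; lra.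
  have up : \sum_(k < 2 ^ n) (odd_angle n k) ^- 2 <= 2 * 4 ^+ n.
    by rewrite -sum_sin_inv2; apply: ler_sum => k _; case/andP: (H k (ltn_ord k)).
  have lo : 2 * 4 ^+ n - 2 ^+ n <= \sum_(k < 2 ^ n) (odd_angle n k) ^- 2.
    rewrite -sum_sin_inv2 -pw -[X in _ - X%:R](card_ord (2 ^ n)) -sumr_const -sumrB.
    by apply: ler_sum => k _; case/andP: (H k (ltn_ord k)).
  have a0 : 0 < 2 ^+ n :> R by rewrite exprn_gt0.
  have a4 : 4 ^+ n = (2 ^+ n) ^+ 2 :> R.
    by have -> : 4 = 2 ^+ 2 :> R; [rewrite -natrX | rewrite -!exprM mulnC].
  rewrite sumE; apply/andP; split.
    apply: le_trans (ler_wpM2l _ lo).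
      rewrite a4 expr_div_n expr1n; move: (@pi R) (2 ^+ n) a0 p0 => p a a0 p0.
      by rewrite le_eqVlt; apply/orP; left; apply/eqP; field; rewrite gt_eqF.
    by rewrite divr_ge0 ?sqr_ge0// mulr_ge0 ?exprn_ge0.
  apply: le_trans (ler_wpM2l _ up) _.
    by rewrite divr_ge0 ?sqr_ge0// mulr_ge0 ?exprn_ge0.
  rewrite a4; move: (@pi R) (2 ^+ n) a0 p0 => p a a0 p0.
  by rewrite le_eqVlt; apply/orP; left; apply/eqP; field; rewrite gt_eqF.
- rewrite -[X in _ --> X]subr0; apply: cvgB; first exact: cvg_cst.
  rewrite -[X in _ --> X](mulr0 (pi ^+ 2 / 16)); apply: cvgM; first exact: cvg_cst.
  by apply: cvg_expr; rewrite ger0_norm//; lra.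
- exact: cvg_cst.
Qed.

End Basel.

(** * The dilogarithm and the integral of [ln sh] *)

Section Dilogarithm.
Context {R : realType}.
Implicit Types (x K : R) (n i : nat).

(** Comparison with the sum of the [(i + 1) K^i]. Linear growth covers a series together with the
    two derived series that termwise differentiation asks for. *)
Lemma cvg_pseries_linear (c : nat -> R) K : (forall i, 0 <= c i <= i.+1%:R) ->
  0 <= K < 1 -> cvgn (pseries c K).
Proof.
move=> c1 /andP[K0 K1].
have sumE n : (\sum_(i < n) i.+1%:R * K ^+ i) * (1 - K) ^+ 2 =
    1 - n.+1%:R * K ^+ n + n%:R * K ^+ n.+1.
  elim: n => [|n IH]; first by rewrite big_ord0 !mul0r expr0; ring.
  by rewrite big_ord_recr /= mulrDl IH !exprS -!natr1; ring.
apply: nondecreasing_is_cvgn.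
  apply/nondecreasing_seqP => n; rewrite /pseries /series /= big_nat_recr//= lerDl.
  by rewrite mulr_ge0 ?exprn_ge0//; case/andP: (c1 n).
exists ((1 - K) ^- 2) => _ [n _ <-]; rewrite /pseries /series /= big_mkord.
apply: (@le_trans _ _ (\sum_(i < n) i.+1%:R * K ^+ i)).
  by apply: ler_sum => i _; rewrite ler_wpM2r ?exprn_ge0//; case/andP: (c1 i).
have K2 : 0 < (1 - K) ^+ 2 by rewrite exprn_gt0// subr_gt0.
rewrite -[leRHS]mul1r ler_pdivlMr// sumE.
have Kn : 0 <= K ^+ n by rewrite exprn_ge0.
have : n%:R * K ^+ n.+1 <= n.+1%:R * K ^+ n.
  rewrite exprS mulrA ler_wpM2r// -natr1.
  by have : n%:R * K <= n%:R; [rewrite ler_piMr// ltW | lra].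
by lra.
Qed.

(** The term of index 0 vanishes since [0^-1 = 0]: the series starts at [x]. *)
Definition Li2_coef i : R := i%:R ^- 2.
Definition Li2 x : R := limn (pseries Li2_coef x).

Let inv_coef i : R := i%:R^-1.

Lemma pseries_cst1 x : `|x| < 1 -> limn (pseries (fun _ => 1) x) = (1 - x)^-1.
Proof.
move=> x1; apply/cvg_lim => //; have := @cvg_geometric_series R 1 x x1.
by rewrite mul1r.
Qed.

Let half_between x : `|x| < 1 ->
  0 <= (1 + `|x|) / 2 < 1 /\ `|x| < `|(1 + `|x|) / 2|.
Proof.
move=> x1; have x0 := normr_ge0 x; have K0 : 0 <= (1 + `|x|) / 2 by lra.
by rewrite (ger0_norm K0); split; lra.
Qed.

Lemma pseries_inv x : `|x| < 1 -> limn (pseries inv_coef x) = - ln (1 - x).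
Proof.
have dF y : `|y| < 1 -> has_derive (fun y => limn (pseries inv_coef y) + ln (1 - y)) y 0.
  move=> y1; have [K01 yK] := half_between y1.
  have dc : pseries_diffs inv_coef = fun=> 1.
    apply/funext => i; rewrite /pseries_diffs /inv_coef.
    by rewrite divff// pnatr_eq0.
  have ddc : pseries_diffs (fun=> 1) = fun i => i.+1%:R :> R.
    by apply/funext => i; rewrite /pseries_diffs mulr1.
  have := @pseries_snd_diffs R inv_coef _ y; rewrite dc ddc => H.
  have dL : has_derive (fun y => limn (pseries inv_coef y)) y (1 - y)^-1.
    rewrite -pseries_cst1//; apply: H yK; apply: cvg_pseries_linear => // i.
    - rewrite /inv_coef invr_ge0 ler0n /=; case: i => [|i]; first by rewrite invr0.
      by rewrite (@le_trans _ _ 1)// ?invf_le1 ?ltr0n// ler1n.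
    - by rewrite ler01 ler1n.
    - by rewrite ler0n lexx.
  have y0 : 0 < 1 - y by move: y1; rewrite ltr_norml; lra.
  by derive; [exact: y0 | field; rewrite gt_eqF].
move=> x1; have F0 : limn (pseries inv_coef 0) + ln (1 - 0) = 0.
  rewrite subr0 ln1 addr0; apply/cvg_lim => //.
  rewrite (_ : pseries _ _ = fun=> 0); first exact: cvg_cst.
  apply/funext => n; rewrite /pseries /series /= big1// => -[_|i _].
    by rewrite /inv_coef invr0 mul0r.
  by rewrite exprS mul0r mulr0.
apply/eqP; rewrite -addr_eq0 -F0; apply/eqP.
have [x0|/ltW x0] := leP 0 x; [apply/esym|];
  apply: (derive0_cst (f := fun y => limn (pseries inv_coef y) + ln (1 - y))) => // y yx;
  by apply: dF; move: x1 yx; rewrite !ltr_norml; lra.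
Qed.

(** The derivative is described through [x * d] so that [x = 0] is covered. *)
Lemma derive_Li2 x : `|x| < 1 -> exists2 d, has_derive Li2 x d & x * d = - ln (1 - x).
Proof.
move=> x1; have [K01 xK] := half_between x1.
have dc : pseries_diffs Li2_coef = fun i => i.+1%:R^-1.
  apply/funext => i; rewrite /pseries_diffs /Li2_coef.
  have : i.+1%:R != 0 :> R by rewrite pnatr_eq0.
  by move: i.+1%:R => a a0; field.
have ddc : pseries_diffs (fun i => i.+1%:R^-1) = fun i => i.+1%:R / i.+2%:R :> R.
  by apply/funext => i; rewrite /pseries_diffs.
have inv1 i : (i.+1%:R : R)^-1 <= 1 by rewrite invf_le1 ?ltr0n// ler1n.
have cvg_d y : 0 <= y < 1 -> cvgn (pseries (fun i => i.+1%:R^-1) y : R^nat).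
  move=> y01; apply: cvg_pseries_linear => // i.
  by rewrite invr_ge0 ler0n/= (le_trans (inv1 i))// ler1n.
have := @pseries_snd_diffs R Li2_coef _ x.
rewrite dc ddc => H; exists (limn (pseries (fun i => i.+1%:R^-1) x)).
  apply: H xK => //; last 2 first.
  - exact: cvg_d.
  - apply: cvg_pseries_linear => // i.
    by rewrite divr_ge0//= ler_piMr.
  apply: cvg_pseries_linear => // i.
  rewrite /Li2_coef invr_ge0 exprn_ge0//=; case: i => [|i]; first by rewrite expr0n invr0.
  by rewrite -exprVn (@le_trans _ _ 1)// ?ler1n// exprn_ile1// invr_ge0.
rewrite -pseries_inv//; apply/esym/cvg_lim => //.
rewrite -cvg_shiftS.
rewrite (_ : (fun n => _) = (fun n => x * pseries (fun i => i.+1%:R^-1) x n)); last first.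
  apply/funext => n; rewrite /pseries /series /= big_nat_recl//= /inv_coef.
  rewrite invr0 mul0r add0r mulr_sumr; apply: eq_bigr => i _.
  by rewrite exprS; ring.
apply: cvgM; first exact: cvg_cst.
by apply: (is_cvg_pseries_inside (cvg_d _ K01)).
Qed.

(** Splitting by parity, [S (2 N + 1) = O N + S (N + 1) / 4] with [O N] the sum over the first [N]
    odd numbers. The limit along [N = 2^n], where [O N] is known, gives [S = pi^2 / 8 + S / 4]. *)
Lemma cvg_Li2_1 : pseries Li2_coef 1 @ \oo --> (pi ^+ 2 / 6 : R).
Proof.
pose S : nat -> R := pseries Li2_coef 1; rewrite -/S.
have SS n : S n.+1 = S n + n%:R ^- 2.
  by rewrite /S /pseries /series /= big_nat_recr//= expr1n mulr1.
have S0 : S 0%N = 0 by rewrite /S /pseries /series /= big_nil.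
have S1 : S 1%N = 0 by rewrite SS S0 expr0n invr0 addr0.
pose O N : R := \sum_(k < N) k.*2.+1%:R ^- 2.
have SO N : S N.*2.+1 = O N + S N.+1 / 4.
  elim: N => [|N IH]; first by rewrite /O big_ord0 add0r S1 mul0r.
  rewrite doubleS SS SS IH [S N.+2]SS /O big_ord_recr /= -/(O N).
  have -> : N.*2.+2%:R = 2 * N.+1%:R :> R by rewrite -natrM; congr _%:R; lia.
  have : N.+1%:R != 0 :> R by rewrite pnatr_eq0.
  have : N.*2.+1%:R != 0 :> R by rewrite pnatr_eq0.
  by move: N.+1%:R N.*2.+1%:R => a b b0 a0; field; rewrite a0 b0.
have Sub n : S n.+2 <= 2 - n.+1%:R^-1.
  elim: n => [|n IH]; first by rewrite SS S1 expr1n invr1; lra.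
  rewrite SS; have : n.+2%:R ^- 2 <= n.+1%:R^-1 - n.+2%:R^-1 :> R.
    have a0 : 0 < n.+1%:R :> R by rewrite ltr0n.
    have -> : n.+2%:R = n.+1%:R + 1 :> R by rewrite natr1.
    move: n.+1%:R a0 => a a0; have -> : a^-1 - (a + 1)^-1 = (a * (a + 1))^-1.
      by field; rewrite !gt_eqF//; lra.
    by rewrite lef_pV2 ?posrE ?mulr_gt0 ?exprn_gt0//; [nra|lra..].
  by move: IH; move: (S n.+2) (n.+2%:R ^- 2) (n.+1%:R^-1) (n.+2%:R^-1) => a b c d; lra.
have Snd : nondecreasing_seq S.
  by apply/nondecreasing_seqP => n; rewrite SS lerDl invr_ge0 exprn_ge0.
have cvS : cvgn S.
  apply: nondecreasing_is_cvgn => //; exists 2 => _ [n _ <-].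
  apply: (@le_trans _ _ (S n.+2)); first by apply: Snd; lia.
  by apply: le_trans (Sub n) _; rewrite gerBl invr_ge0.
have pow_oo (f : nat -> nat) : (forall n, (n <= f n)%N) -> f n @[n --> \oo] --> \oo.
  by move=> fn A [N _ NA]; exists N => // n /= Nn; apply: NA => /=; exact: leq_trans (fn n).
have n2n n : (n <= 2 ^ n)%N by rewrite ltnW// ltn_expl.
have L1 : S (2 ^ n).*2.+1 @[n --> \oo] --> limn S.
  apply: (cvg_comp (fun n => (2 ^ n).*2.+1) S _ cvS); apply: pow_oo => n.
  by have := n2n n; lia.
have L2 : O (2 ^ n)%N + S (2 ^ n).+1 / 4 @[n --> \oo] --> pi ^+ 2 / 8 + limn S / 4.
  apply: cvgD; first exact: cvg_odd_squares.
  apply: cvgM; last exact: cvg_cst.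
  apply: (cvg_comp (fun n => (2 ^ n).+1) S _ cvS); apply: pow_oo => n.
  by have := n2n n; lia.
have E : limn S = pi ^+ 2 / 8 + limn S / 4.
  have L3 : O (2 ^ n)%N + S (2 ^ n).+1 / 4 @[n --> \oo] --> limn S.
    by move: L1; under eq_fun do rewrite SO.
  exact: (cvg_unique _ L3 L2).
by have -> : pi ^+ 2 / 6 = limn S by lra.
Qed.

Lemma Li2_1 : Li2 1 = pi ^+ 2 / 6.
Proof. by apply/cvg_lim => //; exact: cvg_Li2_1. Qed.

Lemma Li2_0 : Li2 0 = 0.
Proof.
apply/cvg_lim => //; rewrite (_ : pseries _ _ = fun=> 0); first exact: cvg_cst.
apply/funext => n; rewrite /pseries /series /= big1// => -[_|i _].
  by rewrite /Li2_coef expr0n invr0 mul0r.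
by rewrite exprS mul0r mulr0.
Qed.

Let Li2_coef_ge0 i : 0 <= Li2_coef i.
Proof. by rewrite /Li2_coef invr_ge0 exprn_ge0. Qed.

Lemma Li2_bounds x n : 0 <= x <= 1 -> pseries Li2_coef x n <= Li2 x <= Li2 1.
Proof.
move=> /andP[x0 x1].
have le1 m : pseries Li2_coef x m <= pseries Li2_coef 1 m.
  rewrite /pseries /series /= ler_sum// => i _.
  by rewrite ler_wpM2l ?Li2_coef_ge0// expr1n exprn_ile1.
have nd y : 0 <= y -> nondecreasing_seq (pseries Li2_coef y).
  move=> y0; apply/nondecreasing_seqP => m.
  by rewrite /pseries /series /= big_nat_recr//= lerDl mulr_ge0 ?exprn_ge0.
have cv1 : cvgn (pseries Li2_coef 1) by apply/cvg_ex; eexists; exact: cvg_Li2_1.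
have cv : cvgn (pseries Li2_coef x).
  apply: nondecreasing_is_cvgn; first exact: nd.
  exists (Li2 1) => _ [m _ <-]; apply: le_trans (le1 m) _.
  by apply: nondecreasing_cvgn_le => //; exact: nd.
apply/andP; split; first by apply: nondecreasing_cvgn_le => //; exact: nd.
by apply: ler_lim => //; apply: nearW => m; exact: le1.
Qed.

(** Abel continuity. With nonnegative coefficients a partial sum bounds [Li2] from below and [Li2 1]
    bounds it from above; the partial sum is continuous and, for a suitable length, close to [Li2 1]
    at 1. *)
Lemma cvg_Li2_left : Li2 x @[x --> 1^'-] --> Li2 1.
Proof.
apply/cvgrPdist_lt => e e0.
have [N _ NE] : \forall n \near \oo, `|Li2 1 - pseries Li2_coef 1 n| < e / 2.
  have L : pseries Li2_coef 1 @ \oo --> Li2 1 by rewrite Li2_1; exact: cvg_Li2_1.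
  by move/cvgrPdist_lt : L; apply; rewrite divr_gt0.
have {}NE := NE N (leqnn N).
have cont : continuous (fun x => pseries Li2_coef x N).
  move=> x; rewrite /pseries /series /=; elim: N {NE} => [|n IH].
    rewrite (_ : (fun _ => _) = fun=> 0); last by apply/funext => y; rewrite big_nil.
    exact: cvg_cst.
  rewrite (_ : (fun _ => _) = fun y => \sum_(0 <= i < n) Li2_coef i * y ^+ i +
    Li2_coef n * y ^+ n); last by apply/funext => y; rewrite big_nat_recr.
  apply: cvgD => //; apply: cvgM; first exact: cvg_cst.
  exact: exprn_continuous.
have := cvg_at_left_filter (cont 1); move/cvgrPdist_lt => /(_ (e / 2)).
rewrite divr_gt0// => /(_ isT) H.
near=> x.
have x1 : x <= 1 by apply: ltW; near: x; exact: nbhs_left_lt.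
have x0 : 0 <= x by near: x; apply: nbhs_left_ge.
have /andP[b1 b2] := @Li2_bounds x N (introT andP (conj x0 x1)).
have : `|pseries Li2_coef 1 N - pseries Li2_coef x N| < e / 2 by near: x; exact: H.
move: NE; rewrite !ltr_norml => /andP[_ h1] /andP[_ h2].
by apply/andP; split; lra.
Unshelve. all: end_near. Qed.

Lemma derive_Li2_pos x : 0 < x < 1 -> has_derive Li2 x (- ln (1 - x) / x).
Proof.
move=> /andP[x0 x1]; have [|d Hd dE] := @derive_Li2 x; first by rewrite gtr0_norm.
by apply: derive_eq Hd _; rewrite -dE; field; rewrite gt_eqF.
Qed.

Lemma oppr_ln_onem_le x : 0 <= x <= 2^-1 -> - ln (1 - x) <= 2 * x.
Proof.
move=> /andP[x0 x1]; have y0 : 0 < 1 - x by lra.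
rewrite -lnV ?posrE//; have -> : (1 - x)^-1 = 1 + x / (1 - x) by field; rewrite gt_eqF.
apply: le_trans (le_ln1Dx _) _.
  by apply: lt_le_trans (_ : 0 <= _); [lra | rewrite divr_ge0// ltW].
by rewrite ler_pdivrMr//; nra.
Qed.

(** The left side has derivative 0 on [(0, 1)]. Its constant value is its limit at [0+], where
    [ln x * ln (1 - x)] tends to 0. *)
Lemma Li2_reflection x : 0 < x < 1 ->
  Li2 x + Li2 (1 - x) + ln x * ln (1 - x) = Li2 1.
Proof.
pose f x := Li2 x + Li2 (1 - x) + ln x * ln (1 - x).
have df y : 0 < y < 1 -> has_derive f y 0.
  move=> /andP[y0 y1]; rewrite /f.
  have d1 : has_derive Li2 y (- ln (1 - y) / y) by apply: derive_Li2_pos; rewrite y0.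
  have d2 : has_derive Li2 (1 - y) (- ln y / (1 - y)).
    by rewrite -[in ln y](subKr 1 y); apply: derive_Li2_pos; lra.
  have d3 : has_derive (fun y => Li2 (1 - y)) y (- ln y / (1 - y) * - 1).
    by apply: (@derive_comp _ Li2 (fun y => 1 - y) y _ _ d2); derive; ring.
  derive; [exact: y0|lra|]; move: (ln y) (ln (1 - y)) => a b.
  by field; rewrite !gt_eqF//; lra.
have fc y z : 0 < y < 1 -> 0 < z < 1 -> f y = f z.
  move=> /andP[y0 y1] /andP[z0 z1]; have [yz|/ltW yz] := leP y z; [|apply/esym];
  by apply: (derive0_cst yz) => w wyz; apply: df; lra.
move=> x01; rewrite -/(f x).
have L : f y @[y --> 0^'+] --> Li2 1.
  rewrite -[X in _ --> X]addr0 -[X in _ --> X + _]add0r; apply: cvgD; first apply: cvgD.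
  - have [|d Hd _] := @derive_Li2 0; first by rewrite normr0.
    by have := cvg_at_right_filter (derive_continuous Hd); rewrite Li2_0.
  - apply: (cvg_comp (fun y : R => 1 - y) Li2 _ cvg_Li2_left).
    move=> A [e /= e0 HA]; exists e => //= y; rewrite /ball_/= sub0r normrN => ye y0.
    apply: HA => /=; last by rewrite gtrBl.
    by rewrite opprB addrCA subrr addr0.
  - apply: norm_cvg0; apply: (@squeeze_cvgr _ _ _ _ (cst 0) (fun y => 4 * Num.sqrt y)).
    + near=> y; rewrite /= normr_ge0 /=.
      have y0 : 0 < y by near: y; exact: nbhs_right_gt.
      have y1 : y <= 2^-1 by near: y; apply: nbhs_right_le; rewrite invr_gt0.
      rewrite normrM [ `|ln y| ]ler0_norm ?ln_le0//; last by lra.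
      rewrite [ `|ln (1 - y)| ]ler0_norm ?ln_le0//; last by lra.
      have s0 : 0 < Num.sqrt y by rewrite sqrtr_gt0.
      have l1 : - ln y <= 2 * (Num.sqrt y)^-1.
        have {1}-> : y = Num.sqrt y ^+ 2 by rewrite sqr_sqrtr// ltW.
        have : ln (Num.sqrt y)^-1 < (Num.sqrt y)^-1 by rewrite ln_sublinear ?invr_gt0.
        rewrite lnXn// lnV ?posrE// mulr2n; move: (ln _) (_^-1) => a b; lra.
      have l2 : - ln (1 - y) <= 2 * y by apply: oppr_ln_onem_le; lra.
      have -> : 4 * Num.sqrt y = 2 * (Num.sqrt y)^-1 * (2 * y).
        have {3}-> : y = Num.sqrt y ^+ 2 by rewrite sqr_sqrtr// ltW.
        by field; rewrite gt_eqF.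
      by apply: ler_pM => //; rewrite oppr_ge0 ln_le0//; lra.
    + exact: cvg_cst.
    + rewrite -[X in _ --> X](mulr0 4); apply: cvgM; first exact: cvg_cst.
      by rewrite -[X in _ --> X]sqrtr0; apply: cvg_at_right_filter; exact: sqrt_continuous.
have L' : f y @[y --> 0^'+] --> f x.
  apply: cvg_near_cst; near=> y; apply: fc => //.
  have y0 : 0 < y by near: y; exact: nbhs_right_gt.
  by rewrite y0 /=; near: y; exact: nbhs_right_lt.
exact: (cvg_unique _ L' L).
Unshelve. all: end_near. Qed.

(** Landen's identity for [Li2 (- x)], in which [Li2 x + Li2 (- x) = Li2 (x^2) / 2] has been
    substituted so that every argument lies in [[0, 1)]. The left side vanishes at 0 and has
    derivative 0. *)
Lemma Li2_landen x : 0 <= x < 1 ->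
  Li2 (x ^+ 2) - 2 * Li2 x + 2 * Li2 (x / (1 + x)) + ln (1 + x) ^+ 2 = 0.
Proof.
move=> /andP[x0 x1].
pose f x := Li2 (x ^+ 2) - 2 * Li2 x + 2 * Li2 (x / (1 + x)) + ln (1 + x) ^+ 2.
have f0 : f 0 = 0.
  by rewrite /f expr0n mul0r !Li2_0 addr0 ln1 expr0n /=; ring.
rewrite -/(f x) -f0; apply/esym; apply: (derive0_cst x0) => y /andP[y0 yx].
have y1 : y < 1 := le_lt_trans yx x1.
have z0 : 0 < 1 + y by lra.
have q1 : `|y ^+ 2| < 1 by rewrite ger0_norm ?sqr_ge0// expr_lt1.
have q2 : `|y| < 1 by rewrite ger0_norm.
have r0 : 0 <= y / (1 + y) by rewrite divr_ge0// ltW.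
have q3 : `|y / (1 + y)| < 1 by rewrite ger0_norm// ltr_pdivrMr//; lra.
have [d1 D1 E1] := derive_Li2 q1; have [d2 D2 E2] := derive_Li2 q2.
have [d3 D3 E3] := derive_Li2 q3.
have c1 : has_derive (fun y => Li2 (y ^+ 2)) y (d1 * (2 * y)).
  by apply: (@derive_comp _ Li2 (fun y => y ^+ 2) y _ _ D1); derive; ring.
have c3 : has_derive (fun y => Li2 (y / (1 + y))) y (d3 * (1 + y) ^- 2).
  by apply: (@derive_comp _ Li2 (fun y => y / (1 + y)) y _ _ D3); derive; [rewrite gt_eqF|field; rewrite gt_eqF].
rewrite /f; derive; first exact: z0.
(* At 0 the derivative of [Li2] is not a quotient; but [y] and [y / (1 + y)] coincide there, so
   their terms cancel, and the first term carries a factor [2 y]. *)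
have [yE|yn0] := eqVneq y 0.
  have d23 : d2 = d3.
    have [_ <-] := D2; have [_ <-] := D3.
    by rewrite yE mul0r.
  by rewrite d23 yE !(addr0, ln1, expr1n, expr1, invr1); ring.
have l1 : ln (1 - y ^+ 2) = ln (1 - y) + ln (1 + y).
  by rewrite -lnM ?posrE//; [congr ln; ring|lra].
have l3 : ln (1 - y / (1 + y)) = - ln (1 + y).
  by rewrite -lnV ?posrE//; congr ln; field; rewrite gt_eqF.
have e1 : d1 = - (ln (1 - y) + ln (1 + y)) / y ^+ 2 by rewrite -l1 -E1; field.
have e2 : d2 = - ln (1 - y) / y by rewrite -E2; field.
have e3 : d3 = ln (1 + y) * (1 + y) / y.
  by rewrite -[ln _]opprK -l3 -E3; field; rewrite yn0 gt_eqF.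
rewrite e1 e2 e3; move: (ln (1 - y)) (ln (1 + y)) => a b.
by field; rewrite yn0 gt_eqF.
Qed.

Local Notation phi := (phi R).

Lemma phi_sqr : phi ^+ 2 = phi + 1.
Proof.
rewrite /Defs.phi; have : Num.sqrt 5 ^+ 2 = 5 :> R by rewrite sqr_sqrtr.
by move: (Num.sqrt 5) => s s2; nra.
Qed.

Lemma phi_gt1 : 1 < phi.
Proof.
rewrite /Defs.phi; have : 1 < Num.sqrt 5 :> R.
  by rewrite -[ltLHS]sqrtr1 ltr_sqrt ?ltr1n.
by lra.
Qed.

(** For [x = 1 / phi] both [1 - x] and [x / (1 + x)] equal [x^2]. The reflection and Landen
    identities thus become two linear equations in [Li2 x] and [Li2 (x^2)]. *)
Lemma Li2_phi : Li2 (phi ^- 2) = pi ^+ 2 / 15 - ln phi ^+ 2.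
Proof.
have := phi_sqr; have := phi_gt1; move: phi => p p1 p2.
have p0 : p != 0 by rewrite gt_eqF//; lra.
have r0 : 0 < p^-1 by rewrite invr_gt0; lra.
have r1 : p^-1 < 1 by rewrite invf_lt1; lra.
have rE : 1 - p^-1 = p ^- 2.
  apply: (mulIf (expf_neq0 2 p0)); rewrite mulVf ?expf_neq0//.
  by transitivity (p ^+ 2 - p); [field | rewrite p2; ring].
have rE2 : p^-1 / (1 + p^-1) = p ^- 2.
  by rewrite p2; field; rewrite p0 gt_eqF//; lra.
have lr : 1 + p^-1 = p.
  apply: (mulIf p0); transitivity (p + 1); [by field | by rewrite -p2 expr2].
have := @Li2_landen p^-1; rewrite rE2 lr exprVn (ltW r0) r1 => /(_ isT) A.
have := @Li2_reflection p^-1; rewrite r0 r1 rE => /(_ isT).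
rewrite Li2_1 [ln p^-1]lnV ?posrE//; last by lra.
rewrite -exprVn lnXn// lnV ?posrE//; last by lra.
rewrite exprVn -mulr_natr => B.
by lra.
Qed.

(** An antiderivative of [ln sh] with a limit at 0, obtained from
    [ln (sh s) = s / 2 + ln (1 - e^(-s))]. *)
Definition Lam s : R := s ^+ 2 / 4 + Li2 (expR (- s)).

Lemma derive_Lam s : 0 < s -> has_derive Lam s (ln (sh s)).
Proof.
move=> s0; have q1 : expR (- s) < 1 by rewrite expR_lt1 oppr_lt0.
have d1 : has_derive Li2 (expR (- s)) (- ln (1 - expR (- s)) / expR (- s)).
  by apply: derive_Li2_pos; rewrite expR_gt0.
have d2 : has_derive (fun s => Li2 (expR (- s))) s
    (- ln (1 - expR (- s)) / expR (- s) * (- expR (- s))).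
  by apply: (@derive_comp _ Li2 (fun s => expR (- s)) s _ _ d1); derive; ring.
have -> : ln (sh s) = s / 2 + ln (1 - expR (- s)).
  rewrite -[s / 2]expRK -lnM ?posrE ?expR_gt0 ?subr_gt0//; congr ln.
  by rewrite mulrBr mulr1 -expRD /sh; congr (_ - expR _); field.
rewrite /Lam; derive.
move: (ln (1 - expR (- s))) (expR (- s)) (expR_gt0 (- s)) => a b b0.
by field; rewrite gt_eqF.
Qed.

Lemma cvg_Lam_right0 : Lam s @[s --> 0^'+] --> Lam 0.
Proof.
rewrite /Lam; apply: cvgD.
  apply: cvg_at_right_filter.
  have H : continuous (fun s : R => s ^+ 2 / 4).
    by apply: continuous_derive => s; eexists; repeat derive_step.
  exact: H.
rewrite oppr0 expR0; apply: (cvg_comp (fun s => expR (- s)) Li2 _ cvg_Li2_left).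
move=> A [e /= e0 HA]; exists e => //= s; rewrite /ball_/= sub0r normrN => se s0.
have q1 : expR (- s) < 1 by rewrite expR_lt1 oppr_lt0.
apply: HA => //=; rewrite gtr0_norm ?subr_gt0//.
move: se; rewrite gtr0_norm// => se.
by have := expR_ge1Dx (- s); lra.
Qed.

Definition vv : R := 2 * ln phi.

Lemma vv_gt0 : 0 < vv.
Proof. by rewrite mulr_gt0// ln_gt0// phi_gt1. Qed.

Let expR_vv2 : expR (vv / 2) = phi.
Proof.
by rewrite /vv mulrC mulKf// lnK// posrE (lt_trans _ phi_gt1).
Qed.

Lemma sh_vv : sh vv = 1.
Proof.
rewrite /sh expRN expR_vv2; have := phi_sqr; have := phi_gt1; move: phi => p p1 p2.
have p0 : p != 0 by rewrite gt_eqF//; lra.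
by apply: (mulIf p0); rewrite mulrBl mulVf// -expr2 p2; ring.
Qed.

Lemma ch_vv : ch vv = Num.sqrt 5.
Proof.
have := ch2 vv; rewrite sh_vv => E.
rewrite -[LHS]ger0_norm ?(ltW (ch_gt0 _))// -sqrtr_sqr E; congr Num.sqrt; ring.
Qed.

Lemma expRN_vv : expR (- vv) = phi ^- 2.
Proof. by rewrite expRN -expR_vv2 -expRM_natl; congr (expR _)^-1; field. Qed.

Lemma Lam_vv : Lam vv - Lam 0 = - (pi ^+ 2 / 10).
Proof.
rewrite /Lam expRN_vv Li2_phi oppr0 expR0 Li2_1 /vv.
by move: (@pi R) (ln phi) => p l; field.
Qed.

End Dilogarithm.

(** * Stirling's formula *)

Section Stirling.
Context {R : realType}.
Notation mu := (@lebesgue_measure R).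
Implicit Types (G g dg : R -> R) (a b x y : R) (n k : nat).

(** The chord of the convex function [g] lies above it. As a function of the right endpoint the
    error has derivative [((x - a) g'(x) - (g x - g a)) / 2], which the mean value theorem bounds by
    the variation of [g']. *)
Lemma trapezoid_convex G g dg a b : a <= b ->
  (forall x, a <= x <= b -> has_derive G x (g x)) ->
  (forall x, a <= x <= b -> has_derive g x (dg x)) ->
  (forall x y, a <= x -> x <= y -> y <= b -> dg x <= dg y) ->
  0 <= (b - a) * (g a + g b) / 2 - (G b - G a) <= (b - a) ^+ 2 * (dg b - dg a) / 2.
Proof.
rewrite le_eqVlt => /predU1P[<- _ _ _|ab dG dgE nd].
  by rewrite !subrr expr0n !mul0r subrr lexx.
pose e x := (x - a) * (g a + g x) / 2 - (G x - G a).
have de x : a <= x <= b -> has_derive e x (((x - a) * dg x - (g x - g a)) / 2).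
  move=> xab; have HG := dG x xab; have Hg := dgE x xab.
  by rewrite /e; derive; field.
have [c cab] := mean_value ab de.
have -> : e a = 0 by rewrite /e !subrr !mul0r subrr.
rewrite subr0 -/(e b) => ->.
have [d dac dE] : exists2 d, a <= d <= c & g c - g a = dg d * (c - a).
  have ac : a < c by case/andP: cab.
  have [x xac|d dac gE] := mean_value ac (f := g) (df := dg).
    by apply: dgE; lra.
  by exists d => //; lra.
rewrite dE.
have h1 : dg d <= dg c by apply: nd; lra.
have h2 : dg a <= dg d by apply: nd; lra.
have h3 : dg c <= dg b by apply: nd; lra.
have -> : ((c - a) * dg c - dg d * (c - a)) / 2 * (b - a) =
    (c - a) * (dg c - dg d) * (b - a) / 2 by ring.
have c1 : 0 <= c - a by lra.
have c2 : c - a <= b - a by lra.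
apply/andP; split; first by rewrite divr_ge0 ?mulr_ge0//; lra.
rewrite ler_pM2r ?invr_gt0// expr2 mulrAC ler_pM ?mulr_ge0//; try lra.
by rewrite ler_wpM2r//; lra.
Qed.

(** Wallis recurrence in [k]: the function [y (1 - y^2 / n)^(k+1)] vanishes at both endpoints, so
    its derivative has integral 0. *)
Lemma integral_binomial_kernel n k : (0 < n)%N ->
  \int[mu]_(y in `[- Num.sqrt n%:R, Num.sqrt n%:R]) ((1 - y ^+ 2 / n%:R) ^+ k) =
  2 * Num.sqrt n%:R * \prod_(i < k) (i.+1.*2%:R / i.+1.*2.+1%:R).
Proof.
move=> n0; set r : R := Num.sqrt n%:R.
have nr : n%:R = r ^+ 2 by rewrite sqr_sqrtr.
have r0 : 0 < r by rewrite sqrtr_gt0 ltr0n.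
have rr : - r <= r by lra.
have cont i : continuous (fun y : R => (1 - y ^+ 2 / n%:R) ^+ i).
  case: i => [|i].
    rewrite (_ : (fun _ => _) = fun=> 1); last by apply/funext => y; rewrite expr0.
    by move=> y; exact: cvg_cst.
  by apply: continuous_derive => y; eexists; repeat derive_step.
elim: k => [|k IH].
  have d1 (x : R) : has_derive (fun y : R => y) x ((1 - x ^+ 2 / n%:R) ^+ 0).
    by rewrite expr0; exact: derive_id.
  by rewrite (integral_derive rr (cont 0%N) d1) big_ord0; ring.
pose f (y : R) := k.+1.*2.+1%:R * (1 - y ^+ 2 / n%:R) ^+ k.+1 -
  k.+1.*2%:R * (1 - y ^+ 2 / n%:R) ^+ k.
have df (y : R) : has_derive (fun y => y * (1 - y ^+ 2 / n%:R) ^+ k.+1) y (f y).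
  rewrite /f; derive; rewrite -[k.+1.*2.+1%:R]natr1 -muln2 natrM ![_ ^+ k.+1]exprS.
  have nn0 : n%:R != 0 :> R by rewrite pnatr_eq0 -lt0n.
  by move: n%:R nn0 k.+1%:R (_ ^+ k) => N N0 K A; field.
have cf : continuous f.
  move=> y; apply: cvgB; (apply: cvgM; first exact: cvg_cst); exact: cont.
have := integral_derive rr cf df.
rewrite sqrrN -nr divff ?pnatr_eq0 -?lt0n// subrr exprS mul0r !mulr0 subrr.
have intg i := continuous_integrable (- r) r (cont i).
rewrite /f RintegralB//; last 2 first.
- apply: continuous_integrable => y; apply: cvgM; first exact: cvg_cst.
  exact: cont.
- apply: continuous_integrable => y; apply: cvgM; first exact: cvg_cst.
  exact: cont.
rewrite !RintegralZl// IH => /eqP; rewrite subr_eq0 => /eqP E.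
have b0 : k.+1.*2.+1%:R != 0 :> R by rewrite pnatr_eq0.
by apply: (mulfI b0); rewrite E big_ord_recr /=; field.
Qed.

Lemma cvg_natV : (n%:R^-1 : R) @[n --> \oo] --> (0 : R).
Proof. by rewrite -cvg_shiftS; exact: cvg_harmonic. Qed.

(** The kernels [(1 - y^2 / n)^n] converge to [e^(- y^2)] and are dominated by it. The Gaussian
    integral thereby gives the Wallis product, which fixes the constant in Stirling's formula. *)
Lemma cvg_binomial_kernel : 2 * Num.sqrt n%:R *
  \prod_(i < n) (i.+1.*2%:R / i.+1.*2.+1%:R) @[n --> \oo] --> (Num.sqrt pi : R).
Proof.
pose f n (y : R) := ((fun y => (1 - y ^+ 2 / n%:R) ^+ n) \_ `[- Num.sqrt n%:R, Num.sqrt n%:R]) y.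
have cont n : continuous (fun y : R => (1 - y ^+ 2 / n%:R) ^+ n).
  case: n => [|n].
    rewrite (_ : (fun _ => _) = fun=> 1); last by apply/funext => y; rewrite expr0.
    by move=> y; exact: cvg_cst.
  by apply: continuous_derive => y; eexists; repeat derive_step.
have dom n y : (0 < n)%N -> 0 <= f n y <= gauss 1 y.
  move=> n0; have n1 : 0 < n%:R :> R by rewrite ltr0n.
  rewrite /f patchE; case: ifPn => [|_]; last by rewrite lexx expR_ge0.
  rewrite inE /= in_itv /= -ler_norml => yn.
  have y2 : y ^+ 2 <= n%:R.
    have : `|y| ^+ 2 <= Num.sqrt n%:R ^+ 2 by rewrite lerXn2r ?nnegrE ?sqrtr_ge0.
    by rewrite real_normK ?num_real// sqr_sqrtr.
  have u0 : 0 <= 1 - y ^+ 2 / n%:R by rewrite subr_ge0 ler_pdivrMr// mul1r.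
  rewrite exprn_ge0//= /gauss mul1r.
  have -> : - y ^+ 2 = n%:R * (- (y ^+ 2 / n%:R)) by field; rewrite gt_eqF.
  by rewrite expRM_natl lerXn2r ?nnegrE ?expR_ge0// expR_ge1Dx.
have lim y : f n y @[n --> \oo] --> gauss 1 y.
  apply: (@squeeze_cvgr _ _ _ _ (fun n => gauss 1 y * expR (- (2 * y ^+ 4 / n%:R)))
      (fun=> gauss 1 y)).
  - near=> n.
    have n0 : (0 < n)%N by near: n; exact: nbhs_infty_gt.
    have n1 : 0 < n%:R :> R by rewrite ltr0n.
    case/andP: (dom n y n0) => _ ->; rewrite andbT.
    have ny : 2 * y ^+ 2 <= n%:R by near: n; exact: nbhs_infty_ger.
    have y0 : 0 <= y ^+ 2 by exact: sqr_ge0.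
    rewrite /f patchE ifT; last first.
      rewrite inE /= in_itv /= -ler_norml -sqrtr_sqr ler_sqrt//; lra.
    pose u := y ^+ 2 / n%:R.
    have u0 : 0 <= u by rewrite divr_ge0// ltW.
    have u1 : u <= 2^-1 by rewrite ler_pdivrMr//; lra.
    (* The lower bound rests on [1 - u >= e^(- u - 2 u^2)] for [0 <= u <= 1/2]. *)
    have -> : gauss 1 y * expR (- (2 * y ^+ 4 / n%:R)) = expR (- u - 2 * u ^+ 2) ^+ n.
      rewrite /gauss -expRD -expRM_natl; congr expR; rewrite /u.
      by field; rewrite gt_eqF.
    rewrite lerXn2r ?nnegrE ?expR_ge0//; first by rewrite -/u; lra.
    rewrite -/u; have w0 : 0 < 1 - u by lra.
    rewrite -[leRHS]lnK ?posrE// ler_expR -[leRHS]opprK -lnV ?posrE//.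
    have -> : (1 - u)^-1 = 1 + u / (1 - u) by field; rewrite gt_eqF.
    have := @le_ln1Dx R (u / (1 - u)).
    have v0 : 0 <= u / (1 - u) by rewrite divr_ge0// ltW.
    have : u / (1 - u) <= u + 2 * u ^+ 2 by rewrite ler_pdivrMr//; nra.
    by move=> h1 h2; have {}h2 := h2 (lt_le_trans (ltrN10 R) v0); lra.
  - have H : - (2 * y ^+ 4 / n%:R) @[n --> \oo] --> - (2 * y ^+ 4 * 0).
      apply: cvgN; apply: cvgM; first exact: cvg_cst.
      exact: cvg_natV.
    have H2 : gauss 1 y * expR (- (2 * y ^+ 4 / n%:R)) @[n --> \oo] -->
        gauss 1 y * expR (- (2 * y ^+ 4 * 0)).
      apply: cvgM; first exact: cvg_cst.
      by apply: (@cvg_fun _ _ _ _ _ expR); [exact: continuous_expR|exact: H].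
    by move: H2; rewrite mulr0 oppr0 expR0 mulr1.
  - exact: cvg_cst.
have [||||_ L] := @Rintegral_dominated R f (gauss 1) (gauss 1).
- by move=> n; apply: measurable_restrict_itv; exact: cont.
- exact: lim.
- exact: (integrable_integral_gauss ltr01).1.
- exists 1%N => // n /= n0 y; have /andP[f0] := dom n y n0.
  by rewrite ger0_norm.
rewrite (integrable_integral_gauss ltr01).2 divr1 in L.
apply: cvg_trans L; apply: near_eq_cvg; exists 1%N => // n /= n0.
by rewrite -integral_binomial_kernel// Rintegral_mkcond.
Unshelve. all: end_near. Qed.

Definition stirling_seq n : R := ln n`!%:R - (n%:R + 2^-1) * ln n%:R + n%:R.

(** The trapezoid rule for [- ln] on [[n, n + 1]] shows that the sequence [s] decreases with steps
    bounded by a telescoping sum, so it has a limit [c]. Then [2 s_n - s_(2n)] also tends to [c],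
    and it is expressed by the Wallis product. *)
Lemma cvg_stirling_seq : stirling_seq @ \oo --> (ln (2 * pi) / 2 : R).
Proof.
have step n : (0 < n)%N -> 0 <= stirling_seq n - stirling_seq n.+1 <=
    (n%:R^-1 - n.+1%:R^-1) / 2.
  move=> n0; have n1 : 0 < n%:R :> R by rewrite ltr0n.
  have := @trapezoid_convex (fun x => - (x * ln x - x)) (fun x => - ln x)
    (fun x => - x^-1) n%:R n.+1%:R.
  rewrite ler_nat leqnSn => /(_ isT).
  have pos x : n%:R <= x <= n.+1%:R -> 0 < x by move=> /andP[nx _]; lra.
  have d1 x : n%:R <= x <= n.+1%:R -> has_derive (fun x => - (x * ln x - x)) x (- ln x).
    by move=> /pos x0; derive; [exact: x0|field; rewrite gt_eqF].
  have d2 x : n%:R <= x <= n.+1%:R -> has_derive (fun x => - ln x) x (- x^-1).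
    by move=> /pos x0; derive; [exact: x0|ring].
  move=> /(_ d1 d2) H; have {H} := H _.
  have -> : n.+1%:R - n%:R = 1 :> R by rewrite -natr1 addrC addKr.
  rewrite expr1n !mul1r => H.
  have -> : stirling_seq n - stirling_seq n.+1 =
      (- ln n%:R - ln n.+1%:R) / 2 - (- (n.+1%:R * ln n.+1%:R - n.+1%:R) -
        - (n%:R * ln n%:R - n%:R)).
    rewrite /stirling_seq factS natrM lnM ?posrE ?ltr0n ?fact_gt0// -[n.+1%:R]natr1.
    set C := ln (_ + 1); set B := ln n%:R; set A := ln n`!%:R.
    by move: A B C n%:R => A B C N; field.
  have -> : (n%:R^-1 - n.+1%:R^-1) / 2 = (- n.+1%:R^-1 - - n%:R^-1) / 2 :> R.
    by congr (_ / _); rewrite opprK addrC.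
  apply: H => x y nx xy yn; rewrite lerN2 lef_pV2 ?posrE//; lra.
have [c cL] : exists c : R, stirling_seq n @[n --> \oo] --> c.
  suff /cvg_ex : cvgn (fun n => - stirling_seq n.+1).
    move=> [l Ll]; exists (- l); rewrite -cvg_shiftS.
    by under eq_fun do rewrite -[stirling_seq _]opprK; exact: cvgN.
  apply: nondecreasing_is_cvgn.
    apply/nondecreasing_seqP => n; rewrite lerN2 -subr_ge0.
    by case/andP: (step n.+1 isT).
  exists (- stirling_seq 1 + 2^-1) => _ [n _ <-].
  suff : - stirling_seq n.+1 <= - stirling_seq 1 + (1 - n.+1%:R^-1) / 2.
    have : 0 <= n.+1%:R^-1 :> R by rewrite invr_ge0.
    by move: (_^-1) (stirling_seq n.+1) (stirling_seq 1) => A B C; lra.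
  elim: n => [|n IH]; first by rewrite invr1; lra.
  case/andP: (step n.+1 isT) IH => _.
  by move: (stirling_seq _) (stirling_seq _) (stirling_seq _) (_^-1) (_^-1) => A B C D E; lra.
have pn n : 0 < \prod_(i < n) (i.+1.*2%:R / i.+1.*2.+1%:R) :> R.
  by apply: prodr_gt0 => i _; rewrite divr_gt0// ltr0n double_gt0.
have prodE n : ln (\prod_(i < n) (i.+1.*2%:R / i.+1.*2.+1%:R)) =
    (2 * n)%:R * ln 2 + 2 * ln n`!%:R - ln (2 * n)`!%:R - ln (2 * n).+1%:R :> R.
  elim: n => [|n IH]; first by rewrite big_ord0 muln0 fact0 !ln1; ring.
  rewrite big_ord_recr /= lnM ?posrE ?pn ?divr_gt0 ?ltr0n ?double_gt0// IH.
  rewrite ln_div ?posrE ?ltr0n ?double_gt0// -!mul2n.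
  have l1 : ln (2 * n.+1)%:R = ln 2 + ln n.+1%:R :> R.
    by rewrite natrM lnM ?posrE ?ltr0n.
  have l2 : ln (2 * n.+1)`!%:R =
      ln (2 * n.+1)%:R + ln (2 * n).+1%:R + ln (2 * n)`!%:R :> R.
    rewrite -!lnM ?posrE ?mulr_gt0 ?ltr0n ?fact_gt0// -!natrM; congr (ln _%:R).
    by rewrite mulnS !addSn add0n !factS mulnA.
  have l3 : ln n.+1`!%:R = ln n.+1%:R + ln n`!%:R :> R.
    by rewrite factS natrM lnM ?posrE ?ltr0n ?fact_gt0.
  have l4 : (2 * n.+1)%:R = (2 * n)%:R + 2 :> R by rewrite -natrD mulnS addnC.
  have -> : (2 * n.+1)%:R * ln 2 = ((2 * n)%:R + 2) * ln 2 :> R by rewrite l4.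
  rewrite l2 l3 l1.
  move: (ln 2) (ln n.+1%:R) (ln n`!%:R) (ln (2 * n)`!%:R) (ln (2 * n).+1%:R)
    (ln (2 * n.+1).+1%:R) (2 * n)%:R => A B C D E F N.
  ring.
have E n : (0 < n)%N -> ln (2 * Num.sqrt n%:R * \prod_(i < n) (i.+1.*2%:R / i.+1.*2.+1%:R)) =
    2 * stirling_seq n - stirling_seq (2 * n) + ln 2 / 2 - ln (2 + n%:R^-1) :> R.
  move=> n0; have n1 : 0 < n%:R :> R by rewrite ltr0n.
  have r0 : 0 < Num.sqrt n%:R :> R by rewrite sqrtr_gt0.
  rewrite lnM ?posrE ?mulr_gt0 ?pn// lnM ?posrE// prodE.
  have lr : ln n%:R = 2 * ln (Num.sqrt n%:R) :> R.
    by rewrite -{1}(sqr_sqrtr (ler0n R n)) lnXn// mulr2n; ring.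
  have l2 : ln (2 * n)%:R = ln 2 + ln n%:R :> R by rewrite natrM lnM ?posrE.
  have l1 : ln (2 * n).+1%:R = ln n%:R + ln (2 + n%:R^-1) :> R.
    rewrite -lnM ?posrE ?addr_gt0 ?invr_gt0//; congr ln.
    by rewrite -natr1 natrM; field; rewrite gt_eqF.
  rewrite /stirling_seq l1 l2 lr natrM.
  set F := ln (2 + _); move: F => F.
  set D := ln (2 * n)`!%:R; set C := ln n`!%:R; set B := ln (Num.sqrt _).
  by set A := ln 2; move: A B C D n%:R => A B C D N; field.
have L1 : 2 * stirling_seq n - stirling_seq (2 * n) + ln 2 / 2 - ln (2 + n%:R^-1)
    @[n --> \oo] --> 2 * c - c + ln 2 / 2 - ln (2 + 0).
  apply: cvgB; last first.
    apply: (@cvg_fun _ _ _ _ _ (@ln R)); first by apply: continuous_ln; rewrite addr0.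
    by apply: cvgD; [exact: cvg_cst|exact: cvg_natV].
  apply: cvgD; last exact: cvg_cst.
  apply: cvgB; first by apply: cvgM; [exact: cvg_cst|].
  apply: (cvg_comp (fun n => (2 * n)%N) stirling_seq _ cL).
  by move=> A [N _ NA]; exists N => // n /= Nn; apply: NA => /=; lia.
have L2 : ln (2 * Num.sqrt n%:R * \prod_(i < n) (i.+1.*2%:R / i.+1.*2.+1%:R))
    @[n --> \oo] --> ln (Num.sqrt pi : R).
  apply: (@cvg_fun _ _ _ _ _ (@ln R)); last exact: cvg_binomial_kernel.
  by apply: continuous_ln; rewrite sqrtr_gt0 pi_gt0.
have L3 : 2 * stirling_seq n - stirling_seq (2 * n) + ln 2 / 2 - ln (2 + n%:R^-1)
    @[n --> \oo] --> ln (Num.sqrt pi : R).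
  by apply: cvg_trans L2; apply: near_eq_cvg; exists 1%N => // n /= n0; rewrite E.
have cE : 2 * c - c + ln 2 / 2 - ln (2 + 0) = ln (Num.sqrt pi).
  exact: (cvg_unique _ L1 L3).
have lp : ln (pi : R) = 2 * ln (Num.sqrt pi).
  by rewrite -{1}(sqr_sqrtr (pi_ge0 R)) lnXn ?sqrtr_gt0 ?pi_gt0// mulr2n; ring.
suff -> : ln (2 * pi) / 2 = c by [].
rewrite lnM ?posrE ?pi_gt0// lp -cE addr0.
by set x := ln 2; field.
Qed.

End Stirling.

(** * Height of the peak *)

Section SinhProduct.
Context {R : realType}.
Implicit Types (s t : R) (M j : nat).

(* [g s = ln (sh s / s)] is the part of [ln (sh s)] that is smooth at 0. *)
Let g s := ln (sh s) - ln s.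
Let G s := Lam s - (s * ln s - s).
Let dg s := ch s / (2 * sh s) - s^-1.

Let dG s : 0 < s -> has_derive G s (g s).
Proof.
move=> s0; rewrite /G /g; have dL := derive_Lam s0.
by derive; [exact: s0|field; rewrite gt_eqF].
Qed.

Let dgE s : 0 < s -> has_derive g s (dg s).
Proof.
move=> s0; rewrite /g /dg; have dS := derive_sh s; have S0 := sh_gt0 s0.
by derive; [exact: S0|exact: s0|field; rewrite !gt_eqF].
Qed.

Lemma sh0 : sh 0 = 0 :> R.
Proof. by rewrite /sh mul0r oppr0 subrr. Qed.

Lemma sh_ge s : 0 <= s -> s <= sh s.
Proof.
move=> s0; rewrite -subr_ge0.
have := @derive_ge0_le R (fun y => sh y - y) (fun y => ch y / 2 - 1) 0 s s0.
rewrite sh0 subrr; apply => y _.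
  by have dS := derive_sh y; derive; ring.
have e0 := expR_gt0 (y / 2); rewrite /ch expRN.
have -> : (expR (y / 2) + (expR (y / 2))^-1) / 2 - 1 =
    (expR (y / 2) - 1) ^+ 2 / (2 * expR (y / 2)) by field; rewrite gt_eqF.
by rewrite divr_ge0 ?sqr_ge0// mulr_ge0// ltW.
Qed.

Lemma two_sh_le s : 0 <= s -> 2 * sh s <= s * ch s.
Proof.
move=> s0; rewrite -subr_ge0.
have := @derive_ge0_le R (fun y => y * ch y - 2 * sh y) (fun y => y * sh y / 2) 0 s s0.
rewrite sh0 mul0r mulr0 subrr; apply => y /andP[y0 _].
  by have dS := derive_sh y; have dC := derive_ch y; derive; field.
by rewrite divr_ge0// mulr_ge0// (le_trans y0)// sh_ge.
Qed.

Let dg_nd s t : 0 < s -> s <= t -> dg s <= dg t.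
Proof.
move=> s0 st; apply: (derive_ge0_le (df := fun y => y ^- 2 - sh y ^- 2) st) => y /andP[sy _].
  have y0 : 0 < y by lra.
  have dS := derive_sh y; have dC := derive_ch y; have S0 := sh_gt0 y0.
  rewrite /dg; derive; rewrite ?gt_eqF ?mulr_gt0//.
  have := ch2 y; move: (ch y) (sh y) S0 => c u u0 E.
  transitivity (y ^- 2 - (c ^+ 2 - u ^+ 2) / 4 * u ^- 2); last by rewrite E; field; rewrite !gt_eqF.
  by field; rewrite !gt_eqF.
have y0 : 0 < y by lra.
by rewrite subr_ge0 lef_pV2 ?posrE ?exprn_gt0 ?sh_gt0// lerXn2r ?nnegrE ?(ltW (sh_gt0 y0)) ?(ltW y0)// sh_ge// ltW.
Qed.

Let dg_ge0 s : 0 < s -> 0 <= dg s.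
Proof.
move=> s0; have S0 := sh_gt0 s0; rewrite /dg subr_ge0 ler_pdivlMr ?mulr_gt0//.
by rewrite ler_pdivrMl// two_sh_le// ltW.
Qed.

Let g_nd s t : 0 < s -> s <= t -> g s <= g t.
Proof.
move=> s0 st; apply: (derive_ge0_le (df := dg) st) => y /andP[sy _];
  by [apply: dgE; lra|apply: dg_ge0; lra].
Qed.

Let g_ge0 s : 0 < s -> 0 <= g s.
Proof.
by move=> s0; rewrite subr_ge0 ler_ln ?posrE ?sh_gt0// sh_ge// ltW.
Qed.

Lemma cvg_ln_sh_sub : ln (sh s) - ln s @[s --> (0 : R)^'+] --> (0 : R).
Proof.
apply: (@squeeze_cvgr _ _ _ _ (cst 0) (fun s => ch s / 2 - 1)).
- near=> s; have s0 : 0 < s by near: s; exact: nbhs_right_gt.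
  rewrite g_ge0//= /g -ln_div ?posrE ?sh_gt0//.
  have C0 := ch_gt0 s; apply: (@le_trans _ _ (ln (ch s / 2))).
    rewrite ler_ln ?posrE ?divr_gt0 ?sh_gt0// ler_pdivrMr// mulrAC ler_pdivlMr//.
    by rewrite mulrC [leRHS]mulrC two_sh_le// ltW.
  have -> : ch s / 2 = 1 + (ch s / 2 - 1) by ring.
  apply: le_trans (le_ln1Dx _) _; last by lra.
  by have : 0 < ch s / 2; [rewrite divr_gt0|lra].
- exact: cvg_cst.
- have c0 : continuous (fun s : R => ch s / 2 - 1).
    by apply: continuous_derive => s; have dC := derive_ch s; eexists; repeat derive_step.
  have := cvg_at_right_filter (c0 0).
  by rewrite /ch mul0r oppr0 expR0 (_ : (1 + 1) / 2 - 1 = 0 :> R)//; lra.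
Unshelve. all: end_near. Qed.

Lemma cvg_xlnx : s * ln s @[s --> (0 : R)^'+] --> (0 : R).
Proof.
apply: norm_cvg0; apply: (@squeeze_cvgr _ _ _ _ (cst 0) (fun s => 2 * Num.sqrt s)).
- near=> s; have s0 : 0 < s by near: s; exact: nbhs_right_gt.
  have s1 : s <= 1 by near: s; exact: nbhs_right_le.
  have r0 : 0 < Num.sqrt s by rewrite sqrtr_gt0.
  rewrite /= normr_ge0 normrM gtr0_norm// ler0_norm ?ln_le0//.
  have sE : s = Num.sqrt s ^+ 2 by rewrite sqr_sqrtr// ltW.
  have h : ln (Num.sqrt s)^-1 < (Num.sqrt s)^-1 by rewrite ln_sublinear ?invr_gt0.
  rewrite lnV ?posrE// in h; rewrite {1 2}sE lnXn// mulr2n.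
  have -> : 2 * Num.sqrt s = Num.sqrt s ^+ 2 * (2 * (Num.sqrt s)^-1).
    by field; rewrite gt_eqF.
  by rewrite ler_wpM2l ?sqr_ge0//; move: h; move: (ln _) (_^-1) => a b; lra.
- exact: cvg_cst.
- rewrite -[X in _ --> X](mulr0 2); apply: cvgM; first exact: cvg_cst.
  by rewrite -[X in _ --> X]sqrtr0; apply: cvg_at_right_filter; exact: sqrt_continuous.
Unshelve. all: end_near. Qed.

Let G_right0 t : 0 < t -> 0 <= G t - Lam 0 <= t * g t.
Proof.
move=> t0; have L : G t - G s @[s --> 0^'+] --> G t - Lam 0.
  apply: cvgB; first exact: cvg_cst.
  rewrite -[X in _ --> X]subr0 -[X in _ --> _ - X](subrr (0 : R)).
  apply: cvgB; first exact: cvg_Lam_right0.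
  apply: cvgB; first exact: cvg_xlnx.
  by apply: cvg_at_right_filter; exact: cvg_id.
have H : \forall s \near 0^'+, 0 <= G t - G s <= t * g t.
  near=> s; have s0 : 0 < s by near: s; exact: nbhs_right_gt.
  have st : s < t by near: s; exact: nbhs_right_lt.
  have [|c /andP[sc ct] ->] := mean_value st (f := G) (df := g).
    by move=> x /andP[sx _]; apply: dG; lra.
  have gc : 0 <= g c by apply: g_ge0; lra.
  have gt : g c <= g t by apply: g_nd; lra.
  by apply/andP; split; [apply: mulr_ge0; lra|rewrite mulrC ler_pM//; lra].
apply/andP; split.
  by apply: (cvgr_to_ge L); apply: filterS H => s /andP[].
by apply: (cvgr_to_le L); apply: filterS H => s /andP[].
Unshelve. all: end_near. Qed.

(** First order Euler-Maclaurin formula on [[0, M t]]: the trapezoid rule for the convex function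
    [g] on [[t, M t]], and monotonicity of [g] on the first cell, where the antiderivative [G]
    enters through its limit [Lam 0] at [0+]. *)
Let sum_g_bounds t M : 0 < t -> (0 < M)%N ->
  `|t * (\sum_(1 <= j < M.+1) g (j%:R * t)) - (G (M%:R * t) - Lam 0) -
    t * g (M%:R * t) / 2| <= t ^+ 2 * dg (M%:R * t) / 2 + 2 * (t * g t).
Proof.
move=> t0; case: M => // M _.
have bnd : 0 <= t * (\sum_(1 <= j < M.+2) g (j%:R * t)) - (G (M.+1%:R * t) - G t) -
    t * g (M.+1%:R * t) / 2 - t * g t / 2 <= t ^+ 2 * (dg (M.+1%:R * t) - dg t) / 2.
  elim: M => [|M IH]; first by rewrite big_nat1 mul1r !subrr; lra.
  have a0 : 0 < M.+1%:R * t by rewrite mulr_gt0.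
  have ab : M.+1%:R * t <= M.+2%:R * t by rewrite ler_wpM2r ?(ltW t0)// ler_nat.
  have := @trapezoid_convex R G g dg _ _ ab.
  have -> : M.+2%:R * t - M.+1%:R * t = t by rewrite -[M.+2%:R]natr1; ring.
  move=> H; have /andP[h1 h2] : 0 <= t * (g (M.+1%:R * t) + g (M.+2%:R * t)) / 2 -
      (G (M.+2%:R * t) - G (M.+1%:R * t)) <=
      t ^+ 2 * (dg (M.+2%:R * t) - dg (M.+1%:R * t)) / 2.
    apply: H => [x /andP[ax _]|x /andP[ax _]|x y ax xy _].
    - by apply: dG; exact: lt_le_trans ax.
    - by apply: dgE; exact: lt_le_trans ax.
    - by apply: dg_nd => //; exact: lt_le_trans ax.
  rewrite big_nat_recr//= mulrDr; case/andP: IH.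
  move: h1 h2; move: (t * \sum_(1 <= j < M.+2) _) => A.
  move: (G _) (G _) (G _) (g _) (g _) (g _) (dg _) (dg _) (dg _) => B C D E F H1 I J K.
  by move=> h1 h2 h3 h4; apply/andP; split; lra.
have M0 : 0 < M.+1%:R * t by rewrite mulr_gt0.
have := G_right0 t0; have := dg_ge0 t0; have := g_ge0 t0; have := dg_ge0 M0.
move: bnd; rewrite ler_norml; move: (t * \sum_(1 <= j < M.+2) _) => A.
move: (G _) (G _) (g _) (dg _) (dg _) => B C E I J /andP[b1 b2] I0 g0 J0 /andP[c1 c2].
have : 0 <= t ^+ 2 * I by rewrite mulr_ge0 ?sqr_ge0.
have : 0 <= t ^+ 2 * J by rewrite mulr_ge0 ?sqr_ge0.
have : 0 <= t * g t by rewrite mulr_ge0// ltW.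
by move=> p1 p2 p3; apply/andP; split; lra.
Qed.

(** The mesh whose [M]-th node is exactly [vv], the point where [sh] equals 1. *)
Definition step M : R := vv / M%:R.

Lemma step_gt0 M : (0 < M)%N -> 0 < step M.
Proof. by move=> M0; rewrite divr_gt0 ?vv_gt0// ltr0n. Qed.

Lemma mul_step M : (0 < M)%N -> M%:R * step M = vv.
Proof. by move=> M0; rewrite mulrCA divff ?mulr1// pnatr_eq0 -lt0n. Qed.

Lemma cvg_step : step M @[M --> \oo] --> (0 : R).
Proof.
rewrite -[X in _ --> X](mulr0 vv); apply: cvgM; first exact: cvg_cst.
exact: cvg_natV.
Qed.

Lemma cvg_step_right : step M @[M --> \oo] --> (0 : R)^'+.
Proof.
move=> A [e /= e0 eA]; have := cvg_step; move/cvgrPdist_lt => /(_ e e0)[N _ NA].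
exists (maxn N 1) => // M /=; rewrite geq_max => /andP[NM M1].
by apply: eA; [exact: NA|exact: step_gt0].
Qed.

(** In [ln (sh (j t)) = g (j t) + ln (j t)] the first part is compared with its integral and the
    second sums to [ln M! + M ln t]. Since [sh vv = 1], [g vv = - ln vv = - ln (M t)], and the terms
    assemble into [stirling_seq]. *)
Lemma cvg_sum_ln_sh : \sum_(1 <= j < M.+1) ln (sh (j%:R * step M)) +
  pi ^+ 2 / 10 / step M + ln (step M) / 2 @[M --> \oo] --> (ln (2 * pi) / 2 : R).
Proof.
pose err M := \sum_(1 <= j < M.+1) g (j%:R * step M) - (G vv - Lam 0) / step M -
  g vv / 2.
have err0 : err M @[M --> \oo] --> 0.
  apply: norm_cvg0; apply: (@squeeze_cvgr _ _ _ _ (cst 0)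
    (fun M => step M * dg vv / 2 + 2 * g (step M))).
  - exists 1%N => // M /= M0; rewrite normr_ge0 /=.
    have t0 := step_gt0 M0; have := sum_g_bounds t0 M0; rewrite mul_step//.
    have nE : step M * `|err M| = `|step M * err M| by rewrite normrM (gtr0_norm t0).
    move=> H; rewrite -(ler_pM2l t0) nE; move: H.
    rewrite /err; set S := \sum_(_ <= _ < _) _.
    set A := G _; set B := Lam 0; set C := g vv; set D := dg _; set E := g (step M).
    move: t0; move: (step M) => t t0.
    have -> : t * (S - (A - B) / t - C / 2) = t * S - (A - B) - t * C / 2.
      by field; rewrite gt_eqF.
    by have -> : t * (t * D / 2 + 2 * E) = t ^+ 2 * D / 2 + 2 * (t * E) by field.
  - exact: cvg_cst.
  - apply: (@cvg_eq _ _ _ _ (0 * dg vv / 2 + 2 * 0)); last by rewrite !mul0r mulr0 addr0.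
    apply: cvgD.
      apply: cvgM; last exact: cvg_cst.
      by apply: cvgM; [exact: cvg_step|exact: cvg_cst].
    apply: cvgM; first exact: cvg_cst.
    exact: (cvg_comp step g cvg_step_right cvg_ln_sh_sub).
have L : stirling_seq M + err M @[M --> \oo] --> ln (2 * pi) / 2 + 0.
  by apply: cvgD => //; exact: cvg_stirling_seq.
rewrite addr0 in L; apply: cvg_trans L; apply: near_eq_cvg.
exists 1%N => // M /= M0; have t0 := step_gt0 M0; have M1 : 0 < M%:R :> R by rewrite ltr0n.
have -> : \sum_(1 <= j < M.+1) ln (sh (j%:R * step M)) =
    \sum_(1 <= j < M.+1) g (j%:R * step M) + (ln M`!%:R + M%:R * ln (step M)).
  have -> : ln M`!%:R + M%:R * ln (step M) = \sum_(1 <= j < M.+1) ln (j%:R * step M).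
    move: (step M) t0 => t t1; elim: (M) => [|k IH].
      by rewrite big_geq// ln1 mul0r addr0.
    rewrite big_nat_recr//= -IH factS natrM !lnM ?posrE ?ltr0n ?fact_gt0//.
    rewrite [k.+1%:R * ln t]mulrC -[in ln t * _]natr1.
    by move: (ln _) (ln _) (ln _) => a b c; ring.
  by rewrite -big_split /=; apply: eq_bigr => j _; rewrite /g subrK.
have lv : ln vv = ln M%:R + ln (step M) by rewrite -lnM ?posrE// mul_step.
have vt : vv / step M = M%:R by rewrite -(mul_step M0) mulfK// gt_eqF.
have Gv : (G vv - Lam 0) / step M =
    - (pi ^+ 2 / 10) / step M - M%:R * ln vv + M%:R.
  by rewrite -Lam_vv -vt /G; field; rewrite gt_eqF.
have gv : g vv = - ln vv by rewrite /g sh_vv ln1 sub0r.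
rewrite /err /stirling_seq Gv gv lv mulNr.
move: M%:R (\sum_(_ <= _ < _) _) (ln M`!%:R) (ln M%:R) (ln (step M))
  (pi ^+ 2 / 10 / step M) => E A B C D F.
by field.
Qed.

Lemma amp0E t M : 0 < t ->
  amp t M 0 = expR (- (2 * \sum_(1 <= j < M.+1) ln (sh (j%:R * t)))).
Proof.
move=> t0; elim: M => [|M IH]; first by rewrite amp0 big_geq// mulr0 oppr0 expR0.
have S0 : 0 < sh (M.+1%:R * t) by rewrite sh_gt0// mulr_gt0.
rewrite ampS IH (@big_nat_recr _ _ _ M.+1 1)//= mulrDr opprD expRD; congr (_ * _).
rewrite /fden mulr0 mul0r sin0 expr0n mulr0 addr0 expRN expRM_natl lnK//.
Qed.

Lemma cvg_amp0 : amp (step M) M 0 * expR (- (pi ^+ 2 / 5 / step M)) / step M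
  @[M --> \oo] --> (2 * pi)^-1.
Proof.
have L : expR (- (2 * (\sum_(1 <= j < M.+1) ln (sh (j%:R * step M)) +
    pi ^+ 2 / 10 / step M + ln (step M) / 2))) @[M --> \oo] -->
    expR (- (2 * (ln (2 * pi) / 2 : R))).
  apply: (@cvg_fun _ _ _ _ _ expR); first exact: continuous_expR.
  by apply: cvgN; apply: cvgM; [exact: cvg_cst|exact: cvg_sum_ln_sh].
have l2 : 2 * (ln (2 * pi) / 2) = ln (2 * pi) :> R by set x := ln _; field.
rewrite l2 expRN lnK ?posrE ?mulr_gt0 ?pi_gt0// in L.
apply: cvg_trans L; apply: near_eq_cvg; exists 1%N => // M /= M0.
have t0 := step_gt0 M0; rewrite amp0E//.
rewrite !mulrDr !opprD !expRD; congr (_ * _ * _).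
  by congr expR; congr (- _); field; rewrite gt_eqF.
have -> : 2 * (ln (step M) / 2) = ln (step M) by set x := ln _; field.
by rewrite expRN lnK.
Qed.

End SinhProduct.

(** * Riemann sums for the phase and the modulus *)

Section RiemannSums.
Context {R : realType}.
Implicit Types (F q : R -> R) (s t u : R) (m j : nat).

(** Right endpoint sums of a nonincreasing function lie below its integral, and the errors of the
    cells telescope. The integral from 0 is written [F (m t) - l], with [l] the limit of the
    antiderivative at [0+]. *)
Lemma riemann_nonincreasing F q (l K : R) t m :
  (forall s, 0 < s -> has_derive F s (q s)) -> F s @[s --> 0^'+] --> l ->
  (forall s u, 0 < s -> s <= u -> q u <= q s) -> (forall s, 0 < s -> q s <= K) ->
  0 < t -> (0 < m)%N ->
  0 <= F (m%:R * t) - l - t * \sum_(1 <= j < m.+1) q (j%:R * t) <=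
    t * (K - q (m%:R * t)).
Proof.
move=> dF cF nd qK t0; case: m => // m _; elim: m => [|m IH].
  rewrite big_nat1 mul1r.
  have L : F t - F s - (t - s) * q t @[s --> 0^'+] --> F t - l - (t - 0) * q t.
    apply: cvgB; first by apply: cvgB => //; exact: cvg_cst.
    apply: cvgM; last exact: cvg_cst.
    apply: cvgB; first exact: cvg_cst.
    by apply: cvg_at_right_filter; exact: cvg_id.
  have H : \forall s \near 0^'+, 0 <= F t - F s - (t - s) * q t <= t * (K - q t).
    near=> s; have s0 : 0 < s by near: s; exact: nbhs_right_gt.
    have st : s < t by near: s; exact: nbhs_right_lt.
    have [|c /andP[sc ct] ->] := mean_value st (f := F) (df := q).
      by move=> x /andP[sx _]; apply: dF; exact: lt_le_trans sx.
    have q1 : q t <= q c by apply: nd; lra.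
    have q2 : q c <= K by apply: qK; lra.
    have -> : q c * (t - s) - (t - s) * q t = (t - s) * (q c - q t) by ring.
    by apply/andP; split; [apply: mulr_ge0; lra|apply: ler_pM; lra].
  rewrite subr0 in L; apply/andP; split.
    by apply: (cvgr_to_ge L); apply: filterS H => s /andP[].
  by apply: (cvgr_to_le L); apply: filterS H => s /andP[].
have a0 : 0 < m.+1%:R * t by rewrite mulr_gt0.
have ab : m.+1%:R * t < m.+2%:R * t by rewrite ltr_pM2r// ltr_nat.
have tE : m.+2%:R * t - m.+1%:R * t = t by rewrite -[m.+2%:R]natr1; ring.
have [|c /andP[ac cb] E] := mean_value ab (f := F) (df := q).
  by move=> x /andP[ax _]; apply: dF; exact: lt_le_trans ax.
rewrite tE in E.
have q1 : q (m.+2%:R * t) <= q c by apply: nd; [exact: lt_trans ac|exact: ltW].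
have q2 : q c <= q (m.+1%:R * t) by apply: nd => //; exact: ltW.
rewrite big_nat_recr//= mulrDr; case/andP: IH.
move: (t * \sum_(1 <= j < m.+2) _) E => A.
move: q1 q2; move: (q _) (q _) (q _) (F _) (F _) => a b c' d e q1 q2 E h1 h2.
have : 0 <= t * (a - b) by rewrite mulr_ge0 ?(ltW t0)//; lra.
have : 0 <= t * (b - c') by rewrite mulr_ge0 ?(ltW t0)//; lra.
by move=> h3 h4; apply/andP; split; lra.
Unshelve. all: end_near. Qed.

(** [pcoth s = s coth (s / 2)]. For small [theta] the [j]-th factor adds [theta / t * pcoth (j t)]
    to the phase and [(theta / t)^2 * sq_csch (j t)] to minus the logarithm of the modulus. The
    antiderivatives come from [Lam] by integration by parts. *)
Definition pcoth s : R := s * ch s / sh s.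
Definition int_pcoth s : R := 2 * (s * ln (sh s)) - 2 * Lam s.
Definition sq_csch s : R := (s / sh s) ^+ 2.
Definition int_sq_csch s : R := int_pcoth s - s ^+ 2 * ch s / (2 * sh s).

Lemma derive_int_pcoth s : 0 < s -> has_derive int_pcoth s (pcoth s).
Proof.
move=> s0; have S0 := sh_gt0 s0; have dS := derive_sh s; have dL := derive_Lam s0.
by rewrite /int_pcoth /pcoth; derive; [exact: S0|field; rewrite gt_eqF].
Qed.

Lemma derive_int_sq_csch s : 0 < s -> has_derive int_sq_csch s (sq_csch s).
Proof.
move=> s0; have S0 := sh_gt0 s0; have dS := derive_sh s; have dC := derive_ch s.
have dP := derive_int_pcoth s0.
rewrite /int_sq_csch /sq_csch; derive; first by rewrite gt_eqF ?mulr_gt0.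
rewrite /pcoth; have := ch2 s; move: (ch s) (sh s) S0 => c u u0 E.
transitivity (s ^+ 2 * ((c ^+ 2 - u ^+ 2) / 4) / u ^+ 2); last first.
  by rewrite E; field; rewrite gt_eqF.
by field; rewrite gt_eqF.
Qed.

Lemma derive_pcoth s : 0 < s ->
  has_derive pcoth s ((sh (2 * s) - 2 * s) / sh s ^+ 2).
Proof.
move=> s0; have S0 := sh_gt0 s0; have dS := derive_sh s; have dC := derive_ch s.
rewrite /pcoth; derive; first by rewrite gt_eqF.
have -> : sh (2 * s) = ch s * sh s.
  by rewrite /ch /sh [RHS]mulrC -subr_sqr -!expRM_natl; congr (expR _ - expR _); field.
have := ch2 s; move: (ch s) (sh s) S0 => c u u0 E.
transitivity ((c * u - 2 * s * ((c ^+ 2 - u ^+ 2) / 4)) / u ^+ 2); last first.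
  by rewrite E; field; rewrite gt_eqF.
by field; rewrite gt_eqF.
Qed.

Lemma pcoth_le s u : 0 < s -> s <= u -> pcoth s <= pcoth u.
Proof.
move=> s0 su; apply: (derive_ge0_le su) => [y /andP[sy _]|y /andP[sy _]].
  by apply: derive_pcoth; lra.
by rewrite divr_ge0 ?sqr_ge0// subr_ge0 sh_ge//; lra.
Qed.

Lemma pcoth_ge0 s : 0 < s -> 0 <= pcoth s.
Proof.
by move=> s0; rewrite divr_ge0 ?mulr_ge0 ?(ltW (ch_gt0 _)) ?(ltW (sh_gt0 _))// ltW.
Qed.

Lemma s_sh_ge0 s : 0 < s -> 0 <= s / sh s <= 1.
Proof.
move=> s0; have S0 := sh_gt0 s0; rewrite divr_ge0 ?(ltW s0) ?(ltW S0)//=.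
by rewrite ler_pdivrMr// mul1r sh_ge// ltW.
Qed.

Lemma s_sh_le s u : 0 < s -> s <= u -> u / sh u <= s / sh s.
Proof.
move=> s0 su; rewrite -lerN2.
apply: (derive_ge0_le (f := fun y => - (y / sh y))
  (df := fun y => (y * ch y / 2 - sh y) / sh y ^+ 2) su) => y /andP[sy _].
  have y0 : 0 < y by lra.
  have dS := derive_sh y; have S0 := sh_gt0 y0.
  by derive; [rewrite gt_eqF|field; rewrite gt_eqF].
rewrite divr_ge0 ?sqr_ge0// subr_ge0 ler_pdivlMr// mulrC two_sh_le//; lra.
Qed.

Lemma sq_csch_le s u : 0 < s -> s <= u -> sq_csch u <= sq_csch s.
Proof.
move=> s0 su; have u0 : 0 < u by lra.
have /andP[a0 _] := s_sh_ge0 s0; have /andP[b0 _] := s_sh_ge0 u0.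
by rewrite lerXn2r ?nnegrE// s_sh_le.
Qed.

Lemma sq_csch_le1 s : 0 < s -> sq_csch s <= 1.
Proof.
by move=> s0; have /andP[a0 a1] := s_sh_ge0 s0; rewrite /sq_csch exprn_ile1.
Qed.

Lemma cvg_int_pcoth_right0 : int_pcoth s @[s --> 0^'+] --> - (2 * Lam 0).
Proof.
have sL : s @[s --> (0 : R)^'+] --> (0 : R) by apply: cvg_at_right_filter; exact: cvg_id.
have L1 : s * (ln (sh s) - ln s) + s * ln s @[s --> (0 : R)^'+] --> 0 * 0 + (0 : R).
  by apply: cvgD; [apply: cvgM => //; exact: cvg_ln_sh_sub|exact: cvg_xlnx].
rewrite /int_pcoth; apply: (@cvg_eq _ _ _ _ (2 * (0 * 0 + 0) - 2 * Lam 0)); last by ring.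
apply: cvgB; last by apply: cvgM; [exact: cvg_cst|exact: cvg_Lam_right0].
apply: cvgM; first exact: cvg_cst.
apply: cvg_trans L1; apply: near_eq_cvg; apply: nearW => s /=.
by rewrite -mulrDr subrK.
Qed.

Lemma cvg_int_sq_csch_right0 : int_sq_csch s @[s --> 0^'+] --> - (2 * Lam 0).
Proof.
rewrite /int_sq_csch; apply: (@cvg_eq _ _ _ _ (- (2 * Lam 0) - 0)); last by rewrite subr0.
apply: cvgB; first exact: cvg_int_pcoth_right0.
apply: (@squeeze_cvgr _ _ _ _ (cst 0) (fun s => s * ch s / 2)).
- near=> s; have s0 : 0 < s by near: s; exact: nbhs_right_gt.
  have S0 := sh_gt0 s0; have C0 := ch_gt0 s; have /andP[a0 a1] := s_sh_ge0 s0.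
  have -> : s ^+ 2 * ch s / (2 * sh s) = s * ch s / 2 * (s / sh s).
    by field; rewrite gt_eqF.
  have b0 : 0 <= s * ch s / 2 by rewrite divr_ge0// mulr_ge0// ltW.
  by rewrite mulr_ge0//= ler_piMr.
- exact: cvg_cst.
- have c0 : continuous (fun s : R => s * ch s / 2).
    by apply: continuous_derive => s; have dC := derive_ch s; eexists; repeat derive_step.
  by have := cvg_at_right_filter (c0 0); rewrite !mul0r.
Unshelve. all: end_near. Qed.

(** The integral of [sq_csch] over [[0, vv]]: the rate of Gaussian decay in the angle. *)
Definition sigma2 : R := pi ^+ 2 / 5 - Num.sqrt 5 / 2 * vv ^+ 2.

(** In units of [theta / t^2] this is the slope of the phase at the peak. It coincides with the
    limit of [t^2 n], so it cancels against [n theta]. *)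
Lemma int_pcoth_vv : int_pcoth vv + 2 * Lam 0 = pi ^+ 2 / 5.
Proof.
rewrite /int_pcoth sh_vv ln1 mulr0 mulr0 sub0r.
have -> : Lam vv = Lam 0 - pi ^+ 2 / 10 :> R by rewrite -Lam_vv; ring.
by set x : R := pi ^+ 2; field.
Qed.

Lemma int_sq_csch_vv : int_sq_csch vv + 2 * Lam 0 = sigma2.
Proof.
rewrite /int_sq_csch sh_vv ch_vv /sigma2 -int_pcoth_vv.
by move: (int_pcoth _) (Num.sqrt _) => a b; field.
Qed.

(** The closed form does not display a sign; as an integral, [sigma2] is at least the one-term
    Riemann sum [vv * sq_csch vv]. *)
Lemma sigma2_gt0 : 0 < sigma2.
Proof.
have v0 := @vv_gt0 R.
have := @riemann_nonincreasing int_sq_csch sq_csch (- (2 * Lam 0)) 1 vv 1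
  derive_int_sq_csch cvg_int_sq_csch_right0 sq_csch_le sq_csch_le1 v0 isT.
rewrite big_nat1 mul1r opprK int_sq_csch_vv => /andP[h _].
have : 0 < vv * sq_csch vv :> R.
  by rewrite mulr_gt0// /sq_csch sh_vv divr1 exprn_gt0.
lra.
Qed.

End RiemannSums.

(** * Taylor remainders with monotone derivatives *)

Section TaylorMonotone.
Context {R : realType}.
Implicit Types (F f g : R -> R) (a b v : R).

(** The remainder is bounded by the variation of [f] between [v] and [b], so continuity of [f] at
    [v] makes it [o(|b - v|)]. *)
Lemma taylor1_monotone F f v b : 0 < v -> 0 < b ->
  (forall s, 0 < s -> has_derive F s (f s)) ->
  (forall s u, 0 < s -> s <= u -> f s <= f u) ->
  `|F b - F v - f v * (b - v)| <= `|f b - f v| * `|b - v|.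
Proof.
move=> v0 b0 dF nd.
have [vb|bv|->] := ltgtP v b; last by rewrite !subrr mulr0 subrr normr0 mul0r.
  have [|c /andP[vc cb] ->] := mean_value vb (f := F) (df := f).
    by move=> x /andP[vx _]; apply: dF; lra.
  have f1 : f v <= f c by apply: nd => //; exact: ltW.
  have f2 : f c <= f b by apply: nd; lra.
  rewrite -mulrBl normrM ler_wpM2r// !ger0_norm; lra.
have [|c /andP[bc cv] E] := mean_value bv (f := F) (df := f).
  by move=> x /andP[bx _]; apply: dF; lra.
have f1 : f b <= f c by apply: nd => //; exact: ltW.
have f2 : f c <= f v by apply: nd; lra.
have -> : F b - F v - f v * (b - v) = (f c - f v) * (b - v) by lra.
rewrite normrM ler_wpM2r// !ler0_norm; lra.
Qed.

(** At the critical point [v], [F] is compared with the two quadratics of second derivative [g v]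
    and [g b]; its difference with each of them is monotone between [v] and [b]. *)
Lemma taylor2_monotone F f g v b : 0 < v -> 0 < b -> f v = 0 ->
  (forall s, 0 < s -> has_derive F s (f s)) ->
  (forall s, 0 < s -> has_derive f s (g s)) ->
  (forall s u, 0 < s -> s <= u -> g u <= g s) ->
  `|F b - F v - g v * (b - v) ^+ 2 / 2| <= `|g b - g v| * (b - v) ^+ 2 / 2.
Proof.
move=> v0 b0 fv dF df nd.
have E (k : R) s : 0 < s ->
    has_derive (fun s => F s - k * (s - v) ^+ 2 / 2) s (f s - k * (s - v)).
  by move=> s0; have dFs := dF s s0; derive; field.
have [vb|bv|->] := ltgtP v b; last by rewrite !subrr expr0n /= mulr0 !mul0r subrr normr0 mulr0 mul0r.
  have fE s : v <= s <= b -> g b * (s - v) <= f s <= g v * (s - v).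
    rewrite le_eqVlt => /andP[/predU1P[<- _|vs sb]]; first by rewrite fv subrr !mulr0 lexx.
    have [|c /andP[vc cs]] := mean_value vs (f := f) (df := g).
      by move=> x /andP[vx _]; apply: df; lra.
    rewrite fv subr0 => ->.
    have g1 : g c <= g v by apply: nd => //; exact: ltW.
    have g2 : g b <= g c by apply: nd; lra.
    by rewrite !ler_wpM2r//; lra.
  have h1 := derive_ge0_le (ltW vb) (f := fun s => F s - g b * (s - v) ^+ 2 / 2)
    (df := fun s => f s - g b * (s - v)).
  have h2 := derive_ge0_le (ltW vb) (f := fun s => - (F s - g v * (s - v) ^+ 2 / 2))
    (df := fun s => - (f s - g v * (s - v))).
  have {}h1 : F v - g b * (v - v) ^+ 2 / 2 <= F b - g b * (b - v) ^+ 2 / 2.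
    apply: h1 => s sI; first by apply: E; lra.
    by case/andP: (fE s sI); lra.
  have {}h2 : - (F v - g v * (v - v) ^+ 2 / 2) <= - (F b - g v * (b - v) ^+ 2 / 2).
    apply: h2 => s sI; first by apply: derive_opp; apply: E; lra.
    by case/andP: (fE s sI); lra.
  have g0 : g b <= g v by apply: nd => //; exact: ltW.
  rewrite subrr expr0n /= !mulr0 !mul0r !subr0 in h1 h2.
  by rewrite (ler0_norm (_ : g b - g v <= 0)) ?ler0_norm//; lra.
have fE s : b <= s <= v -> g b * (s - v) <= f s <= g v * (s - v).
  move=> /andP[bs]; rewrite le_eqVlt => /predU1P[->|sv]; first by rewrite fv subrr !mulr0 lexx.
  have [|c /andP[sc cv]] := mean_value sv (f := f) (df := g).
    by move=> x /andP[vx _]; apply: df; lra.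
  rewrite fv sub0r => fsE; have -> : f s = g c * (s - v) by lra.
  have g1 : g v <= g c by apply: nd; lra.
  have g2 : g c <= g b by apply: nd; lra.
  by rewrite !ler_wnM2r//; lra.
have h1 := derive_ge0_le (ltW bv) (f := fun s => F s - g b * (s - v) ^+ 2 / 2)
  (df := fun s => f s - g b * (s - v)).
have h2 := derive_ge0_le (ltW bv) (f := fun s => - (F s - g v * (s - v) ^+ 2 / 2))
  (df := fun s => - (f s - g v * (s - v))).
have {}h1 : F b - g b * (b - v) ^+ 2 / 2 <= F v - g b * (v - v) ^+ 2 / 2.
  apply: h1 => s sI; first by apply: E; lra.
  by case/andP: (fE s sI); lra.
have {}h2 : - (F b - g v * (b - v) ^+ 2 / 2) <= - (F v - g v * (v - v) ^+ 2 / 2).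
  apply: h2 => s sI; first by apply: derive_opp; apply: E; lra.
  by case/andP: (fE s sI); lra.
have g0 : g v <= g b by apply: nd => //; exact: ltW.
rewrite subrr expr0n /= !mulr0 !mul0r !subr0 in h1 h2.
by rewrite !ger0_norm; lra.
Qed.

End TaylorMonotone.

(** * Expansion of the modulus and the phase at small angles *)

Section Products.
Context {R : realType}.
Implicit Types (t theta y : R) (m j : nat).

(** Relative excess of [fden] over its value at [theta = 0]; [damping] is thus the modulus
    normalised to 1 at [theta = 0]. *)
Definition dev t theta j : R := 4 * sin (j%:R * theta / 2) ^+ 2 / sh (j%:R * t) ^+ 2.
Definition damping t theta m : R := \prod_(1 <= j < m.+1) (1 + dev t theta j)^-1.

Lemma dev_ge0 t theta j : 0 <= dev t theta j.
Proof. by apply: divr_ge0; rewrite ?sqr_ge0// mulr_ge0 ?sqr_ge0. Qed.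

Lemma amp_damping t m theta : 0 < t -> amp t m theta = amp t m 0 * damping t theta m.
Proof.
move=> t0; elim: m => [|m IH]; first by rewrite !amp0 /damping big_geq// mulr1.
rewrite !ampS IH [damping t theta m.+1](@big_nat_recr _ _ _ m.+1 1)//= -/(damping t theta m).
have S0 : 0 < sh (m.+1%:R * t) by rewrite sh_gt0// mulr_gt0.
have D0 : 0 < 1 + dev t theta m.+1 by rewrite ltr_wpDr// dev_ge0.
have -> : fden (m.+1%:R * t) (m.+1%:R * theta) =
    sh (m.+1%:R * t) ^+ 2 * (1 + dev t theta m.+1).
  by rewrite /fden /dev; field; rewrite gt_eqF.
rewrite /fden mulr0 mul0r sin0 expr0n mulr0 addr0.
by field; rewrite !gt_eqF.
Qed.

Lemma expR_sumN (F : nat -> R) m :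
  expR (- \sum_(1 <= j < m.+1) F j) = \prod_(1 <= j < m.+1) expR (- F j).
Proof.
elim: m => [|m IH]; first by rewrite !big_geq// oppr0 expR0.
by rewrite !(@big_nat_recr _ _ _ m.+1 1)//= opprD expRD IH.
Qed.

Lemma prod_le (F G : nat -> R) m : (forall j, (0 < j <= m)%N -> 0 <= F j <= G j) ->
  \prod_(1 <= j < m.+1) F j <= \prod_(1 <= j < m.+1) G j.
Proof.
move=> FG; rewrite big_seq [leRHS]big_seq; apply: ler_prod => j.
by rewrite mem_index_iota ltnS; exact: FG.
Qed.

Lemma inv1D_le_expR (a : R) : 0 <= a -> (1 + a)^-1 <= expR (- (a - a ^+ 2)).
Proof.
move=> a0; have a1 : 0 < 1 + a by lra.
have -> : (1 + a)^-1 = 1 + - (a / (1 + a)) by field; rewrite gt_eqF.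
apply: le_trans (expR_ge1Dx _) _; rewrite ler_expR lerN2 ler_pdivlMr//.
have : 0 <= a ^+ 3 by rewrite exprn_ge0.
by rewrite !exprS expr0 mulr1; nra.
Qed.

Lemma expRN_le_inv1D (a : R) : 0 <= a -> expR (- a) <= (1 + a)^-1.
Proof.
by move=> a0; rewrite expRN lef_pV2 ?posrE ?expR_gt0 ?expR_ge1Dx//; lra.
Qed.

Lemma sin_sqr_bounds (u : R) : `|u| <= 1 -> u ^+ 2 * (1 - u ^+ 2) <= sin u ^+ 2 <= u ^+ 2.
Proof.
wlog u0 : u / 0 <= u.
  move=> H u1; have [/H->//|/ltW u0] := leP 0 u.
  by have := H (- u); rewrite oppr_ge0 normrN sinN !sqrrN; exact.
rewrite ger0_norm// => u1.
have upi : u <= pi by have := pihalf_ge1 R; lra.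
have s1 := sin_le u0; have s0 : 0 <= sin u by rewrite sin_ge0_pi// u0.
have s2 := mul_cos_le_sin (introT andP (conj u0 upi)).
have c0 : 0 <= cos u.
  by apply: cos_ge0_pihalf; have := pihalf_ge1 R; lra.
have s3 : sin u ^+ 2 <= u ^+ 2 by rewrite lerXn2r ?nnegrE.
rewrite s3 andbT; apply: (@le_trans _ _ ((u * cos u) ^+ 2)).
  rewrite exprMn ler_wpM2l ?sqr_ge0// cos2sin2; lra.
by rewrite lerXn2r ?nnegrE// mulr_ge0.
Qed.

(** At [theta = t^(3/2) y], [dev] is [y^2 t sq_csch (j t)] up to the loss in
    [u^2 (1 - u^2) <= sin^2 u <= u^2], [u = j theta / 2]. The factor [1 - t y^2] comes from
    [e^(-a) <= 1 / (1 + a) <= e^(- (a - a^2))] with [a <= t y^2]. *)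
Lemma damping_bounds t y m : 0 < t -> (0 < m)%N -> t * y ^+ 2 <= 1 ->
  (m%:R * t) ^+ 2 * (t * y ^+ 2) <= 4 ->
  let D := y ^+ 2 * (t * \sum_(1 <= j < m.+1) sq_csch (j%:R * t)) in
  expR (- D) <= damping t (t * Num.sqrt t * y) m <=
  expR (- ((1 - t * y ^+ 2) * (1 - (m%:R * t) ^+ 2 * (t * y ^+ 2) / 4) * D)).
Proof.
rewrite /=; move=> t0 m0 h1 h2; set D := y ^+ 2 * _; set th := t * Num.sqrt t * y.
have th2 : th ^+ 2 = t ^+ 2 * (t * y ^+ 2).
  by rewrite /th !exprMn sqr_sqrtr ?(ltW t0)//; ring.
pose d j := y ^+ 2 * (t * sq_csch (j%:R * t)).
set A := (1 - t * y ^+ 2) * (1 - (m%:R * t) ^+ 2 * (t * y ^+ 2) / 4).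
have DE : D = \sum_(1 <= j < m.+1) d j by rewrite /D /d !mulr_sumr.
have A1 : 0 <= 1 - t * y ^+ 2 by lra.
have A2 : 0 <= 1 - (m%:R * t) ^+ 2 * (t * y ^+ 2) / 4 by lra.
have key j : (0 < j <= m)%N -> [/\ 0 <= d j, dev t th j <= d j &
    A * d j <= dev t th j - dev t th j ^+ 2].
  move=> /andP[j0 jm]; have j1 : 0 < j%:R :> R by rewrite ltr0n.
  have s0 : 0 < j%:R * t by rewrite mulr_gt0.
  have S0 := sh_gt0 s0.
  have dE : d j = (j%:R * th) ^+ 2 / sh (j%:R * t) ^+ 2.
    by rewrite /d /sq_csch (exprMn _ _ th) th2 expr_div_n; field; rewrite gt_eqF.
  have d0 : 0 <= d j by rewrite dE divr_ge0 ?sqr_ge0.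
  have d1 : d j <= t * y ^+ 2.
    rewrite /d mulrCA ler_wpM2l ?(ltW t0)// ler_piMr ?sqr_ge0//.
    exact: sq_csch_le1.
  have u2 : (j%:R * th / 2) ^+ 2 = (j%:R * t) ^+ 2 * (t * y ^+ 2) / 4.
    have -> : (j%:R * th / 2) ^+ 2 = j%:R ^+ 2 * th ^+ 2 / 4 by field.
    by rewrite th2; ring.
  have ty0 : 0 <= t * y ^+ 2 by rewrite mulr_ge0 ?sqr_ge0// ltW.
  have jmt : (j%:R * t) ^+ 2 * (t * y ^+ 2) <= (m%:R * t) ^+ 2 * (t * y ^+ 2).
    rewrite ler_wpM2r// lerXn2r ?nnegrE ?mulr_ge0 ?(ltW t0)//.
    by rewrite ler_wpM2r ?(ltW t0)// ler_nat.
  have u1 : `|j%:R * th / 2| <= 1.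
    by rewrite -(@ler_pXn2r _ 2)// ?nnegrE// real_normK ?num_real// u2 expr1n; lra.
  have /andP[b1 b2] := sin_sqr_bounds u1.
  have devd : dev t th j <= d j.
    rewrite /dev dE ler_pM2r ?invr_gt0 ?exprn_gt0//.
    have -> : (j%:R * th) ^+ 2 = 4 * (j%:R * th / 2) ^+ 2 by field.
    by rewrite ler_pM2l.
  split => //.
  have dev0 := dev_ge0 t th j.
  apply: (@le_trans _ _ ((1 - t * y ^+ 2) * dev t th j)); last first.
    rewrite expr2 -[X in _ <= X - _]mul1r -mulrBl ler_wpM2r//; lra.
  rewrite /A -mulrA ler_wpM2l//.
  rewrite /dev dE (mulrA (1 - _)) ler_pM2r ?invr_gt0 ?exprn_gt0//.
  have -> : (j%:R * th) ^+ 2 = 4 * (j%:R * th / 2) ^+ 2 by field.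
  rewrite mulrCA ler_pM2l// mulrC; apply: le_trans b1.
  by rewrite ler_wpM2l ?sqr_ge0// u2; lra.
have inv0 j : 0 <= (1 + dev t th j)^-1 by rewrite invr_ge0 addr_ge0// dev_ge0.
rewrite DE mulr_sumr !expR_sumN; apply/andP; split; apply: prod_le => j /key[d0 dd Ad].
  rewrite expR_ge0/=; apply: le_trans (expRN_le_inv1D (dev_ge0 t th j)).
  by rewrite ler_expR lerN2.
rewrite inv0/=; apply: le_trans (inv1D_le_expR (dev_ge0 t th j)) _.
by rewrite ler_expR lerN2.
Qed.

Lemma normr_sin_le (x : R) : 0 <= x -> `|sin x| <= x.
Proof.
move=> x0; have [xpi|xpi] := leP x pi.
  by rewrite ger0_norm ?sin_le// sin_ge0_pi// x0.
have p1 := pihalf_ge1 R.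
by have s1 : `|sin x| <= 1; [rewrite ler_norml sin_geN1 sin_le1 | lra].
Qed.

(** The derivative of [ang s] at [u] lies below its value [ch s / sh s] at 0 by at most
    [ch s / sh s^3] times [4 sin^2 (u / 2) <= w^2]. The mean value theorem supplies the third factor
    [w]. *)
Lemma ang_le (s w : R) : 0 < s -> `|ang s w - w * (ch s / sh s)| <= `|w| ^+ 3 * (ch s / sh s ^+ 3).
Proof.
move=> s0; have S0 := sh_gt0 s0; have C0 := ch_gt0 s.
wlog w0 : w / 0 <= w.
  move=> H; have [/H//|/ltW w0] := leP 0 w.
  have := H (- w); rewrite oppr_ge0 normrN => /(_ w0).
  have -> : ang s (- w) = - ang s w.
    by rewrite /ang cosN sinN mulrN mulNr atanN; ring.
  by rewrite mulNr -opprB opprK addrC opprB -opprB normrN.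
rewrite (ger0_norm w0).
pose k := ch s / sh s; pose c := ch s / sh s ^+ 3.
have c0 : 0 <= c by rewrite divr_ge0 ?exprn_ge0 ?(ltW S0) ?(ltW C0).
have df u : has_derive (fun u => ang s u - u * k) u (sh s * ch s / fden s u - k).
  by have dA := derive_ang u s0; derive; ring.
have dB u : 0 <= u <= w -> - (c * w ^+ 2) <= sh s * ch s / fden s u - k <= 0.
  move=> /andP[u0 uw]; have F0 := fden_gt0 u s0.
  have -> : sh s * ch s / fden s u - k = - (c * (4 * sin (u / 2) ^+ 2) * (sh s ^+ 2 / fden s u)).
    rewrite /k /c; have -> : 4 * sin (u / 2) ^+ 2 = fden s u - sh s ^+ 2.
      by rewrite /fden; ring.
    by field; rewrite !gt_eqF.
  have q0 : 0 <= 4 * sin (u / 2) ^+ 2 by rewrite mulr_ge0 ?sqr_ge0.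
  have q1 : 4 * sin (u / 2) ^+ 2 <= w ^+ 2.
    have u20 : 0 <= u / 2 by lra.
    apply: (@le_trans _ _ (u ^+ 2)); last by rewrite lerXn2r ?nnegrE.
    have -> : u ^+ 2 = 4 * (u / 2) ^+ 2 by field.
    rewrite ler_pM2l// -[sin _ ^+ 2]real_normK ?num_real// lerXn2r ?nnegrE//.
    exact: normr_sin_le.
  have r0 : 0 <= sh s ^+ 2 / fden s u by rewrite divr_ge0 ?sqr_ge0// ltW.
  have r1 : sh s ^+ 2 / fden s u <= 1.
    by rewrite ler_pdivrMr// mul1r lerDl mulr_ge0 ?sqr_ge0.
  rewrite lerN2 oppr_le0 (mulr_ge0 (mulr_ge0 c0 q0) r0) andbT.
  rewrite -[leRHS]mulr1; apply: ler_pM => //; first by rewrite mulr_ge0.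
  by rewrite ler_wpM2l.
have a0 : ang s 0 = 0 by rewrite /ang sin0 mulr0 mul0r atan0 mulr0 addr0.
move: w0; rewrite le_eqVlt => /predU1P[<-|w0].
  by rewrite a0 !mul0r subrr normr0 expr0n /= mul0r.
have [|x /andP[x0 xw] E] := mean_value w0 (f := fun u => ang s u - u * k)
  (df := fun u => sh s * ch s / fden s u - k); first by move=> x _; exact: df.
have xI : 0 <= x <= w by rewrite !ltW.
move: E; rewrite a0 mul0r !subr0 => ->.
have /andP[b1 b2] := dB x xI.
rewrite normrM (ger0_norm (ltW w0)) (_ : w ^+ 3 * _ = c * w ^+ 2 * w); last by rewrite /c; ring.
by rewrite ler_wpM2r ?(ltW w0)// ler0_norm// lerNl.
Qed.

End Products.

(** * Sums of [ln sh] between two indices *)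

Section MonotoneSums.
Context {R : realType}.
Implicit Types (F f : R -> R) (t s u : R) (m a b j : nat).

Lemma sum_nondecreasing F f t a k :
  (forall s, 0 < s -> has_derive F s (f s)) ->
  (forall s u, 0 < s -> s <= u -> f s <= f u) -> 0 < t -> (0 < a)%N ->
  0 <= t * \sum_(a <= j < a + k) f (j.+1%:R * t) -
       (F ((a + k)%:R * t) - F (a%:R * t)) <=
    t * (f ((a + k)%:R * t) - f (a%:R * t)).
Proof.
move=> dF nd t0 a0; elim: k => [|k IH].
  by rewrite addn0 big_geq// !subrr mulr0 subr0 lexx.
have p0 : 0 < (a + k)%:R * t by rewrite mulr_gt0// ltr0n addn_gt0 a0.
rewrite addnS big_nat_recr ?leq_addr//= mulrDr.
have E : (a + k).+1%:R * t = (a + k)%:R * t + t by rewrite -natr1 mulrDl mul1r.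
have lt : (a + k)%:R * t < (a + k).+1%:R * t by rewrite E ltrDl.
have [|c /andP[c1 c2] Ec] := mean_value lt (f := F) (df := f).
  by move=> s /andP[s0 _]; apply: dF; exact: lt_le_trans s0.
have f1 : f ((a + k)%:R * t) <= f c by apply: nd => //; exact: ltW.
have f2 : f c <= f ((a + k).+1%:R * t) by apply: nd; [exact: lt_trans c1|exact: ltW].
have E2 : F ((a + k).+1%:R * t) = F ((a + k)%:R * t) + f c * t.
  by have -> : f c * t = f c * ((a + k).+1%:R * t - (a + k)%:R * t); [rewrite E; ring | lra].
have g1 : t * f ((a + k)%:R * t) <= f c * t by rewrite mulrC ler_pM2r.
have g2 : f c * t <= t * f ((a + k).+1%:R * t) by rewrite mulrC ler_pM2l.
by rewrite E2; lra.
Qed.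

Lemma ln_sh_le s u : 0 < s -> s <= u -> ln (sh s) <= ln (sh u).
Proof.
move=> s0 su; rewrite ler_ln ?posrE ?sh_gt0//; last exact: lt_le_trans su.
apply: (derive_ge0_le su (f := @sh R) (df := fun s => ch s / 2)) => x _.
  exact: derive_sh.
by rewrite divr_ge0// ltW// ch_gt0.
Qed.

Lemma ch_le s u : 0 <= s -> s <= u -> ch s <= ch u.
Proof.
move=> s0 su; apply: (derive_ge0_le su (f := @ch R) (df := fun s => sh s / 2)) => x /andP[sx _].
  exact: derive_ch.
by rewrite divr_ge0//; have := sh_ge (le_trans s0 sx); lra.
Qed.

Definition sum_ln_sh t m : R := \sum_(1 <= j < m.+1) ln (sh (j%:R * t)).

(** For a monotone function the error is at most the mesh times the variation. One endpoint is [vv],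
    where [ln sh] vanishes, so only the value at the other endpoint remains. *)
Lemma sum_ln_sh_step t m a : 0 < t -> (0 < m)%N -> (0 < a)%N -> a%:R * t = vv ->
  `|t * (sum_ln_sh t m - sum_ln_sh t a) - (Lam (m%:R * t) - Lam vv)| <=
    t * `|ln (sh (m%:R * t))|.
Proof.
move=> t0 m0 a0 at_; have l0 : ln (sh vv) = 0 :> R by rewrite sh_vv ln1.
have sumE p k : (0 < p)%N -> t * \sum_(p <= j < p + k) ln (sh (j.+1%:R * t)) =
    t * (sum_ln_sh t (p + k) - sum_ln_sh t p).
  move=> p0; elim: k => [|k IH]; first by rewrite addn0 big_geq// subrr.
  rewrite addnS big_nat_recr ?leq_addr//= mulrDr IH /sum_ln_sh.
  rewrite [in RHS](@big_nat_recr _ _ _ (p + k).+1 1)//=; ring.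
have [am|/ltnW ma] := leqP a m.
  have := sum_nondecreasing (m - a) (@derive_Lam R) ln_sh_le t0 a0.
  rewrite sumE// subnKC// at_ l0 subr0 => /andP[h1 h2].
  rewrite ger0_norm//; apply: le_trans h2 _.
  by rewrite ler_pM2l// ler_norm.
have := sum_nondecreasing (a - m) (@derive_Lam R) ln_sh_le t0 m0.
rewrite sumE// subnKC// at_ l0 sub0r => /andP[h1 h2].
rewrite ler0_norm; last by lra.
have : t * - ln (sh (m%:R * t)) <= t * `|ln (sh (m%:R * t))|.
  by rewrite ler_pM2l// -normrN ler_norm.
by move: h2; lra.
Qed.

End MonotoneSums.

(** * Limits on the Gaussian scale *)

Section LocalLimits.
Context {R : realType}.
Variables (t : nat -> R) (M m : nat -> nat) (x : R).
Hypotheses (t_gt0 : forall n, 0 < t n) (M_gt0 : forall n, (0 < M n)%N)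
  (m_gt0 : forall n, (0 < m n)%N) (Mt : forall n, (M n)%:R * t n = vv)
  (cvg_t : t n @[n --> \oo] --> (0 : R))
  (cvg_m : ((m n)%:R - (M n)%:R) * Num.sqrt (t n) @[n --> \oo] --> x).

Lemma cvg_sqrt_t : Num.sqrt (t n) @[n --> \oo] --> (0 : R).
Proof. by rewrite -[X in _ --> X](@sqrtr0 R); apply: cvg_fun cvg_t; exact: sqrt_continuous. Qed.

Lemma mulr_m_t n : (m n)%:R * t n =
  vv + ((m n)%:R - (M n)%:R) * Num.sqrt (t n) * Num.sqrt (t n).
Proof. by rewrite -mulrA -expr2 sqr_sqrtr ?(ltW (t_gt0 n))// -(Mt n); ring. Qed.

Lemma cvg_m_t : (m n)%:R * t n @[n --> \oo] --> (vv : R).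
Proof.
under eq_fun do rewrite mulr_m_t.
apply: (@cvg_eq _ _ _ _ (vv + x * 0)); last by rewrite mulr0 addr0.
apply: cvgD; first exact: cvg_cst.
by apply: cvgM; [exact: cvg_m|exact: cvg_sqrt_t].
Qed.

Lemma mt_gt0 n : 0 < (m n)%:R * t n.
Proof. by rewrite mulr_gt0 ?ltr0n. Qed.

(** Minus half the logarithm of the ratio is [(Lam (m t) - Lam vv) / t + o(1)]. The function [Lam]
    is critical at [vv] with second derivative [ch vv / (2 sh vv) = sqrt 5 / 2], and
    [(m t - vv)^2 / t] tends to [x^2]. *)
Lemma cvg_amp_ratio :
  amp (t n) (m n) 0 / amp (t n) (M n) 0 @[n --> \oo] --> gauss (Num.sqrt 5 / 2) x.
Proof.
pose g (s : R) := ch s / (2 * sh s).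
have dln (s : R) : 0 < s -> has_derive (fun s => ln (sh s)) s (g s).
  move=> s0; have S0 := sh_gt0 s0; have dS := derive_sh s.
  by derive => //; rewrite /g; field; rewrite gt_eqF.
have dg (s : R) : 0 < s -> has_derive g s (- sh s ^- 2).
  move=> s0; have S0 := sh_gt0 s0; have dS := derive_sh s; have dC := derive_ch s.
  rewrite /g; derive; first by rewrite mulf_neq0// gt_eqF.
  have := ch2 s; move: (sh s) S0 (ch s) => S S0 C CE.
  have -> : - S ^- 2 = (S ^+ 2 - C ^+ 2) / (4 * S ^+ 2) by rewrite CE; field; rewrite gt_eqF.
  by field; rewrite gt_eqF.
have g_le (s u : R) : 0 < s -> s <= u -> g u <= g s.
  move=> s0 su; rewrite -lerN2.
  apply: (derive_ge0_le su (f := fun s => - g s) (df := fun s => - - sh s ^- 2)) => z /andP[sz _].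
    by apply: derive_opp; apply: dg; exact: lt_le_trans sz.
  by rewrite opprK invr_ge0 sqr_ge0.
have gv : g vv = Num.sqrt 5 / 2 by rewrite /g sh_vv ch_vv mulr1.
have lv : ln (sh vv) = 0 :> R by rewrite sh_vv ln1.
pose D n := sum_ln_sh (t n) (m n) - sum_ln_sh (t n) (M n).
pose d n : R := ((m n)%:R - (M n)%:R) * Num.sqrt (t n).
have dE n : ((m n)%:R * t n - vv) ^+ 2 = t n * d n ^+ 2.
  rewrite mulr_m_t addrC addrA addNr add0r exprMn sqr_sqrtr ?(ltW (t_gt0 n))//.
  by rewrite mulrC.
have bound n : `|D n - g vv * d n ^+ 2 / 2| <=
    `|ln (sh ((m n)%:R * t n))| + `|g ((m n)%:R * t n) - g vv| * d n ^+ 2 / 2.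
  have h1 := sum_ln_sh_step (t_gt0 n) (m_gt0 n) (M_gt0 n) (Mt n).
  have h2 := taylor2_monotone vv_gt0 (mt_gt0 n) lv (@derive_Lam R) dln g_le.
  rewrite -/(D n) dE in h1 h2; have t0 := t_gt0 n.
  rewrite -(ler_pM2l t0) -[X in X * `| _ |](gtr0_norm t0) -normrM.
  set L := Lam _ in h1 h2; set E := ln (sh ((m n)%:R * t n)) in h1 *.
  have -> : t n * (D n - g vv * d n ^+ 2 / 2) = (t n * D n - (L - Lam vv)) +
    (L - Lam vv - g vv * (t n * d n ^+ 2) / 2) by ring.
  apply: le_trans (ler_normD _ _) _; rewrite [leRHS]mulrDr; apply: lerD => //.
  by apply: le_trans h2 _; rewrite le_eqVlt; apply/orP; left; apply/eqP; ring.
have cE : `|ln (sh ((m n)%:R * t n))| + `|g ((m n)%:R * t n) - g vv| * d n ^+ 2 / 2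
    @[n --> \oo] --> (0 : R).
  apply: (@cvg_eq _ _ _ _ (`|ln (sh vv)| + `|g vv - g vv| * x ^+ 2 / 2)); last first.
    by rewrite lv normr0 subrr normr0 !mul0r addr0.
  apply: cvgD.
    apply: cvg_norm; apply: (@cvg_fun _ _ _ _ _ (fun s => ln (sh s))) cvg_m_t.
    exact: derive_continuous (dln _ vv_gt0).
  apply: cvgM; last exact: cvg_cst.
  apply: cvgM; last by rewrite expr2; apply: cvgM; exact: cvg_m.
  apply: cvg_norm; apply: cvgB; last exact: cvg_cst.
  apply: (@cvg_fun _ _ _ _ _ g) cvg_m_t; exact: derive_continuous (dg _ vv_gt0).
have c0 : D n - g vv * d n ^+ 2 / 2 @[n --> \oo] --> (0 : R).
  apply: norm_cvg0; apply: (@squeeze_cvgr _ _ _ _ (cst 0)) cE; last exact: cvg_cst.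
  by apply: nearW => n /=; rewrite normr_ge0 bound.
have cD : D n @[n --> \oo] --> g vv * x ^+ 2 / 2.
  have -> : D = fun n => (D n - g vv * d n ^+ 2 / 2) + g vv * d n ^+ 2 / 2.
    by apply/funext => n; rewrite subrK.
  apply: (@cvg_eq _ _ _ _ (0 + g vv * x ^+ 2 / 2)); last by rewrite add0r.
  apply: cvgD => //; apply: cvgM; last exact: cvg_cst.
  apply: cvgM; first exact: cvg_cst.
  by rewrite expr2; apply: cvgM; exact: cvg_m.
have -> : (fun n => amp (t n) (m n) 0 / amp (t n) (M n) 0) = fun n => expR (- (2 * D n)).
  apply/funext => n; rewrite !amp0E// -expRN -expRD -!/(sum_ln_sh _ _) /D.
  by congr expR; ring.
rewrite /gauss; apply: (@cvg_eq _ _ _ _ (expR (- (2 * (g vv * x ^+ 2 / 2))))).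
  apply: (@cvg_fun _ _ _ _ _ expR); first exact: continuous_expR.
  by apply: cvgN; apply: cvgM => //; exact: cvg_cst.
by rewrite gv; congr expR; field.
Qed.

Variable y : R.

Lemma cvg_damping :
  damping (t n) (t n * Num.sqrt (t n) * y) (m n) @[n --> \oo] --> gauss sigma2 y.
Proof.
pose I n := t n * \sum_(1 <= j < (m n).+1) sq_csch (j%:R * t n).
pose A n := (1 - t n * y ^+ 2) * (1 - ((m n)%:R * t n) ^+ 2 * (t n * y ^+ 2) / 4).
have cty : t n * y ^+ 2 @[n --> \oo] --> (0 : R).
  apply: (@cvg_eq _ _ _ _ (0 * y ^+ 2)); last by rewrite mul0r.
  by apply: cvgM => //; exact: cvg_cst.
have cmty : ((m n)%:R * t n) ^+ 2 * (t n * y ^+ 2) @[n --> \oo] --> (0 : R).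
  apply: (@cvg_eq _ _ _ _ (vv ^+ 2 * 0)); last by rewrite mulr0.
  by apply: cvgM => //; rewrite expr2; apply: cvgM; exact: cvg_m_t.
have cI : I n @[n --> \oo] --> (sigma2 : R).
  have B n : int_sq_csch ((m n)%:R * t n) + 2 * Lam 0 - t n <= I n <=
      int_sq_csch ((m n)%:R * t n) + 2 * Lam 0.
    have := riemann_nonincreasing derive_int_sq_csch cvg_int_sq_csch_right0
      (@sq_csch_le R) (@sq_csch_le1 R) (t_gt0 n) (m_gt0 n).
    rewrite -/(I n) => /andP[h1 h2].
    have : t n * (1 - sq_csch ((m n)%:R * t n)) <= t n.
      by rewrite ler_piMr ?(ltW (t_gt0 n))// gerBl sqr_ge0.
    by move: h1 h2; lra.
  have c1 : int_sq_csch ((m n)%:R * t n) + 2 * Lam 0 @[n --> \oo] --> (sigma2 : R).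
    rewrite -int_sq_csch_vv; apply: cvgD; last exact: cvg_cst.
    apply: (@cvg_fun _ _ _ _ _ (@int_sq_csch R)) cvg_m_t.
    exact: derive_continuous (derive_int_sq_csch vv_gt0).
  apply: (squeeze_cvgr _ _ c1); first by apply: nearW => n; exact: B.
  apply: (@cvg_eq _ _ _ _ (sigma2 - 0)); last by rewrite subr0.
  exact: cvgB.
have cA : A n @[n --> \oo] --> (1 : R).
  apply: (@cvg_eq _ _ _ _ ((1 - 0) * (1 - 0 / 4))); last by rewrite mul0r !subr0 mulr1.
  apply: cvgM; apply: cvgB => //; try exact: cvg_cst.
  by apply: cvgM => //; exact: cvg_cst.
have cD : y ^+ 2 * I n @[n --> \oo] --> sigma2 * y ^+ 2.
  by rewrite mulrC; apply: cvgM => //; exact: cvg_cst.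
apply: (@squeeze_cvgr _ _ _ _ (fun n => expR (- (y ^+ 2 * I n)))
  (fun n => expR (- (A n * (y ^+ 2 * I n))))).
- have n1 : \forall n \near \oo, t n * y ^+ 2 <= 1.
    by apply: cvgr_le cty _ ltr01.
  have n2 : \forall n \near \oo, ((m n)%:R * t n) ^+ 2 * (t n * y ^+ 2) <= 4.
    by apply: cvgr_le cmty _ _.
  near=> n; apply: damping_bounds => //; [near: n; exact: n1|near: n; exact: n2].
- apply: (@cvg_fun _ _ _ _ _ expR); first exact: continuous_expR.
  by apply: cvgN.
- rewrite /gauss -[X in expR (- X)]mul1r.
  apply: (@cvg_fun _ _ _ _ _ expR); first exact: continuous_expR.
  by apply: cvgN; apply: cvgM.
Unshelve. all: by end_near. Qed.

Variable w : nat.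
Hypothesis cvg_n : (t n ^+ 2 * n%:R - pi ^+ 2 / 5) / Num.sqrt (t n) @[n --> \oo] --> (0 : R).

(** The cubic errors of the arguments are summed; [s / sh s <= 1] makes them uniform in [j]. *)
Lemma phase_linear (s th : R) k : 0 < s -> (0 < k)%N ->
  `|phase s k th - th / s ^+ 2 * (s * \sum_(1 <= j < k.+1) pcoth (j%:R * s))| <=
    `|th / s| ^+ 3 * (k%:R * ch (k%:R * s)).
Proof.
move=> s0 k0; rewrite /phase !mulr_sumr -sumrB.
apply: le_trans (ler_norm_sum _ _ _) _.
have -> : `|th / s| ^+ 3 * (k%:R * ch (k%:R * s)) =
    \sum_(1 <= j < k.+1) (`|th / s| ^+ 3 * ch (k%:R * s)).
  by rewrite sumr_const_nat subSS subn0 -[RHS]mulr_natl mulrCA.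
rewrite !big_seq; apply: ler_sum => j; rewrite mem_index_iota ltnS => /andP[j0 jk].
have j1 : 0 < j%:R :> R by rewrite ltr0n.
have js0 : 0 < j%:R * s by rewrite mulr_gt0.
have S0 := sh_gt0 js0.
have -> : th / s ^+ 2 * (s * pcoth (j%:R * s)) =
    j%:R * th * (ch (j%:R * s) / sh (j%:R * s)).
  by rewrite /pcoth; field; rewrite !gt_eqF.
apply: le_trans (ang_le _ js0) _.
have -> : `|j%:R * th| ^+ 3 * (ch (j%:R * s) / sh (j%:R * s) ^+ 3) =
    `|th / s| ^+ 3 * (ch (j%:R * s) * (j%:R * s / sh (j%:R * s)) ^+ 3).
  rewrite !normrM (gtr0_norm j1) normfV (gtr0_norm s0).
  by field; rewrite !gt_eqF.
rewrite ler_wpM2l ?exprn_ge0// -[leRHS]mulr1.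
have /andP[q0 q1] := s_sh_ge0 js0.
apply: ler_pM; rewrite ?exprn_ge0 ?exprn_ile1//; first by rewrite ltW// ch_gt0.
by apply: ch_le; [exact: ltW | rewrite ler_pM2r// ler_nat].
Qed.

(** The terms of order [t^(-1/2)] cancel because [t^2 n = pi^2 / 5 + o(sqrt t)]. What remains is the
    change of [int_pcoth] from [vv] to [m t], which gives [pcoth vv * x * y]. The shift by [w m]
    contributes [w m t^(3/2) y], which tends to 0. *)
Lemma cvg_phase : phase (t n) (m n) (t n * Num.sqrt (t n) * y) -
    (n%:Z - (w * m n)%:Z)%:~R * (t n * Num.sqrt (t n) * y)
  @[n --> \oo] --> Num.sqrt 5 * vv * x * y.
Proof.
pose r n := Num.sqrt (t n).
have r0 n : 0 < r n by rewrite sqrtr_gt0.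
have r2 n : r n ^+ 2 = t n by rewrite sqr_sqrtr// ltW.
pose I n := t n * \sum_(1 <= j < (m n).+1) pcoth (j%:R * t n).
pose d n : R := ((m n)%:R - (M n)%:R) * r n.
pose mt n := (m n)%:R * t n.
have mtE n : mt n - vv = d n * r n by rewrite /mt mulr_m_t addrC addrA addNr add0r.
have pv : pcoth vv = Num.sqrt 5 * vv :> R by rewrite /pcoth sh_vv ch_vv divr1 mulrC.
have cmt := cvg_m_t; have cr := cvg_sqrt_t.
have cpc : pcoth (mt n) @[n --> \oo] --> (pcoth vv : R).
  apply: (@cvg_fun _ _ _ _ _ (@pcoth R)) cmt; exact: derive_continuous (derive_pcoth vv_gt0).
have cch : ch (mt n) @[n --> \oo] --> (ch vv : R).
  apply: (@cvg_fun _ _ _ _ _ (@ch R)) cmt; exact: derive_continuous (derive_ch vv).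
have dI n : `|I n - (int_pcoth (mt n) + 2 * Lam 0)| <= t n * pcoth (mt n).
  have dN (s : R) : 0 < s -> has_derive (fun s => - int_pcoth s) s (- pcoth s).
    by move=> s0; apply: derive_opp; exact: derive_int_pcoth.
  have cN : - int_pcoth s @[s --> (0 : R)^'+] --> - - (2 * Lam 0) by apply: cvgN; exact: cvg_int_pcoth_right0.
  have := riemann_nonincreasing (q := fun s => - pcoth s) dN cN _ _ (t_gt0 n) (m_gt0 n) (K := 0).
  have nd (s u : R) : 0 < s -> s <= u -> - pcoth u <= - pcoth s.
    by move=> s0 su; rewrite lerN2 pcoth_le.
  have K0 (s : R) : 0 < s -> - pcoth s <= 0 by move=> s0; rewrite oppr_le0 pcoth_ge0.
  move=> /(_ nd K0); rewrite sumrN mulrN -/(I n) -/(mt n) !opprK add0r => /andP[h1 h2].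
  by rewrite ger0_norm; lra.
have dP n : `|int_pcoth (mt n) - int_pcoth vv - pcoth vv * (d n * r n)| <=
    `|pcoth (mt n) - pcoth vv| * `|d n * r n|.
  rewrite -mtE; apply: taylor1_monotone => //; [exact: vv_gt0|exact: mt_gt0| |exact: pcoth_le].
  exact: derive_int_pcoth.
have dF n : `|phase (t n) (m n) (t n * r n * y) - r n * y / t n * I n| <=
    `|y| ^+ 3 * r n * (mt n * ch (mt n)).
  have := @phase_linear (t n) (t n * r n * y) (m n) (t_gt0 n) (m_gt0 n).
  rewrite -/(I n).
  have -> : t n * r n * y / t n ^+ 2 = r n * y / t n by field; rewrite gt_eqF.
  have -> : t n * r n * y / t n = r n * y by field; rewrite gt_eqF.
  move=> /le_trans; apply; rewrite normrM (gtr0_norm (r0 n)) /mt -(r2 n).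
  by rewrite le_eqVlt; apply/orP; left; apply/eqP; ring.
(* The four errors: nonlinearity of the arguments, Riemann sum, Taylor remainder at [vv], and
   distance of [t^2 n] from [pi^2 / 5]. *)
pose e1 n := phase (t n) (m n) (t n * r n * y) - r n * y / t n * I n.
pose e2 n := (I n - (int_pcoth (mt n) + 2 * Lam 0)) / r n.
pose e3 n := (int_pcoth (mt n) - int_pcoth vv - pcoth vv * (d n * r n)) / r n.
pose e4 n := (t n ^+ 2 * n%:R - pi ^+ 2 / 5) / r n.
have E n : phase (t n) (m n) (t n * r n * y) -
    (n%:Z - (w * m n)%:Z)%:~R * (t n * r n * y) =
    e1 n + y * (e2 n + e3 n + pcoth vv * d n - e4 n + w%:R * (mt n * r n)).
  rewrite /e1 /e2 /e3 /e4 -int_pcoth_vv intrB -!pmulrn natrM /mt -(r2 n).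
  by move: (Lam 0) => L; field; rewrite gt_eqF.
have c1 : e1 n @[n --> \oo] --> (0 : R).
  apply: norm_cvg0; apply: (@squeeze_cvgr _ _ _ _ (cst 0) (fun n => `|y| ^+ 3 * r n * (mt n * ch (mt n)))).
  - by apply: nearW => n /=; rewrite normr_ge0 dF.
  - exact: cvg_cst.
  - apply: (@cvg_eq _ _ _ _ (`|y| ^+ 3 * 0 * (vv * ch vv))); last by rewrite mulr0 mul0r.
    apply: cvgM; last exact: cvgM.
    by apply: cvgM => //; exact: cvg_cst.
have c2 : e2 n @[n --> \oo] --> (0 : R).
  apply: norm_cvg0; apply: (@squeeze_cvgr _ _ _ _ (cst 0) (fun n => r n * pcoth (mt n))).
  - apply: nearW => n /=; rewrite normr_ge0 normrM normfV (gtr0_norm (r0 n)).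
    rewrite ler_pdivrMr//=; apply: le_trans (dI n) _.
    have -> : r n * pcoth (mt n) * r n = r n ^+ 2 * pcoth (mt n) by ring.
    by rewrite r2.
  - exact: cvg_cst.
  - apply: (@cvg_eq _ _ _ _ (0 * pcoth vv)); last by rewrite mul0r.
    exact: cvgM.
have c3 : e3 n @[n --> \oo] --> (0 : R).
  apply: norm_cvg0; apply: (@squeeze_cvgr _ _ _ _ (cst 0) (fun n => `|pcoth (mt n) - pcoth vv| * `|d n|)).
  - apply: nearW => n /=; rewrite normr_ge0 normrM normfV (gtr0_norm (r0 n)).
    rewrite ler_pdivrMr//=; apply: le_trans (dP n) _.
    by rewrite normrM (gtr0_norm (r0 n)) mulrA.
  - exact: cvg_cst.
  - apply: (@cvg_eq _ _ _ _ (`|pcoth vv - pcoth vv| * `|x|)); last by rewrite subrr normr0 mul0r.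
    apply: cvgM; last by apply: cvg_norm; exact: cvg_m.
    by apply: cvg_norm; apply: cvgB => //; exact: cvg_cst.
under eq_fun do rewrite E.
apply: (@cvg_eq _ _ _ _ (0 + y * (0 + 0 + pcoth vv * x - 0 + w%:R * (vv * 0)))); last first.
  by rewrite pv; ring.
apply: cvgD => //; apply: cvgM; first exact: cvg_cst.
apply: cvgD; last by apply: cvgM; [exact: cvg_cst|exact: cvgM].
apply: cvgB => //; apply: cvgD; first exact: cvgD.
by apply: cvgM; [exact: cvg_cst|exact: cvg_m].
Qed.

End LocalLimits.

(** * Domination of the modulus over the whole circle *)

Section DampingDomination.
Context {R : realType}.
Implicit Types (t theta y u : R) (m j M : nat).

Lemma jordan_sin u : 0 <= u <= pi / 2 -> 2 * u / pi <= sin u.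
Proof.
have p0 := pi_gt0 R; rewrite le_eqVlt => /andP[/predU1P[<- _|u0 up]].
  by rewrite mulr0 mul0r sin0.
have := derive_ge0_le up (f := fun s => - (sin s / s))
  (df := fun s => (sin s - s * cos s) / s ^+ 2).
have h1 (s : R) : u <= s <= pi / 2 ->
    has_derive (fun s => - (sin s / s)) s ((sin s - s * cos s) / s ^+ 2).
  move=> /andP[us _]; have s0 : 0 < s by exact: lt_le_trans us.
  by derive; [rewrite gt_eqF | field; rewrite gt_eqF].
have h2 (s : R) : u <= s <= pi / 2 -> 0 <= (sin s - s * cos s) / s ^+ 2.
  move=> /andP[us sp]; apply: divr_ge0; last exact: sqr_ge0.
  by rewrite subr_ge0 mul_cos_le_sin//; lra.
move=> /(_ h1 h2); rewrite sin_pihalf lerN2 ler_pdivlMr// => H.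
apply: le_trans H; rewrite le_eqVlt; apply/orP; left; apply/eqP.
by move: (@pi R) p0 => p p0; field; rewrite gt_eqF.
Qed.

Lemma dirichlet_kernel theta m :
  2 * sin (theta / 2) * \sum_(1 <= j < m.+1) cos (j%:R * theta) =
  sin ((m%:R + 2^-1) * theta) - sin (theta / 2).
Proof.
elim: m => [|m IH].
  by rewrite big_geq// mulr0 add0r mulrC subrr.
rewrite (@big_nat_recr _ _ _ m.+1 1)//= mulrDr IH.
have -> : (m.+1%:R + 2^-1) * theta = m.+1%:R * theta + theta / 2 by rewrite mulrDl (mulrC 2^-1).
have -> : (m%:R + 2^-1) * theta = m.+1%:R * theta - theta / 2.
  by rewrite -natr1; field.
by rewrite sinB sinD; ring.
Qed.

(** Each term is [2 - 2 cos (j theta)], and by the Dirichlet kernel the cosines sum to at most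
    [1 / (2 sin (theta / 2)) <= m / 2], because [sin (theta / 2) >= theta / pi >= 1 / m]. *)
Lemma sum_sin_sqr_ge theta m : (0 < m)%N -> pi / m%:R <= theta <= pi ->
  m%:R <= \sum_(1 <= j < m.+1) (4 * sin (j%:R * theta / 2) ^+ 2).
Proof.
move=> m0 /andP[th1 th2]; have p0 := pi_gt0 R.
have m1 : 0 < m%:R :> R by rewrite ltr0n.
have th0 : 0 < theta by apply: lt_le_trans th1; rewrite divr_gt0.
have J : theta / pi <= sin (theta / 2).
  have -> : theta / pi = 2 * (theta / 2) / pi by congr (_ / _); field.
  by apply: jordan_sin; lra.
have s0 : 0 < sin (theta / 2) by apply: lt_le_trans J; rewrite divr_gt0.
have E : \sum_(1 <= j < m.+1) (4 * sin (j%:R * theta / 2) ^+ 2) =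
    2 * m%:R - 2 * \sum_(1 <= j < m.+1) cos (j%:R * theta).
  have -> : 2 * m%:R = \sum_(1 <= j < m.+1) (2 : R).
    by rewrite sumr_const_nat subSS subn0 mulr_natr.
  rewrite mulr_sumr -sumrB; apply: eq_bigr => j _.
  have {2}-> : j%:R * theta = (j%:R * theta / 2) *+ 2 by rewrite -mulr_natr; field.
  by rewrite cos_mulr2n cos2sin2; ring.
rewrite E; set C := \sum_(1 <= j < m.+1) _.
have : 2 * sin (theta / 2) * C <= 1.
  have := dirichlet_kernel theta m; rewrite -/C => ->.
  by have := sin_le1 ((m%:R + 2^-1) * theta); lra.
have h : 1 <= sin (theta / 2) * m%:R.
  rewrite -ler_pdivrMr// (le_trans _ J)// ler_pdivlMr// mulrC mul1r.
  by have -> : pi * m%:R^-1 = pi / m%:R by [].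
move=> hC; have : 2 * sin (theta / 2) * C <= sin (theta / 2) * m%:R by exact: le_trans h.
rewrite (mulrC 2) -mulrA ler_pM2l//; lra.
Qed.

Lemma sum_sqr_ge m : m%:R ^+ 3 / 3 <= \sum_(1 <= j < m.+1) (j%:R ^+ 2) :> R.
Proof.
elim: m => [|m IH]; first by rewrite big_geq// expr0n mul0r.
rewrite (@big_nat_recr _ _ _ m.+1 1)//=; apply: le_trans (lerD IH (lexx _)).
by rewrite -natr1; have : 0 <= m%:R :> R by []; move: (m%:R) => x x0; nra.
Qed.

Lemma prod1D_ge (F : nat -> R) m : (forall j, 0 <= F j) ->
  1 + \sum_(1 <= j < m.+1) F j <= \prod_(1 <= j < m.+1) (1 + F j).
Proof.
move=> F0; elim: m => [|m IH]; first by rewrite !big_geq// addr0.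
rewrite !(@big_nat_recr _ _ _ m.+1 1)//=; set S := \sum_(1 <= j < m.+1) _ in IH *.
have S0 : 0 <= S by apply: sumr_ge0.
apply: le_trans (ler_wpM2r _ IH); last by rewrite addr_ge0.
by have := F0 m.+1; move: (F m.+1) => f f0; nra.
Qed.

(** The 5 makes [(1 + f) (1 - f / 5) = 1 + f (4 - f) / 5] at least 1 on [[0, 4]]; combined with
    [1 - f / 5 <= e^(- f / 5)], this gives [e^(f / 5) <= 1 + f]. *)
Lemma prod1D_expR_ge (F : nat -> R) m : (forall j, 0 <= F j <= 4) ->
  expR ((\sum_(1 <= j < m.+1) F j) / 5) <= \prod_(1 <= j < m.+1) (1 + F j).
Proof.
move=> F4; elim: m => [|m IH]; first by rewrite !big_geq// mul0r expR0.
rewrite !(@big_nat_recr _ _ _ m.+1 1)//= mulrDl expRD.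
apply: ler_pM => //; try exact: expR_ge0.
have /andP[f0 f4] := F4 m.+1; move: (F m.+1) f0 f4 => f f0 f4.
have h : 0 < 1 - f / 5 by lra.
have := ler_wpM2r (expR_ge0 (f / 5)) (expR_ge1Dx (- (f / 5))).
rewrite -expRD addNr expR0 => e1.
rewrite -(ler_pM2l h); apply: le_trans e1 _; nra.
Qed.

Lemma devN t theta j : dev t (- theta) j = dev t theta j.
Proof. by rewrite /dev mulrN mulNr sinN sqrrN. Qed.

Lemma damping_normr t theta m : damping t `|theta| m = damping t theta m.
Proof.
rewrite /damping; apply: eq_bigr => j _; congr (_ ^-1); congr (1 + _).
by have [h|h] := leP 0 theta; [rewrite ger0_norm | rewrite ltr0_norm// devN].
Qed.

Lemma damping_ge0 t theta m : 0 <= damping t theta m.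
Proof. by apply: prodr_ge0 => j _; rewrite invr_ge0 addr_ge0// dev_ge0. Qed.

Lemma damping_nonincr t theta m k : (m <= k)%N -> damping t theta k <= damping t theta m.
Proof.
elim: k => [|k IH]; first by rewrite leqn0 => /eqP->.
rewrite leq_eqVlt => /predU1P[->//|]; rewrite ltnS => /IH; apply: le_trans.
rewrite [leLHS](@big_nat_recr _ _ _ k.+1 1)//= ler_piMr//; first exact: damping_ge0.
by rewrite invf_le1 ?ltr_wpDr ?dev_ge0// lerDl dev_ge0.
Qed.

Lemma damping_le1 t theta m : damping t theta m <= 1.
Proof. by apply: le_trans (damping_nonincr t theta (leq0n m)) _; rewrite /damping big_geq. Qed.

(** While [j t <= vv] one has [sh (j t) <= 1], so dropping the denominator of [dev] can only
    decrease it. *)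
Lemma damping_le_prod t theta m : 0 < t -> m%:R * t <= vv ->
  damping t theta m <= (\prod_(1 <= j < m.+1) (1 + 4 * sin (j%:R * theta / 2) ^+ 2))^-1.
Proof.
move=> t0 mt; rewrite -prodfV; apply: prod_le => j /andP[j0 jm].
have d0 := dev_ge0 t theta j.
have q0 : 0 <= 4 * sin (j%:R * theta / 2) ^+ 2 by rewrite mulr_ge0 ?sqr_ge0.
rewrite invr_ge0 addr_ge0//= lef_pV2 ?posrE ?ltr_wpDr// lerD2l.
have s0 : 0 < j%:R * t by rewrite mulr_gt0 ?ltr0n.
have S0 := sh_gt0 s0.
rewrite /dev ler_pdivlMr ?exprn_gt0// ler_piMr// exprn_ile1 ?(ltW S0)//.
apply: (@le_trans _ _ (sh vv)); last by rewrite sh_vv.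
apply: (derive_ge0_le _ (f := @sh R) (df := fun s => ch s / 2)).
- by apply: le_trans mt; rewrite ler_pM2r// ler_nat.
- by move=> *; exact: derive_sh.
- by move=> *; rewrite divr_ge0// ltW// ch_gt0.
Qed.

(** The first [m1] factors suffice. If [|theta| <= pi / m1], the sum of the [4 sin^2 (j theta / 2)]
    is at least [c1 y^2] by the Jordan inequality. Otherwise their product exceeds [e^(m1 / 5)],
    hence a multiple of [t^-3], and [|theta| <= pi] bounds [y^2] by [pi^2 t^-3]. *)
Lemma damping_dominated : exists2 K : R, 0 < K & forall t M m y, 0 < t -> (1 < M)%N ->
  M%:R * t = vv -> (M <= m.*2)%N -> `|t * Num.sqrt t * y| <= pi ->
  damping t (t * Num.sqrt t * y) m <= K * (1 + y ^+ 2)^-1.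
Proof.
have v0 := @vv_gt0 R; have p0 := pi_gt0 R.
(* With [m1 t >= vv / 3]: [c1 = 4 / (3 pi^2) * (vv / 3)^3] and [c2 = (vv / 3)^3 / (15^3 pi^2)]. *)
pose c1 : R := 4 * vv ^+ 3 / (81 * pi ^+ 2).
pose c2 : R := (vv / 45) ^+ 3 / pi ^+ 2.
have c10 : 0 < c1 by apply: divr_gt0; apply: mulr_gt0; rewrite ?exprn_gt0.
have c20 : 0 < c2 by rewrite /c2 divr_gt0 ?exprn_gt0 ?divr_gt0.
exists (1 + c1^-1 + c2^-1); first by rewrite !addr_gt0 ?invr_gt0.
move=> t M m y t0 M1 Mt Mm thpi; set th := t * Num.sqrt t * y.
have th2 : `|th| ^+ 2 = t ^+ 3 * y ^+ 2.
  rewrite real_normK ?num_real// /th !exprMn sqr_sqrtr ?(ltW t0)//; ring.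
(* This choice ensures [m1 <= m] and [m1 t <= vv], while [M <= 3 m1] keeps [m1 t] away from 0. *)
pose m1 := M./2; have m10 : (0 < m1)%N by rewrite half_gt0.
have m1M : (M <= 3 * m1)%N by rewrite /m1; lia.
have m1m : (m1 <= m)%N by rewrite /m1; lia.
have m1t : m1%:R * t <= vv by rewrite -Mt ler_pM2r// ler_nat /m1; lia.
have m1p : 0 < m1%:R :> R by rewrite ltr0n.
have m1v : vv / 3 <= m1%:R * t.
  have : M%:R * t <= (3 * m1)%:R * t by rewrite ler_pM2r// ler_nat.
  by rewrite Mt natrM; lra.
pose F j := 4 * sin (j%:R * `|th| / 2) ^+ 2.
have F4 j : 0 <= F j <= 4.
  rewrite /F; move: (j%:R * _ / 2) => u.
  by have := cos2Dsin2 u; have := sqr_ge0 (cos u); have := sqr_ge0 (sin u); lra.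
have F0 j : 0 <= F j by case/andP: (F4 j).
pose P := \prod_(1 <= j < m1.+1) (1 + F j).
have P1 : 1 <= P.
  by apply: le_trans (prod1D_ge m1 F0); rewrite lerDl sumr_ge0.
have P0 : 0 < P by exact: lt_le_trans P1.
have dampP : damping t th m <= P^-1.
  by apply: le_trans (damping_nonincr t th m1m) _; rewrite -damping_normr; exact: damping_le_prod.
apply: le_trans dampP _.
have y0 : 0 < 1 + y ^+ 2 by rewrite ltr_wpDr ?sqr_ge0.
rewrite ler_pdivlMr// mulrC ler_pdivrMr//.
have m1t3 : (vv / 3) ^+ 3 <= m1%:R ^+ 3 * t ^+ 3.
  by rewrite -exprMn; apply: lerXn2r => //; rewrite nnegrE; [lra | rewrite mulr_ge0 // ltW].
have i1 : 0 < c1^-1 by rewrite invr_gt0.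
have i2 : 0 < c2^-1 by rewrite invr_gt0.
have [small|large] := leP `|th| (pi / m1%:R).
  have : 1 + c1 * y ^+ 2 <= P.
    apply: le_trans (prod1D_ge m1 F0); rewrite lerD2l.
    apply: (@le_trans _ _ (\sum_(1 <= j < m1.+1) (4 * `|th| ^+ 2 / pi ^+ 2 * j%:R ^+ 2))).
      rewrite -mulr_sumr; apply: (@le_trans _ _ (4 * `|th| ^+ 2 / pi ^+ 2 * (m1%:R ^+ 3 / 3))); last first.
        rewrite ler_wpM2l ?sum_sqr_ge//.
        by apply: divr_ge0; rewrite ?sqr_ge0// mulr_ge0 ?sqr_ge0.
      rewrite th2; have -> : 4 * (t ^+ 3 * y ^+ 2) / pi ^+ 2 * (m1%:R ^+ 3 / 3) =
          (4 / (3 * pi ^+ 2)) * y ^+ 2 * (m1%:R ^+ 3 * t ^+ 3).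
        by move: (@pi R) p0 => p p0; field; rewrite gt_eqF.
      apply: le_trans (ler_wpM2l _ m1t3); last first.
        apply: mulr_ge0; last exact: sqr_ge0.
          by apply: divr_ge0 => //; rewrite mulr_ge0 ?sqr_ge0.
      rewrite /c1 le_eqVlt; apply/orP; left; apply/eqP.
      by move: (@vv R) (@pi R) p0 => v p p0; field; rewrite gt_eqF.
    rewrite !big_seq; apply: ler_sum => j; rewrite mem_index_iota ltnS => /andP[j0 jm].
    have u0 : 0 <= j%:R * `|th| / 2 by rewrite divr_ge0 ?mulr_ge0.
    have u1 : j%:R * `|th| / 2 <= pi / 2.
      rewrite ler_pM2r ?invr_gt0//; move: small; rewrite ler_pdivlMr// mulrC; apply: le_trans.
      by rewrite ler_wpM2r// ler_nat.
    have J := jordan_sin (introT andP (conj u0 u1)).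
    have -> : 4 * `|th| ^+ 2 / pi ^+ 2 * j%:R ^+ 2 = 4 * (2 * (j%:R * `|th| / 2) / pi) ^+ 2.
      by move: (@pi R) p0 => p p1; field; rewrite gt_eqF.
    rewrite ler_pM2l// lerXn2r ?nnegrE//.
      by rewrite divr_ge0 ?mulr_ge0 ?(ltW p0)// divr_ge0 ?mulr_ge0.
    by apply: le_trans J; rewrite divr_ge0 ?(ltW p0)// mulr_ge0.
  move=> H; have : c1^-1 + y ^+ 2 <= c1^-1 * P.
    by rewrite ler_pdivlMl// mulrDr mulfV ?gt_eqF.
  have : 0 <= c2^-1 * P by rewrite mulr_ge0 // ltW.
  by rewrite !mulrDl; lra.
have S := sum_sin_sqr_ge m10 (introT andP (conj (ltW large) thpi)).
have e : expR (m1%:R / 5) <= P.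
  by apply: le_trans (prod1D_expR_ge m1 F4); rewrite ler_expR ler_pM2r ?invr_gt0.
have e3 : (m1%:R / 15 : R) ^+ 3 <= expR (m1%:R / 5).
  have -> : (m1%:R / 5 : R) = 3%:R * (m1%:R / 15) by field.
  rewrite expRM_natl; apply: lerXn2r; rewrite ?nnegrE ?expR_ge0//.
  by apply: le_trans (expR_ge1Dx _); lra.
have y2 : c2 * y ^+ 2 <= (m1%:R / 15) ^+ 3.
  have t3 : 0 < t ^+ 3 by rewrite exprn_gt0.
  rewrite -(ler_pM2r t3) -mulrA (mulrC (y ^+ 2)) -th2.
  have q : `|th| ^+ 2 <= pi ^+ 2 by rewrite lerXn2r ?nnegrE// ltW.
  apply: le_trans (ler_wpM2l (ltW c20) q) _.
  have -> : (m1%:R / 15) ^+ 3 * t ^+ 3 = (m1%:R ^+ 3 * t ^+ 3) / 15 ^+ 3 by field.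
  rewrite ler_pdivlMr ?exprn_gt0//; apply: le_trans m1t3.
  rewrite /c2 le_eqVlt; apply/orP; left; apply/eqP.
  by move: (@vv R) (@pi R) p0 => v p p1; field; rewrite gt_eqF.
have : y ^+ 2 <= c2^-1 * P by rewrite ler_pdivlMl// (le_trans y2)// (le_trans e3).
have : 0 <= c1^-1 * P by rewrite mulr_ge0 // ltW.
by rewrite !mulrDl; lra.
Qed.

End DampingDomination.

(** * Gaussian majorant of the peak values *)

Section AmpDomination.
Context {R : realType}.
Implicit Types (t s x r : R) (m k M : nat).

(** With [a = e^(vv/2)], [b = e^(-vv/2)], [c = e^(s/2)], [d = e^(-s/2)]: since [a - b = 1],
    [a c - b d = c + b (c - d) >= c]. *)
Lemma sh_vvD_ge s : 0 <= s -> expR (s / 2) <= sh (vv + s).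
Proof.
move=> s0; have := @sh_vv R; rewrite /sh mulrDl opprD !expRD.
have e1 : expR (- (s / 2)) <= expR (s / 2) by rewrite ler_expR; lra.
have := expR_ge0 (- (vv / 2) : R); move: (expR (- (vv / 2))) (expR (vv / 2)) => b a b0 ab.
move: (expR (s / 2)) (expR (- (s / 2))) e1 => c d cd; nra.
Qed.

Lemma sh_vvB_le s : 0 <= s -> sh (vv - s) <= expR (- (s / 2)).
Proof.
move=> s0; have := @sh_vv R; rewrite /sh mulrBl opprB addrC expRD (addrC (s / 2)) expRD.
have e1 : expR (- (s / 2)) <= expR (s / 2) by rewrite ler_expR; lra.
have := expR_ge0 (- (vv / 2) : R).
move: (expR (- (vv / 2))) (expR (vv / 2)) => b a b0 ab.
move: (expR (s / 2)) (expR (- (s / 2))) e1 => c d cd; nra.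
Qed.

Lemma ampS0 t m : amp t m.+1 0 = amp t m 0 / sh (m.+1%:R * t) ^+ 2.
Proof. by rewrite ampS /fden mulr0 mul0r sin0 expr0n mulr0 addr0. Qed.

Lemma amp0_gt0 t m : 0 < t -> 0 < amp t m 0.
Proof. by move=> t0; rewrite amp0E// expR_gt0. Qed.

(** Upwards, the step from [M + k] to [M + k + 1] multiplies [amp] by [sh (vv + (k + 1) t)^-2 <=
    e^(- (k + 1) t)]; downwards, the step from [M - k] to [M - k - 1] multiplies it by
    [sh (vv - k t)^2 <= e^(- k t)]. The form [k (k + 1)], with signed [k], covers both
    directions. *)
Lemma amp_quadratic_le t M m : 0 < t -> M%:R * t = vv ->
  let k := m%:R - M%:R in amp t m 0 <= amp t M 0 * expR (- (t * (k * (k + 1)) / 2)).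
Proof.
move=> t0 Mt /=; have [Mm|/ltnW mM] := leqP M m.
  rewrite -(subnKC Mm); elim: (m - M)%N => [|k IH].
    by rewrite addn0 subrr !mul0r mulr0 mul0r oppr0 expR0 mulr1.
  rewrite addnS ampS0.
  have E : (M + k).+1%:R * t = vv + k.+1%:R * t by rewrite -Mt -addnS natrD mulrDl.
  have S := sh_vvD_ge (mulr_ge0 (ler0n R k.+1) (ltW t0)).
  have -> : amp t M 0 * expR (- (t * (((M + k).+1%:R - M%:R) *
      ((M + k).+1%:R - M%:R + 1)) / 2)) = amp t M 0 * expR (- (t * (((M + k)%:R - M%:R) *
      ((M + k)%:R - M%:R + 1)) / 2)) * expR (- (k.+1%:R * t / 2)) ^+ 2.
    rewrite -expRM_natl -[RHS]mulrA -expRD; congr (_ * expR _).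
    by rewrite -addnS !natrD -natr1; move: (k%:R) (M%:R) => x1 x2; field.
  apply: ler_pM => //.
  - by rewrite ltW// amp0_gt0.
  - by rewrite invr_ge0 sqr_ge0.
  rewrite expRN -exprVn; apply: lerXn2r; rewrite ?nnegrE ?invr_ge0 ?expR_ge0//.
    by rewrite E (le_trans _ S)// expR_ge0.
  by rewrite E lef_pV2 ?posrE ?expR_gt0// (lt_le_trans _ S)// expR_gt0.
have [k kE] : exists k, (m + k = M)%N by exists (M - m)%N; rewrite subnKC.
rewrite -{}kE in Mt *; clear mM.
elim: k m Mt => [|k IH] m Mt.
  by rewrite addn0 subrr !mul0r mulr0 mul0r oppr0 expR0 mulr1.
have Mt' : (m.+1 + k)%:R * t = vv by rewrite addSnnS.
have := IH m.+1 Mt'; rewrite addSnnS ampS0.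
have E : m.+1%:R * t = vv - k%:R * t by rewrite -Mt' natrD; ring.
have S := sh_vvB_le (mulr_ge0 (ler0n R k) (ltW t0)).
have S0 : 0 < sh (m.+1%:R * t) by rewrite sh_gt0// mulr_gt0.
rewrite ler_pdivrMr ?exprn_gt0// => /le_trans; apply.
have -> : amp t (m + k.+1) 0 * expR (- (t * ((m%:R - (m + k.+1)%:R) *
    (m%:R - (m + k.+1)%:R + 1)) / 2)) = amp t (m + k.+1) 0 * expR (- (t * ((m.+1%:R - (m + k.+1)%:R) *
    (m.+1%:R - (m + k.+1)%:R + 1)) / 2)) * expR (- (k%:R * t / 2)) ^+ 2.
  rewrite -expRM_natl -[RHS]mulrA -expRD; congr (_ * expR _).
  by rewrite !natrD -!natr1; move: (k%:R) (m%:R) => x1 x2; field.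
rewrite ler_wpM2l//; first by rewrite mulr_ge0 ?expR_ge0// ltW// amp0_gt0.
by apply: lerXn2r; rewrite ?nnegrE ?expR_ge0 ?(ltW S0)// E.
Qed.

(* If [k * r <= x < (k + 1) * r] then [r^2 k (k + 1) >= x^2 - r |x| - r^2 / 4]. *)
Lemma amp_gauss_le t M m x : 0 < t <= 1 -> M%:R * t = vv ->
  let k := m%:R - M%:R in k * Num.sqrt t <= x < (k + 1) * Num.sqrt t ->
  amp t m 0 / amp t M 0 <= expR 1 * gauss 4^-1 x.
Proof.
move=> /andP[t0 t1] Mt k /andP[x1 x2].
rewrite ler_pdivrMr ?amp0_gt0// mulrC; apply: le_trans (amp_quadratic_le m t0 Mt) _.
rewrite ler_pM2l ?amp0_gt0// /gauss -expRD ler_expR -/k.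
have r2 : Num.sqrt t ^+ 2 = t by rewrite sqr_sqrtr ?ltW.
have r0 : 0 < Num.sqrt t by rewrite sqrtr_gt0.
have r1 : Num.sqrt t <= 1 by rewrite -(@sqrtr1 R) ler_wsqrtr.
rewrite -r2; move: (Num.sqrt t) x1 x2 r0 r1 => r x1 x2 r0 r1.
have s0 : 0 <= x - k * r by lra.
have s1 : x - k * r <= r by lra.
have -> : r ^+ 2 * (k * (k + 1)) = (k * r) * (k * r + r) by ring.
have -> : k * r = x - (x - k * r) by ring.
move: (x - k * r) s0 s1 => s s0 s1.
have r21 : r ^+ 2 <= 1 by rewrite exprn_ile1// ltW.
have h1 : s * (r - s) <= 1 / 4 by have := sqr_ge0 (r - 2 * s); lra.
have h2 : - x * (r - 2 * s) <= x ^+ 2 / 2 + 1 / 2.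
  have h3 : (r - 2 * s) ^+ 2 <= 1 by nra.
  by have := sqr_ge0 (x + (r - 2 * s)); lra.
lra.
Qed.

(** Far below the peak the angular integral is bounded only by a multiple of [t^(-3/2)], which is at
    most a multiple of [|x|^3]; half of the Gaussian absorbs this factor. *)
Lemma cubic_gauss_le x : `|x| ^+ 3 * gauss 4^-1 x <= 256 * gauss 8^-1 x.
Proof.
have -> : gauss 4^-1 x = gauss 8^-1 x * gauss 8^-1 x.
  by rewrite /gauss -expRD; congr expR; field.
rewrite mulrA ler_wpM2r ?expR_ge0// {1}/gauss expRN ler_pdivrMr ?expR_gt0//.
have -> : 8^-1 * x ^+ 2 = 2%:R * (x ^+ 2 / 16) by field.
rewrite expRM_natl; apply: (@le_trans _ _ (256 * (1 + x ^+ 2 / 16) ^+ 2)).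
  rewrite -[x ^+ 2]real_normK ?num_real//; move: `|x| (normr_ge0 x) => z z0; nra.
rewrite ler_pM2l//; apply: lerXn2r; rewrite ?nnegrE ?expR_ge0//.
  by rewrite addr_ge0// divr_ge0 ?sqr_ge0.
exact: expR_ge1Dx.
Qed.

End AmpDomination.

(** * Sums as integrals of step functions *)

Section StepFunction.
Context {R : realType}.
Notation mu := (@lebesgue_measure R).
Implicit Types (a r x : R) (c : nat -> R) (m n : nat).

(** The sum over [m] becomes an integral in the rescaled variable [x], constant on cells starting at
    [(m - a) r], so that dominated convergence applies to it. Half-open cells make the index of [x]
    unique. *)
Definition cell a r m : set R := `[(m%:R - a) * r, (m%:R - a + 1) * r[%classic.
Definition step_fun a r c n x := \sum_(1 <= m < n.+1) c m * \1_(cell a r m) x.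

Lemma cellP a r m x : cell a r m x <-> (m%:R - a) * r <= x < (m%:R - a + 1) * r.
Proof. by rewrite /cell /= in_itv. Qed.

Lemma cell_inj a r m k x : 0 < r -> cell a r m x -> cell a r k x -> m = k.
Proof.
move=> r0 /cellP/andP[m1 m2] /cellP/andP[k1 k2].
have h1 : (m%:R - a) * r < (k%:R - a + 1) * r by exact: le_lt_trans m1 k2.
have h2 : (k%:R - a) * r < (m%:R - a + 1) * r by exact: le_lt_trans k1 m2.
rewrite ltr_pM2r// in h1; rewrite ltr_pM2r// in h2.
have h3 : (m < k.+1)%N by rewrite -(ltr_nat R) -natr1; lra.
have h4 : (k < m.+1)%N by rewrite -(ltr_nat R) -natr1; lra.
by apply/eqP; rewrite eqn_leq; apply/andP; split.
Qed.

Lemma step_fun_in a r c n m x : 0 < r -> (0 < m <= n)%N -> cell a r m x ->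
  step_fun a r c n x = c m.
Proof.
move=> r0 mn cx; rewrite /step_fun (bigD1_seq m) ?iota_uniq//=; last first.
  by rewrite mem_index_iota ltnS.
rewrite indicE mem_set// mulr1 big1 ?addr0// => k km.
rewrite indicE memNset ?mulr0// => ck.
by rewrite (cell_inj r0 ck cx) eqxx in km.
Qed.

Lemma step_fun_out a r c n x : (forall m, (0 < m <= n)%N -> ~ cell a r m x) ->
  step_fun a r c n x = 0.
Proof.
move=> H; rewrite /step_fun big_seq big1// => m; rewrite mem_index_iota ltnS => mn.
by rewrite indicE memNset ?mulr0//; exact: H.
Qed.

Lemma integral_step_fun a r c n : 0 < r ->
  mu.-integrable setT (EFin \o step_fun a r c n) /\
  \int[mu]_x step_fun a r c n x = r * \sum_(1 <= m < n.+1) c m.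
Proof.
move=> r0; elim: n => [|n [IH1 IH2]].
  have -> : step_fun a r c 0 = cst 0 by apply/funext => x; rewrite /step_fun big_geq.
  split; first exact: integrable0.
  by rewrite big_geq// mulr0 Rintegral_cst// mul0r.
have E : step_fun a r c n.+1 = fun x => step_fun a r c n x + c n.+1 * \1_(cell a r n.+1) x.
  by apply/funext => x; rewrite /step_fun (@big_nat_recr _ _ _ n.+1 1).
have mc : measurable (cell a r n.+1) by exact: measurable_itv.
have lt : (n.+1%:R - a) * r < (n.+1%:R - a + 1) * r by rewrite ltr_pM2r//; lra.
have muc : mu (cell a r n.+1) = r%:E.
  rewrite /cell lebesgue_measure_itv/= lte_fin lt -EFinB; congr (_%:E); ring.
have i1 : mu.-integrable setT (EFin \o (\1_(cell a r n.+1) : R -> R)).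
  by apply: integrable_indic_itv.
have i2 : mu.-integrable setT (EFin \o (fun x => c n.+1 * \1_(cell a r n.+1) x)).
  exact: (integrableZl measurableT _ i1).
rewrite E; split; first exact: (integrableD measurableT IH1 i2).
rewrite RintegralD// IH2 RintegralZl// (@big_nat_recr _ _ _ n.+1 1)//= mulrDr.
congr (_ + _); rewrite mulrC; congr (_ * _).
by transitivity (fine (mu (cell a r n.+1))); [rewrite /Rintegral integral_indic// setIT|rewrite muc].
Qed.

Lemma measurable_step_fun a r c n : 0 < r -> measurable_fun setT (step_fun a r c n).
Proof.
move=> r0; have [/(measurable_int mu) i _] := integral_step_fun a c n r0.
exact/measurable_EFinP.
Qed.

End StepFunction.

(** * The rounded saddle point *)

Section SaddlePoint.
Context {R : realType}.
Implicit Types (n : nat).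

(* The saddle point [sqrt (B / n)], [B = pi^2 / 5], rounded so that it divides [vv]. *)
Definition peak n : nat := (Num.truncn (vv * Num.sqrt (n%:R / (pi ^+ 2 / 5)) : R)).+1.
Definition saddle n : R := step (peak n).

Lemma peak_gt0 n : (0 < peak n)%N. Proof. by []. Qed.

Lemma saddle_gt0 n : 0 < saddle n.
Proof. exact: step_gt0. Qed.

Lemma mul_saddle n : (peak n)%:R * saddle n = vv.
Proof. exact: mul_step. Qed.

Let B0 : 0 < pi ^+ 2 / 5 :> R.
Proof. by rewrite divr_gt0// exprn_gt0 ?pi_gt0. Qed.

(** Here [s] is the ratio of the rounded parameter to the exact saddle point; rounding changes
    [vv / t] by at most 1. *)
Lemma saddle_bounds n : let s := Num.sqrt (n%:R / (pi ^+ 2 / 5)) * saddle n in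
  1 - saddle n / vv <= s <= 1.
Proof.
have v0 := @vv_gt0 R; have t0 := saddle_gt0 n; have := mul_saddle n.
rewrite /= /peak; set u := Num.sqrt _; have u0 : 0 <= u by exact: sqrtr_ge0.
have /andP[h1 h2] := truncn_itv (mulr_ge0 (ltW v0) u0).
move: (saddle n) t0 => t t0 E.
have k1 : vv * (u * t) <= vv * 1.
  by rewrite mulr1 mulrA -[leRHS]E ler_pM2r// ltW.
have k2 : vv <= vv * (u * t) + t.
  rewrite -{1}E -natr1 mulrDl mul1r lerD2r mulrA ler_pM2r//.
rewrite ler_pM2l// in k1; rewrite k1 andbT.
by rewrite -(ler_pM2l v0) mulrBr mulr1 mulrCA mulfV ?gt_eqF// mulr1; lra.
Qed.

Lemma saddle_sqr n : saddle n ^+ 2 * n%:R =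
  pi ^+ 2 / 5 * (Num.sqrt (n%:R / (pi ^+ 2 / 5)) * saddle n) ^+ 2.
Proof.
rewrite [in RHS]exprMn sqr_sqrtr; last by rewrite divr_ge0// ltW.
by move: (pi ^+ 2 / 5) B0 => B b0; field; rewrite gt_eqF.
Qed.

Lemma cvg_saddle : saddle n @[n --> \oo] --> (0 : R).
Proof.
have c : Num.sqrt (pi ^+ 2 / 5 * n%:R^-1) @[n --> \oo] --> (0 : R).
  rewrite -[X in _ --> X](@sqrtr0 R); apply: cvg_fun; first exact: sqrt_continuous.
  apply: (@cvg_eq _ _ _ _ (pi ^+ 2 / 5 * 0)); last by rewrite mulr0.
  by apply: cvgM; [exact: cvg_cst|exact: cvg_natV].
apply: (@squeeze_cvgr _ _ _ _ (cst 0)) c; last exact: cvg_cst.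
exists 1%N => // n /= n0; rewrite (ltW (saddle_gt0 n))/=.
have n1 : 0 < n%:R :> R by rewrite ltr0n.
rewrite -[leLHS]ger0_norm ?(ltW (saddle_gt0 n))// -sqrtr_sqr ler_wsqrtr//.
rewrite ler_pdivlMr// saddle_sqr -[leRHS]mulr1 ler_pM2l//.
have /andP[_ s1] := saddle_bounds n.
by rewrite exprn_ile1// mulr_ge0 ?sqrtr_ge0// ltW// saddle_gt0.
Qed.

Lemma cvg_peak : peak n @[n --> \oo] --> \oo.
Proof.
apply/cvgnyPge => A; have A0 : 0 < vv / A.+1%:R :> R by rewrite divr_gt0 ?vv_gt0.
apply: filterS (cvgr_lt _ cvg_saddle _ A0) => n.
rewrite /saddle /step ltr_pM2l ?vv_gt0// ltf_pV2 ?posrE ?ltr0n// ltr_nat.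
by move=> /ltnW /ltnW.
Qed.

Lemma cvg_saddle_err :
  (saddle n ^+ 2 * n%:R - pi ^+ 2 / 5) / Num.sqrt (saddle n) @[n --> \oo] --> (0 : R).
Proof.
have v0 := @vv_gt0 R.
apply: norm_cvg0; apply: (@squeeze_cvgr _ _ _ _ (cst 0)
  (fun n => 2 * (pi ^+ 2 / 5) / vv * Num.sqrt (saddle n))).
- apply: nearW => n /=; rewrite normr_ge0/=.
  have t0 := saddle_gt0 n; have r0 : 0 < Num.sqrt (saddle n) by rewrite sqrtr_gt0.
  rewrite normrM normfV (gtr0_norm r0) ler_pdivrMr// -[leRHS]mulrA -expr2 sqr_sqrtr ?(ltW t0)//.
  rewrite saddle_sqr; have := saddle_bounds n; set s := _ * saddle n; cbv zeta.
  have s0 : 0 <= s by rewrite mulr_ge0 ?sqrtr_ge0// ltW.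
  move: (pi ^+ 2 / 5 : R) B0 => B b0 /andP[h1 h2].
  have -> : B * s ^+ 2 - B = - (B * ((1 - s) * (1 + s))) by ring.
  have h3 : 0 <= (1 - s) * (1 + s) by rewrite mulr_ge0; lra.
  rewrite normrN ger0_norm; last by rewrite mulr_ge0// ltW.
  have h4 : (1 - s) * (1 + s) <= saddle n / vv * 2 by apply: ler_pM; lra.
  have -> : 2 * B / vv * saddle n = B * (saddle n / vv * 2) by ring.
  by rewrite ler_pM2l.
- exact: cvg_cst.
- apply: (@cvg_eq _ _ _ _ (2 * (pi ^+ 2 / 5) / vv * 0)); last by rewrite mulr0.
  by apply: cvgM; [exact: cvg_cst|exact: cvg_sqrt_t cvg_saddle].
Qed.

(** With [B = pi^2 / 5], the function [n t + B / t] has minimum [2 sqrt (B n) = 2 pi sqrt (n / 5)].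
    At the rounded point it exceeds it by [B (1 - s)^2 / t], which is [O(t)] as [1 - s = O(t)]. *)
Lemma cvg_saddle_exponent :
  n%:R * saddle n + pi ^+ 2 / 5 / saddle n - 2 * pi * Num.sqrt (n%:R / 5)
  @[n --> \oo] --> (0 : R).
Proof.
have v0 := @vv_gt0 R.
have E n : n%:R * saddle n + pi ^+ 2 / 5 / saddle n - 2 * pi * Num.sqrt (n%:R / 5) =
    pi ^+ 2 / 5 * (1 - Num.sqrt (n%:R / (pi ^+ 2 / 5)) * saddle n) ^+ 2 / saddle n.
  have t0 := saddle_gt0 n.
  have e1 : n%:R * saddle n = pi ^+ 2 / 5 *
      (Num.sqrt (n%:R / (pi ^+ 2 / 5)) * saddle n) ^+ 2 / saddle n.
    by rewrite -saddle_sqr; move: (n%:R : R) (saddle n) t0 => k t t0; field; rewrite gt_eqF.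
  have e2 : 2 * pi * Num.sqrt (n%:R / 5 : R) =
      2 * (pi ^+ 2 / 5) * Num.sqrt (n%:R / (pi ^+ 2 / 5)).
    have -> : n%:R / 5 = (pi / 5) ^+ 2 * (n%:R / (pi ^+ 2 / 5)) :> R.
      have := pi_gt0 R; move: (n%:R : R) => k.
      by move: (@pi R) => p p0; field; rewrite gt_eqF.
    rewrite sqrtrM ?sqr_ge0// sqrtr_sqr ger0_norm ?divr_ge0 ?pi_ge0//.
    by move: (Num.sqrt _) => z; move: (@pi R) => p; field.
  rewrite e1 e2; move: (Num.sqrt _) => u; move: (pi ^+ 2 / 5) => B.
  by field; rewrite gt_eqF.
apply: (@squeeze_cvgr _ _ _ _ (cst 0) (fun n => pi ^+ 2 / 5 / vv ^+ 2 * saddle n)).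
- apply: nearW => n /=; rewrite E; have t0 := saddle_gt0 n.
  rewrite divr_ge0 ?(ltW t0)//=; last by rewrite mulr_ge0 ?sqr_ge0// ltW.
  rewrite ler_pdivrMr//; have := saddle_bounds n; set s := Num.sqrt _ * saddle n; cbv zeta => /andP[h1 h2].
  have -> : pi ^+ 2 / 5 / vv ^+ 2 * saddle n * saddle n = pi ^+ 2 / 5 * (saddle n / vv) ^+ 2.
    by rewrite expr_div_n; move: (pi ^+ 2 / 5) (vv ^+ 2) => p v; ring.
  rewrite ler_pM2l//.
  by apply: lerXn2r; rewrite ?nnegrE ?divr_ge0 ?(ltW v0) ?(ltW t0)//; lra.
- exact: cvg_cst.
- apply: (@cvg_eq _ _ _ _ (pi ^+ 2 / 5 / vv ^+ 2 * 0)); last by rewrite mulr0.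
  by apply: cvgM; [exact: cvg_cst|exact: cvg_saddle].
Qed.

End SaddlePoint.

(** * Normalised summands and their limits *)

Section SaddleExpansion.
Context {R : realType}.
Notation mu := (@lebesgue_measure R).
Implicit Types (n m w : nat) (x y : R).
Local Notation t := (@saddle R).
Local Notation M := (@peak R).
Local Notation r n := (Num.sqrt (t n)).
Local Notation eps n := (t n * Num.sqrt (t n)).
Local Notation phi := (phi R).

(** The integrand, the angular integral and the summand, all normalised. In [coef] stand in order
    the effect of the shift by [w m], the height of the peak, the amplitude relative to the peak and
    the angular integral; each factor has its own limit. *)
Definition kern w n m y : R := damping (t n) (eps n * y) m *
  cos (phase (t n) m (eps n * y) - (n%:Z - (w * m)%:Z)%:~R * (eps n * y)).
Definition osc w n m : R := \int[mu]_(y in `[- (pi / eps n), pi / eps n]) kern w n m y.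
Definition coef w n m : R := expR (- (w%:R * (m%:R * t n))) *
  (amp (t n) (M n) 0 * expR (- (pi ^+ 2 / 5 / t n)) / t n) *
  (amp (t n) m 0 / amp (t n) (M n) 0) * ((2 * pi)^-1 * osc w n m).

Lemma sqrt_saddle_gt0 n : 0 < r n.
Proof. by rewrite sqrtr_gt0 saddle_gt0. Qed.

Lemma eps_gt0 n : 0 < eps n.
Proof. by rewrite mulr_gt0 ?saddle_gt0 ?sqrt_saddle_gt0. Qed.

Lemma kernE w n m y : kern w n m y = (amp (t n) m 0)^-1 * (amp (t n) m (eps n * y) *
  cos (phase (t n) m (eps n * y) - (n%:Z - (w * m)%:Z)%:~R * (eps n * y))).
Proof.
rewrite (amp_damping m (eps n * y) (saddle_gt0 n)) -mulrA mulKf// gt_eqF//.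
exact: amp0_gt0 (saddle_gt0 n).
Qed.

Lemma continuous_kern w n m : continuous (kern w n m).
Proof.
rewrite (_ : kern w n m = fun y => (amp (t n) m 0)^-1 * (amp (t n) m (eps n * y) *
  cos (phase (t n) m (eps n * y) - (n%:Z - (w * m)%:Z)%:~R * (eps n * y)))); last first.
  by apply/funext => y; exact: kernE.
move=> y; apply: cvgM; first exact: cvg_cst.
exact: (@continuous_fourier_integrand R (t n) (eps n) m _ (saddle_gt0 n)).
Qed.

Lemma kern_le w n m y : `|kern w n m y| <= damping (t n) (eps n * y) m.
Proof.
rewrite normrM ger0_norm ?damping_ge0// ler_piMr ?damping_ge0//.
by rewrite ler_norml cos_geN1 cos_le1.
Qed.

Lemma fourier_osc w n m : fourier (t n) (eps n) m (n%:Z - (w * m)%:Z) =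
  eps n / (2 * pi) * (amp (t n) m 0 * osc w n m).
Proof.
have E : amp (t n) m 0 * osc w n m =
    \int[mu]_(y in `[- (pi / eps n), pi / eps n]) (amp (t n) m 0 * kern w n m y).
  by rewrite RintegralZl//; apply: continuous_integrable; exact: continuous_kern.
rewrite /fourier E; congr (_ * _); apply: eq_Rintegral => y _; rewrite kernE mulrA mulfV ?mul1r//.
by rewrite gt_eqF// amp0_gt0// saddle_gt0.
Qed.

(** Of the [t^2], one [t] normalises the peak; [t^(3/2)] from the change of angle over the other [t]
    leaves the mesh [sqrt t] of the step function. *)
Lemma stack_sum_coef w n :
  stack_sum w n * expR (- (n%:R * t n + pi ^+ 2 / 5 / t n)) / t n ^+ 2 =
  r n * \sum_(1 <= m < n.+1) coef w n m.
Proof.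
rewrite /stack_sum !mulr_suml mulr_sumr; apply: eq_bigr => m _.
have t0 := @saddle_gt0 R n; have r0 := sqrt_saddle_gt0 n; have e0 := eps_gt0 n.
rewrite (pairs_fourier m _ t0 e0) fourier_osc /coef.
have -> : (n%:Z - (w * m)%:Z)%:~R * t n = n%:R * t n - w%:R * (m%:R * t n).
  by rewrite intrB -!pmulrn natrM; ring.
rewrite opprD !expRD.
have a0 : amp (t n) (M n) 0 != 0 by rewrite gt_eqF// amp0_gt0.
rewrite [expR (- (n%:R * t n))]expRN.
have e1 : expR (n%:R * t n) != 0 by rewrite gt_eqF ?expR_gt0.
have p0 := pi_gt0 R; have r2 : r n ^+ 2 = t n by rewrite sqr_sqrtr ?ltW.
move: (osc w n m) => o; move: (amp _ m 0) => am.
move: (expR (- (w%:R * _))) (expR (- (pi ^+ 2 / 5 / t n))) => ew eb.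
move: (expR _) e1 (amp _ _ _) a0 => en en0 aM aM0.
move: (t n) t0 (r n) r0 => tn tn0 rn rn0.
by move: (@pi R) p0 => p p0; field; rewrite aM0 en0 !gt_eqF.
Qed.

Lemma stack_sum_integral w n :
  stack_sum w n * expR (- (n%:R * t n + pi ^+ 2 / 5 / t n)) / t n ^+ 2 =
  \int[mu]_x step_fun (M n)%:R (r n) (coef w n) n x.
Proof.
rewrite stack_sum_coef; have [_ ->//] := integral_step_fun (M n)%:R (coef w n) n (sqrt_saddle_gt0 n).
Qed.

(** The trivial bound, of order [t^(-3/2)], for use when [2 m < M]. *)
Lemma osc_le w n m : `|osc w n m| <= 2 * pi / eps n.
Proof.
have e0 := eps_gt0 n; have ck := @continuous_kern w n m.
have pe : - (pi / eps n) <= pi / eps n.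
  by rewrite ge0_cp// divr_ge0 ?pi_ge0// ltW.
have c1 : continuous (fun _ : R => 1 : R) by move=> ?; exact: cvg_cst.
have d1 (x : R) : has_derive (fun y : R => y) x 1 by exact: derive_id.
have le : `|osc w n m| <= \int[mu]_(y in `[- (pi / eps n), pi / eps n]) (1 : R).
  apply: le_trans; first by apply: le_normr_Rintegral => //; exact: continuous_integrable.
  apply: le_Rintegral => //; first exact: (integrable_abse (continuous_integrable _ _ ck)).
    exact: continuous_integrable.
  by move=> y _; apply: le_trans (kern_le _ _ _ _) (damping_le1 _ _ _).
apply: le_trans le _; rewrite (integral_derive pe c1 d1).
by rewrite le_eqVlt; apply/orP; left; apply/eqP; move: (eps n) (@pi R) => e p; ring.
Qed.

Lemma kern_dominated : exists2 K : R, 0 < K & forall w n m, (1 < M n)%N ->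
  (M n <= m.*2)%N -> forall y,
  `|(kern w n m \_ `[- (pi / eps n), pi / eps n]) y| <= K * (1 + y ^+ 2)^-1.
Proof.
have [K K0 HK] := @damping_dominated R; exists K => // w n m M1 Mm y.
have y0 : 0 <= K * (1 + y ^+ 2)^-1.
  by rewrite mulr_ge0 ?(ltW K0)// invr_ge0 addr_ge0 ?sqr_ge0.
rewrite patchE; case: ifPn => [|_]; last by rewrite normr0.
rewrite inE/= in_itv/= => /andP[h1 h2].
apply: le_trans (kern_le w n m y) _.
apply: (HK (t n) (M n)) => //; [exact: saddle_gt0|exact: mul_saddle|].
have e0 := eps_gt0 n; rewrite normrM (gtr0_norm e0) mulrC -ler_pdivlMr// ler_norml.
by rewrite h1 h2.
Qed.

Lemma osc_dominated : exists2 K : R, 0 < K & forall w n m, (1 < M n)%N ->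
  (M n <= m.*2)%N -> `|osc w n m| <= K.
Proof.
have [K K0 HK] := kern_dominated.
have iK : mu.-integrable setT (EFin \o (fun y : R => K * (1 + y ^+ 2)^-1)).
  exact: (integrableZl measurableT _ (@integrable_oneDsqrV R)).
have I0 : 0 <= \int[mu]_y (K * (1 + y ^+ 2)^-1).
  by apply: Rintegral_ge0 => y _; rewrite mulr_ge0 ?(ltW K0)// invr_ge0 addr_ge0 ?sqr_ge0.
exists (1 + \int[mu]_y (K * (1 + y ^+ 2)^-1)); first by rewrite ltr_pwDl.
move=> w n m M1 Mm.
have ik : mu.-integrable setT (EFin \o (kern w n m \_ `[- (pi / eps n), pi / eps n])).
  rewrite (_ : EFin \o _ = (EFin \o kern w n m) \_ `[- (pi / eps n), pi / eps n]); last first.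
    by apply/funext => z; rewrite /= restrict_EFin.
  apply/integrable_restrict => //.
  by rewrite setTI; apply: continuous_integrable; exact: continuous_kern.
apply: (@le_trans _ _ (\int[mu]_y (K * (1 + y ^+ 2)^-1))); last by rewrite lerDr.
rewrite /osc Rintegral_mkcond.
apply: le_trans; first by apply: le_normr_Rintegral.
apply: le_Rintegral => //; first exact: (integrable_abse ik).
by move=> y _; exact: HK.
Qed.

Section PointwiseLimit.
Variables (w : nat) (m : nat -> nat) (x : R).
Hypotheses (m_gt0 : forall n, (0 < m n)%N)
  (cvg_m : ((m n)%:R - (M n)%:R) * r n @[n --> \oo] --> x).

Lemma cvg_osc : osc w n (m n) @[n --> \oo] -->
  \int[mu]_y (gauss sigma2 y * cos (Num.sqrt 5 * vv * x * y)).
Proof.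
have cmt := cvg_m_t (@saddle_gt0 R) (@mul_saddle R) (@cvg_saddle R) cvg_m.
have [K K0 HK] := kern_dominated.
rewrite /osc; under eq_fun do rewrite Rintegral_mkcond.
have [||||//] := @Rintegral_dominated R
  (fun n => kern w n (m n) \_ `[- (pi / eps n), pi / eps n])
  (fun y => gauss sigma2 y * cos (Num.sqrt 5 * vv * x * y))
  (fun y => K * (1 + y ^+ 2)^-1).
- by move=> n; apply: measurable_restrict_itv; exact: continuous_kern.
- move=> y; have L : kern w n (m n) y @[n --> \oo] -->
      gauss sigma2 y * cos (Num.sqrt 5 * vv * x * y).
    apply: cvgM; first exact: (cvg_damping (@saddle_gt0 R) m_gt0 (@mul_saddle R) (@cvg_saddle R) cvg_m).
    apply: (@cvg_fun _ _ _ _ _ cos); first exact: continuous_cos.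
    exact: (cvg_phase (@saddle_gt0 R) m_gt0 (@mul_saddle R) (@cvg_saddle R) cvg_m w (@cvg_saddle_err R)).
  apply: cvg_trans L; apply: near_eq_cvg.
  (* A fixed [y] lies in the interval of integration as soon as [eps n * |y| <= pi]. *)
  have ce : eps n * `|y| @[n --> \oo] --> (0 : R).
    apply: (@cvg_eq _ _ _ _ (0 * 0 * `|y|)); last by rewrite !mul0r.
    apply: cvgM; last exact: cvg_cst.
    by apply: cvgM; [exact: cvg_saddle|exact: cvg_sqrt_t (@cvg_saddle R)].
  apply: filterS (cvgr_le _ ce _ (pi_gt0 R)) => n ne.
  rewrite patchE ifT// inE/= in_itv/= -ler_norml ler_pdivlMr ?eps_gt0// mulrC.
  exact: ne.
- exact: (integrableZl measurableT _ (@integrable_oneDsqrV R)).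
- have v2 : vv / 2 < vv :> R by have := @vv_gt0 R; lra.
  have n1 : \forall n \near \oo, vv / 2 <= (m n)%:R * t n by exact: cvgr_ge cmt _ v2.
  have /cvgnyPge/(_ 2%N) n2 := @cvg_peak R.
  near=> n => y; apply: HK; first by near: n; exact: n2.
  have h1 : vv / 2 <= (m n)%:R * t n by near: n; exact: n1.
  rewrite -(ler_nat R) -(ler_pM2r (saddle_gt0 n)) mul_saddle -mul2n natrM -mulrA; lra.
Unshelve. all: by end_near. Qed.

Definition coef_lim : R := (phi ^- 2) ^+ w * (2 * pi)^-1 * gauss (Num.sqrt 5 / 2) x *
  ((2 * pi)^-1 * (Num.sqrt (pi / sigma2) *
    expR (- ((Num.sqrt 5 * vv * x) ^+ 2 / (4 * sigma2))))).

Lemma cvg_coef : coef w n (m n) @[n --> \oo] --> coef_lim.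
Proof.
have cmt := cvg_m_t (@saddle_gt0 R) (@mul_saddle R) (@cvg_saddle R) cvg_m.
apply: cvgM; last first.
  apply: cvgM; first exact: cvg_cst.
  by rewrite -integral_gauss_cos ?sigma2_gt0//; exact: cvg_osc.
apply: cvgM; last first.
  exact: (cvg_amp_ratio (@saddle_gt0 R) (@peak_gt0 R) m_gt0 (@mul_saddle R) (@cvg_saddle R) cvg_m).
apply: cvgM.
  rewrite -expRN_vv -expRM_natl mulrN.
  apply: (@cvg_fun _ _ _ _ _ expR); first exact: continuous_expR.
  by apply: cvgN; apply: cvgM => //; exact: cvg_cst.
exact: (cvg_comp _ _ (@cvg_peak R) (@cvg_amp0 R)).
Qed.

End PointwiseLimit.

End SaddleExpansion.

(** * Asymptotics of the sums *)

Section StackAsymptotics.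
Context {R : realType}.
Notation mu := (@lebesgue_measure R).
Implicit Types (n m w : nat) (x y : R).
Local Notation t := (@saddle R).
Local Notation M := (@peak R).
Local Notation r n := (Num.sqrt (t n)).
Local Notation phi := (phi R).

Lemma gauss_le (a b x : R) : b <= a -> gauss a x <= gauss b x.
Proof. by move=> ba; rewrite ler_expR lerN2 ler_wpM2r ?sqr_ge0. Qed.

(** If [M <= 2 m] the angular integral is bounded and the Gaussian comes from the amplitude.
    Otherwise the cell is so far from 0 that [t^(-3/2)] is at most a multiple of [|x|^3], at the
    price of part of the Gaussian, whence [1/8]. *)
Lemma coef_dominated w : exists2 C : R, 0 < C & \forall n \near \oo,
  forall m x, cell (M n)%:R (r n) m x -> `|coef w n m| <= C * gauss 8^-1 x.
Proof.
have [K K0 HK] := @osc_dominated R.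
have v0 := @vv_gt0 R; have p0 := pi_gt0 R.
pose A : R := (2 * pi)^-1 + 1.
have A0 : 0 < A by rewrite addr_gt0// invr_gt0 mulr_gt0.
pose L : R := K + 2 * pi * (4 / vv) ^+ 3 * 256.
have c3 : 0 < (4 / vv) ^+ 3 :> R by rewrite exprn_gt0// divr_gt0.
have W0 : 0 < 2 * pi * (4 / vv) ^+ 3 :> R by apply: mulr_gt0 => //; exact: mulr_gt0.
have L0 : 0 < L by apply: addr_gt0 => //; exact: mulr_gt0.
exists (A * expR 1 * ((2 * pi)^-1 * L)).
  by rewrite !mulr_gt0 ?expR_gt0// invr_gt0 mulr_gt0.
have n1 : \forall n \near \oo, t n <= 1 by exact: cvgr_le (@cvg_saddle R) _ ltr01.
have /cvgnyPge/(_ 4%N) n2 := @cvg_peak R.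
have n3 : \forall n \near \oo,
    amp (t n) (M n) 0 * expR (- (pi ^+ 2 / 5 / t n)) / t n <= A.
  by apply: cvgr_le (cvg_comp _ _ (@cvg_peak R) (@cvg_amp0 R)) _ _; rewrite ltrDl.
near=> n => m x cx.
have t1 : t n <= 1 by near: n; exact: n1.
have M4 : (4 <= M n)%N by near: n; exact: n2.
have hA : amp (t n) (M n) 0 * expR (- (pi ^+ 2 / 5 / t n)) / t n <= A by near: n; exact: n3.
have t0 := @saddle_gt0 R n; have r0 := @sqrt_saddle_gt0 R n.
have r2 : r n ^+ 2 = t n by rewrite sqr_sqrtr ?(ltW t0).
have Mt := @mul_saddle R n.
have /cellP cx' := cx.
have h1 : expR (- (w%:R * (m%:R * t n))) <= 1.
  rewrite -[leRHS]expR0 ler_expR oppr_le0; apply: mulr_ge0 => //.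
  by apply: mulr_ge0 => //; exact: ltW.
have tI : 0 < t n <= 1 by rewrite t0.
have h2 := amp_gauss_le tI Mt cx'.
have aM := amp0_gt0 (M n) t0; have am := amp0_gt0 m t0.
have p1 : 0 <= expR (- (w%:R * (m%:R * t n))) by exact: expR_ge0.
have p2 : 0 <= amp (t n) (M n) 0 * expR (- (pi ^+ 2 / 5 / t n)) / t n.
  apply: divr_ge0; last exact: ltW.
  by apply: mulr_ge0; [exact: ltW|exact: expR_ge0].
have p3 : 0 <= amp (t n) m 0 / amp (t n) (M n) 0 by rewrite divr_ge0 ?ltW.
have pp : 0 < (2 * pi)^-1 :> R by rewrite invr_gt0 mulr_gt0.
have key : gauss 4^-1 x * `|osc w n m| <= L * gauss 8^-1 x.
  have g8 := expR_ge0 (- (8^-1 * x ^+ 2)); have g4 := expR_ge0 (- (4^-1 * x ^+ 2)).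
  have [Mm|mM] := leqP (M n) m.*2.
    apply: (@le_trans _ _ (gauss 8^-1 x * K)).
      apply: ler_pM => //; first by apply: gauss_le; lra.
      by apply: HK => //; exact: leq_trans M4.
    by rewrite mulrC ler_wpM2r// /L lerDl mulr_ge0// ltW.
  (* When [2 m < M], the cell of [m] lies below [- M r / 4], and [M r = vv / r]. *)
  have x4 : (r n)^-1 <= 4 / vv * `|x|.
    have e1 : m%:R - (M n)%:R + 1 <= - ((M n)%:R / 4) :> R.
      have : (m.*2.+1%:R : R) <= (M n)%:R by rewrite ler_nat.
      rewrite -natr1 -muln2 natrM; have : 4 <= (M n)%:R :> R by rewrite ler_nat.
      by move: (m%:R) ((M n)%:R) => a b; lra.
    have e2 : x < - ((M n)%:R / 4) * r n.
      by case/andP: cx' => _ /lt_le_trans; apply; rewrite ler_pM2r.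
    have e3 : (M n)%:R * r n / 4 <= `|x|.
      rewrite -normrN; apply: le_trans (ler_norm _).
      have -> : (M n)%:R * r n / 4 = - (- ((M n)%:R / 4) * r n) by field.
      by rewrite lerN2 ltW.
    have -> : (r n)^-1 = 4 / vv * ((M n)%:R * r n / 4).
      have -> : vv = (M n)%:R * r n ^+ 2 :> R by rewrite r2.
      have : 0 < (M n)%:R :> R by rewrite ltr0n.
      move: (r n) r0 ((M n)%:R) => a a0 b b0.
      by field; rewrite !gt_eqF.
    by rewrite ler_pM2l// divr_gt0.
  apply: (@le_trans _ _ (gauss 4^-1 x * (2 * pi * (4 / vv) ^+ 3 * `|x| ^+ 3))).
    rewrite ler_wpM2l//; apply: le_trans (osc_le w n m) _.
    rewrite -[leRHS]mulrA -exprMn ler_pM2l ?mulr_gt0//.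
    have -> : (t n * r n)^-1 = (r n)^-1 ^+ 3 by rewrite exprVn (exprSr _ 2) r2.
    have i0 : 0 <= (r n)^-1 by rewrite invr_ge0 ltW.
    by apply: lerXn2r => //; rewrite nnegrE//; exact: le_trans x4.
  have := cubic_gauss_le x.
  rewrite (_ : gauss 4^-1 x * _ = 2 * pi * (4 / vv) ^+ 3 * (`|x| ^+ 3 * gauss 4^-1 x)); last first.
    by move: (4 / vv) (@pi R) => a b; ring.
  move=> /(ler_wpM2l (ltW W0)) /le_trans; apply.
  by rewrite mulrA ler_wpM2r// /L lerDr ltW.
rewrite /coef !normrM (ger0_norm p1) (ger0_norm (ltW pp)) -2!normrM (ger0_norm p2).
rewrite -normrM (ger0_norm p3).
have q : expR (- (w%:R * (m%:R * t n))) *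
    (amp (t n) (M n) 0 * expR (- (pi ^+ 2 / 5 / t n)) / t n) <= A.
  by rewrite -[leRHS]mul1r; apply: ler_pM.
apply: (@le_trans _ _ (A * (expR 1 * gauss 4^-1 x) * ((2 * pi)^-1 * `|osc w n m|))).
  rewrite ler_wpM2r//; first by rewrite mulr_ge0// ltW.
  by apply: ler_pM => //; rewrite mulr_ge0.
have -> : A * (expR 1 * gauss 4^-1 x) * ((2 * pi)^-1 * `|osc w n m|) =
  A * expR 1 * (2 * pi)^-1 * (gauss 4^-1 x * `|osc w n m|) by ring.
have -> : A * expR 1 * ((2 * pi)^-1 * L) * gauss 8^-1 x =
  A * expR 1 * (2 * pi)^-1 * (L * gauss 8^-1 x) by ring.
by rewrite ler_pM2l// !mulr_gt0 ?expR_gt0.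
Unshelve. all: by end_near. Qed.

Lemma cvg_saddle_sqr : t n ^+ 2 * n%:R @[n --> \oo] --> (pi ^+ 2 / 5 : R).
Proof.
have -> : (fun n => t n ^+ 2 * n%:R) = fun n =>
    (t n ^+ 2 * n%:R - pi ^+ 2 / 5) / r n * r n + pi ^+ 2 / 5.
  by apply/funext => n; rewrite divfK ?subrK// gt_eqF// sqrt_saddle_gt0.
apply: (@cvg_eq _ _ _ _ (0 * 0 + pi ^+ 2 / 5)); last by rewrite mul0r add0r.
apply: cvgD; last exact: cvg_cst.
by apply: cvgM; [exact: cvg_saddle_err|exact: cvg_sqrt_t (@cvg_saddle R)].
Qed.

(** The index of the cell containing [x]. The maximum with 1 keeps it positive for every [n], as the
    pointwise limits require; it has no effect for large [n]. *)
Definition slot x n : nat := `|(Num.max 1 ((M n)%:Z + Num.floor (x / r n)))%R|%N.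

Lemma slot_gt0 x n : (0 < slot x n)%N.
Proof. by rewrite absz_gt0 gt_eqF// lt_max ltr01. Qed.

Lemma near_slot x : \forall n \near \oo,
  (slot x n)%:R - (M n)%:R = (Num.floor (x / r n))%:~R :> R.
Proof.
have c : vv + x * r n - 3 * t n @[n --> \oo] --> (vv : R).
  apply: (@cvg_eq _ _ _ _ (vv + x * 0 - 3 * 0)); last by rewrite !mulr0 subr0 addr0.
  apply: cvgB; last by apply: cvgM; [exact: cvg_cst|exact: cvg_saddle].
  apply: cvgD; first exact: cvg_cst.
  by apply: cvgM; [exact: cvg_cst|exact: cvg_sqrt_t (@cvg_saddle R)].
have n1 : \forall n \near \oo, 0 <= vv + x * r n - 3 * t n by exact: cvgr_ge c _ (@vv_gt0 R).
apply: filterS n1 => n H.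
have t0 := @saddle_gt0 R n; have r0 := @sqrt_saddle_gt0 R n.
have r2 : r n ^+ 2 = t n by rewrite sqr_sqrtr ?(ltW t0).
set f := Num.floor (x / r n).
have /andP[f1 f2] := floor_itv (x / r n).
have g : 1 <= (M n)%:Z + f.
  rewrite -(@ler_int R) intrD -pmulrn.
  have : 2 <= (M n)%:R + x / r n - 1 :> R.
    rewrite -(ler_pM2r t0).
    have xr : x / r n * t n = x * r n.
      by rewrite -[X in _ * X]r2 expr2 mulrA divfK ?gt_eqF.
    by rewrite [leRHS]mulrBl [X in X - _]mulrDl xr mul_saddle; lra.
  by rewrite intrD -/f in f2; lra.
rewrite /slot -/f max_r// -[X in X - _]/((Posz _)%:~R) gez0_abs; last exact: le_trans g.
by rewrite intrD -pmulrn addrC addKr.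
Qed.

Lemma cvg_slot x : ((slot x n)%:R - (M n)%:R) * r n @[n --> \oo] --> x.
Proof.
apply: (@squeeze_cvgr _ _ _ _ (fun n => x - r n) (cst x)).
- apply: filterS (near_slot x) => n ->.
  have r0 := @sqrt_saddle_gt0 R n; have /andP[f1 f2] := floor_itv (x / r n).
  rewrite -ler_pdivlMr// f1 andbT -ler_pdivrMr// mulrBl mulfV ?gt_eqF//.
  by rewrite intrD in f2; lra.
- apply: (@cvg_eq _ _ _ _ (x - 0)); last by rewrite subr0.
  by apply: cvgB; [exact: cvg_cst|exact: cvg_sqrt_t (@cvg_saddle R)].
- exact: cvg_cst.
Qed.

(** For large [n] the value at [x] is the coefficient at [slot x n]: this index is about [vv / t],
    of order [sqrt n], hence within the range of summation. *)
Lemma cvg_step_fun w x :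
  step_fun (M n)%:R (r n) (coef w n) n x @[n --> \oo] --> coef_lim w x.
Proof.
have L := @cvg_coef R w _ x (slot_gt0 x) (@cvg_slot x).
apply: cvg_trans L; apply: near_eq_cvg.
have cmt := cvg_m_t (@saddle_gt0 R) (@mul_saddle R) (@cvg_saddle R) (@cvg_slot x).
have n1 := near_slot x.
have n2 : \forall n \near \oo, (slot x n)%:R * t n <= vv + 1.
  by apply: cvgr_le cmt _ _; rewrite ltrDl.
have c : t n ^+ 2 * n%:R - (vv + 1) * t n @[n --> \oo] --> (pi ^+ 2 / 5 : R).
  apply: (@cvg_eq _ _ _ _ (pi ^+ 2 / 5 - (vv + 1) * 0)); last by rewrite mulr0 subr0.
  apply: cvgB; first exact: cvg_saddle_sqr.
  by apply: cvgM; [exact: cvg_cst|exact: cvg_saddle].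
have n3 : \forall n \near \oo, 0 <= t n ^+ 2 * n%:R - (vv + 1) * t n.
  by apply: cvgr_ge c _ _; rewrite divr_gt0// exprn_gt0// pi_gt0.
near=> n.
have e1 : (slot x n)%:R - (M n)%:R = (Num.floor (x / r n))%:~R :> R by near: n; exact: n1.
have e2 : (slot x n)%:R * t n <= vv + 1 by near: n; exact: n2.
have e3 : 0 <= t n ^+ 2 * n%:R - (vv + 1) * t n by near: n; exact: n3.
have t0 := @saddle_gt0 R n; have r0 := @sqrt_saddle_gt0 R n.
apply/esym/step_fun_in => //.
  rewrite slot_gt0/= -(ler_nat R) -(ler_pM2r t0); apply: le_trans e2 _.
  by rewrite -(ler_pM2r t0); have -> : n%:R * t n * t n = t n ^+ 2 * n%:R; [ring|lra].
apply/cellP; rewrite e1; have /andP[f1 f2] := floor_itv (x / r n).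
rewrite -ler_pdivlMr// f1/= -ltr_pdivrMr//; by rewrite intrD in f2.
Unshelve. all: by end_near. Qed.

(** The determinant of the limiting quadratic form in [(x, y)]. The [vv^2] in [sigma2] cancels
    against the square of the mixed term, so the final constant is free of [ln phi]. *)
Lemma sigma2_identity : sigma2 * (Num.sqrt 5 / 2) + (Num.sqrt 5 * vv) ^+ 2 / 4 =
  Num.sqrt 5 * pi ^+ 2 / 10 :> R.
Proof.
have s5 : Num.sqrt 5 ^+ 2 = 5 :> R by rewrite sqr_sqrtr.
rewrite /sigma2; move: (Num.sqrt (5 : R)) s5 => s s5; move: (@vv R) => v; move: (@pi R) => p.
have -> : (p ^+ 2 / 5 - s / 2 * v ^+ 2) * (s / 2) + (s * v) ^+ 2 / 4 = s * p ^+ 2 / 10 by field.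
by [].
Qed.

Lemma integral_coef_lim w : \int[mu]_x coef_lim w x =
  (phi ^- 2) ^+ w / (4 * pi ^+ 2 * Num.sqrt (Num.sqrt 5 / 10)).
Proof.
have s0 := @sigma2_gt0 R; have p0 := pi_gt0 R.
have q0 : 0 < Num.sqrt 5 :> R by rewrite sqrtr_gt0.
pose b : R := Num.sqrt 5 / 2 + (Num.sqrt 5 * vv) ^+ 2 / (4 * sigma2).
have bs : b * sigma2 = Num.sqrt 5 * pi ^+ 2 / 10.
  rewrite -sigma2_identity /b; move: (Num.sqrt 5 : R) (@vv R) => s v.
  by move: (@sigma2 R) s0 => z z0; field; rewrite gt_eqF.
have b0 : 0 < b by rewrite -(pmulr_lgt0 _ s0) bs divr_gt0// mulr_gt0// exprn_gt0.
have [ig Ig] := integrable_integral_gauss b0.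
pose c : R := (phi ^- 2) ^+ w * (2 * pi)^-1 * ((2 * pi)^-1 * Num.sqrt (pi / sigma2)).
have E x : coef_lim w x = c * gauss b x.
  rewrite /coef_lim /c.
  have -> : gauss b x = gauss (Num.sqrt 5 / 2) x *
      expR (- ((Num.sqrt 5 * vv * x) ^+ 2 / (4 * sigma2))).
    rewrite /gauss -expRD; congr expR; rewrite /b; move: (Num.sqrt 5 : R) (@vv R) => s v.
    by move: (@sigma2 R) s0 => z z0; field; rewrite gt_eqF.
  move: (gauss _ _) (expR _) (Num.sqrt (pi / sigma2)) ((2 * pi)^-1) ((phi ^- 2) ^+ w) => g e z i p; ring.
under eq_Rintegral do rewrite E.
rewrite RintegralZl// Ig /c.
have -> : (phi ^- 2) ^+ w * (2 * pi)^-1 * ((2 * pi)^-1 * Num.sqrt (pi / sigma2)) *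
    Num.sqrt (pi / b) = (phi ^- 2) ^+ w * ((2 * pi)^-1 ^+ 2 *
    Num.sqrt (pi / sigma2 * (pi / b))).
  rewrite [in RHS]sqrtrM ?divr_ge0 ?(ltW p0) ?(ltW s0)//.
  move: (Num.sqrt (pi / sigma2)) (Num.sqrt (pi / b)) ((2 * pi)^-1) ((phi ^- 2) ^+ w) => g e i p; ring.
congr (_ * _).
have -> : pi / sigma2 * (pi / b) = (Num.sqrt 5 / 10)^-1.
  have -> : pi / sigma2 * (pi / b) = pi ^+ 2 / (b * sigma2).
    move: (@pi R) => p; field; by rewrite !gt_eqF.
  rewrite bs; move: (Num.sqrt (5 : R)) q0 => s q0; move: (@pi R) p0 => p p0.
  by field; rewrite !gt_eqF.
rewrite sqrtrV ?divr_ge0 ?(ltW q0)//.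
have : Num.sqrt (Num.sqrt 5 / 10) != 0 :> R by rewrite gt_eqF// sqrtr_gt0 divr_gt0.
by move: (Num.sqrt _) => s s1; move: (@pi R) p0 => p p0; field; rewrite s1 gt_eqF.
Qed.

(** The 20 is [4 pi^2], from the Gaussian double integral, divided by the limit [pi^2 / 5] of
    [t^2 n]. Both sides are nonnegative and their squares are compared. *)
Lemma constantE : 20 * Num.sqrt (Num.sqrt 5 / 10) = 2 * Num.sqrt 2 * 5 `^ (3 / 4) :> R.
Proof.
have q0 : 0 <= Num.sqrt 5 :> R by exact: sqrtr_ge0.
apply: (@pexpIrn _ 2); rewrite ?nnegrE ?mulr_ge0 ?sqrtr_ge0 ?powR_ge0//.
rewrite !exprMn !sqr_sqrtr ?divr_ge0//.
have -> : (5 `^ (3 / 4)) ^+ 2 = 5 * Num.sqrt 5 :> R.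
  rewrite -powR_mulrn ?powR_ge0// -powRrM.
  have -> : 3 / 4 * 2%:R = 1 + 2^-1 :> R by field.
  by rewrite powRD ?powRr1 ?powR12_sqrt// pnatr_eq0 implybT.
by move: (Num.sqrt _) => s; field.
Qed.

Lemma cvg_stack_sum w : stack_sum w n * (n%:R * expR (- (2 * pi * Num.sqrt (n%:R / 5))))
  @[n --> \oo] --> (phi ^- 2) ^+ w / (2 * Num.sqrt 2 * 5 `^ (3 / 4)).
Proof.
have [C C0 HC] := coef_dominated w.
have e8 : 0 < 8^-1 :> R by rewrite invr_gt0.
have iG : mu.-integrable setT (EFin \o (fun x : R => C * gauss 8^-1 x)).
  exact: (integrableZl measurableT _ (integrable_integral_gauss e8).1).
have dom : \forall n \near \oo, forall x,
    `|step_fun (M n)%:R (r n) (coef w n) n x| <= C * gauss 8^-1 x.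
  apply: filterS HC => n H x.
  have [[m [mn cx]]|no] := pselect (exists m, (0 < m <= n)%N /\ cell (M n)%:R (r n) m x).
    by rewrite (step_fun_in _ (sqrt_saddle_gt0 n) mn cx); exact: H.
  rewrite step_fun_out ?normr0 ?mulr_ge0 ?expR_ge0 ?(ltW C0)// => m mn cx.
  by apply: no; exists m.
have ms n : measurable_fun setT (step_fun (M n)%:R (r n) (coef w n) n).
  exact: measurable_step_fun (sqrt_saddle_gt0 n).
have [_ L] := Rintegral_dominated ms (@cvg_step_fun w) iG dom.
rewrite integral_coef_lim in L.
have {}L : stack_sum w n * expR (- (n%:R * t n + pi ^+ 2 / 5 / t n)) / t n ^+ 2
    @[n --> \oo] --> (phi ^- 2) ^+ w / (4 * pi ^+ 2 * Num.sqrt (Num.sqrt 5 / 10)).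
  by under eq_fun do rewrite stack_sum_integral.
have Lx : expR (n%:R * t n + pi ^+ 2 / 5 / t n - 2 * pi * Num.sqrt (n%:R / 5))
    @[n --> \oo] --> (1 : R).
  apply: cvg_eq (expR0 R); apply: (@cvg_fun _ _ _ _ _ expR); first exact: continuous_expR.
  exact: cvg_saddle_exponent.
have -> : (fun n => stack_sum w n * (n%:R * expR (- (2 * pi * Num.sqrt (n%:R / 5))))) =
  (fun n => stack_sum w n * expR (- (n%:R * t n + pi ^+ 2 / 5 / t n)) / t n ^+ 2 *
    (t n ^+ 2 * n%:R) * expR (n%:R * t n + pi ^+ 2 / 5 / t n - 2 * pi * Num.sqrt (n%:R / 5))) :> (nat -> R).
  apply/funext => n; rewrite expRD [expR (- (_ + _))]expRN.
  have := expR_gt0 (n%:R * t n + pi ^+ 2 / 5 / t n); have := @saddle_gt0 R n.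
  move: (expR (_ + _)) => e; move: (expR _) => f; move: (t n) => s; move: (stack_sum w n) => S.
  by move=> s0 e0; field; rewrite !gt_eqF.
apply: (cvg_eq (cvgM (cvgM L cvg_saddle_sqr) Lx)); rewrite -constantE.
have : 0 < Num.sqrt (Num.sqrt 5 / 10) :> R by rewrite sqrtr_gt0 divr_gt0// sqrtr_gt0.
have := pi_gt0 R; move: (_ ^+ w) => z; move: (Num.sqrt _) => s; move: (@pi R) => p p0 s0.
by field; rewrite !gt_eqF.
Qed.

End StackAsymptotics.

Theorem theorem1p1 (R : realType) :
  asymp_equiv (fun n : nat => (h n)%:R : R)
    (fun n : nat => (phi R)^-1 / (2 * Num.sqrt 2 * 5 `^ (3 / 4) * n%:R)
                    * expR (2 * pi * Num.sqrt (n%:R / 5)))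
  /\
  asymp_equiv (fun n : nat => (hs n)%:R : R)
    (fun n : nat => phi R * (h n)%:R).

Proof.
pose k : R := 2 * Num.sqrt 2 * 5 `^ (3 / 4).
have k0 : 0 < k by rewrite !mulr_gt0 ?sqrtr_gt0 ?powR_gt0.
(* The normalisation under which both sums, and hence [h] and [hs], have nonzero limits. *)
pose Z n : R := n%:R * expR (- (2 * pi * Num.sqrt (n%:R / 5))).
have Z0 n : (0 < n)%N -> Z n != 0 by move=> n0; rewrite gt_eqF// mulr_gt0 ?expR_gt0 ?ltr0n.
have p1 := @phi_gt1 R; have p2 := @phi_sqr R.
have p0 : 0 < phi R by exact: lt_trans p1.
have L0 : stack_sum 0 n * Z n @[n --> \oo] --> k^-1.
  by apply: (cvg_eq (@cvg_stack_sum R 0)); rewrite expr0 mul1r.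
have L1 : stack_sum 1 n * Z n @[n --> \oo] --> phi R ^- 2 / k.
  by apply: (cvg_eq (@cvg_stack_sum R 1)); rewrite expr1.
have Lh : (h n)%:R * Z n @[n --> \oo] --> (phi R)^-1 / k.
  apply: (@cvg_eq _ _ _ _ (k^-1 - phi R ^- 2 / k)).
    apply: cvg_trans (cvgB L0 L1); apply: near_eq_cvg; exists 1%N => // n /= n0.
    by rewrite h_stack_sum// mulrBl.
  have -> : k^-1 - phi R ^- 2 / k = (phi R ^+ 2 - 1) / (phi R ^+ 2 * k).
    by move: (phi R) p0 => p p0; field; rewrite !gt_eqF.
  rewrite {1}p2 addrK; move: (phi R) p0 => p p0.
  by field; rewrite !gt_eqF.
have Lhs : (hs n)%:R * Z n @[n --> \oo] --> k^-1.
  apply: cvg_trans L0; apply: near_eq_cvg; exists 1%N => // n /= n0.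
  by rewrite hs_stack_sum.
split; rewrite /asymp_equiv.
  apply: (@cvg_eq _ _ _ _ ((phi R)^-1 / k * (k * phi R))); last first.
    by field; rewrite !gt_eqF.
  apply: cvg_trans (cvgM Lh (cvg_cst (k * phi R))); apply: near_eq_cvg; exists 1%N => // n /= n0.
  rewrite -/k /Z expRN; have := expR_gt0 (2 * pi * Num.sqrt (n%:R / 5) : R).
  have : 0 < n%:R :> R by rewrite ltr0n.
  move: (expR _) => e; move: (n%:R : R) ((h n)%:R : R) => a b; move: (phi R) p0 => p p0.
  by move=> a0 e0; field; rewrite !gt_eqF.
apply: (@cvg_eq _ _ _ _ (k^-1 / (phi R * ((phi R)^-1 / k)))); last first.
  by field; rewrite !gt_eqF.
apply: cvg_trans (cvgM Lhs (cvgV _ (cvgM (cvg_cst (phi R)) Lh))); last first.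
  by rewrite mulf_neq0 ?mulf_neq0 ?invr_eq0// gt_eqF.
apply: near_eq_cvg; exists 1%N => // n /= n0.
have := Z0 n n0; move: (Z n) => z z0.
by rewrite /= mulrA [(phi R * _ * z)^-1]invfM mulrA mulrAC mulfK// mulrAC mulfK.
Qed.
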